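(* Let $r\ge 1$, let $w\in F_r$ be a non-trivial word, let $\epsilon>0$, and let $n>\max\{8\ell(w),16\}$. Let $\mathsf{G}_1,\ldots,\mathsf{G}_r$ be independent Haar-distributed random elements of $\mathrm{U}_n$. Then $$\mathbb{P}\left(w_{\mathrm{U}_n}(\mathsf{G}_1,\ldots,\mathsf{G}_r)\text{ is not }\left(\tfrac12,\epsilon\right)\text{-spread}\right)<2^{3n^2}\epsilon^{\frac{n^2}{16(\ell(w)+1)}}.$$
   Context: $F_r$ is the free group on $x_1,\ldots,x_r$; words are assumed reduced and $\ell(w)$ is the length of $w$. $w_{\mathrm{U}_n}:\mathrm{U}_n^r\to \mathrm{U}_n$ is the word map obtained by substituting $x_i\leftarrow g_i$ in $w$. An element $g\in\mathrm{U}_n$ is $(\frac12,\epsilon)$-spread if no arc of diameter $2\epsilon$ in the unit circle $\mathrm{U}_1$ contains more than $\frac12 n$ of the eigenvalues of $g$ (eigenvalues counted with multiplicity; the diameter of an arc is its arc length, i.e. its angle). *)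

(* Defs.v *)
From HB Require Import structures.
From mathcomp Require Import all_boot all_order all_algebra all_fingroup.
From mathcomp Require Import all_classical all_reals all_analysis.
From mathcomp Require Import complex.

Set Implicit Arguments.
Unset Strict Implicit.
Unset Printing Implicit Defensive.

Import Order.TTheory GRing.Theory Num.Theory.

Local Open Scope classical_set_scope.
Local Open Scope ring_scope.
Local Open Scope complex_scope.

(* Elements of the free group on x_0, ..., x_(r-1) are represented by their
   reduced words; the letter (i, true) is x_i and (i, false) is x_i^-1. *)
Definition word (r : nat) := seq ('I_r * bool).

Definition reduced (r : nat) (w : word r) : bool :=
  sorted (fun a b : 'I_r * bool => b != (a.1, ~~ a.2)) w.

Definition word_map (r : nat) (gT : groupType) (w : word r) (g : 'I_r -> gT)
    : gT :=
  (\big[*%g/1]_(a <- w) (if a.2 then g a.1 else (g a.1)^-1))%g.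

Record unitary (R : realType) (n : nat) := Unitary {
  umx :> 'M[R[i]]_n ;
  _ : umx \is unitarymx }.

Section unitary_group.
Context {R : realType} {n : nat}.
Local Notation U := (unitary R n).
Implicit Types g h : U.

HB.instance Definition _ := [isSub for @umx R n].
HB.instance Definition _ := [Choice of U by <:].

Lemma umxP g : umx g \is unitarymx. Proof. exact: valP. Qed.

Lemma umx1_subproof : (1%:M : 'M[R[i]]_n) \is unitarymx.
Proof. by apply/unitarymxP; rewrite trmx1 map_mx1 mulmx1. Qed.

Definition uone : U := Unitary umx1_subproof.
Definition umul g h : U := Unitary (mul_unitarymx (umxP g) (umxP h)).

Lemma umxV_subproof g : invmx (umx g) \is unitarymx.
Proof. by rewrite invmx_unitary ?umxP// trmxC_unitary umxP. Qed.

Definition uinv g : U := Unitary (umxV_subproof g).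

Lemma umulA : associative umul.
Proof. by move=> g h k; apply/val_inj; exact: mulmxA. Qed.

Lemma umul1g : left_id uone umul.
Proof. by move=> g; apply/val_inj; exact: mul1mx. Qed.

Lemma umulg1 : right_id uone umul.
Proof. by move=> g; apply/val_inj; exact: mulmx1. Qed.

Lemma umulVg : left_inverse uone uinv umul.
Proof.
by move=> g; apply/val_inj; apply: mulVmx; exact: unitarymx_unit (umxP g).
Qed.

Lemma umulgV : right_inverse uone uinv umul.
Proof.
by move=> g; apply/val_inj; apply: mulmxV; exact: unitarymx_unit (umxP g).
Qed.

HB.instance Definition _ := isGroup.Build U umulA umul1g umulg1 umulVg umulgV.

(* The subspace topology inherited from 'M[R[i]]_n; the topology of R[i] given
   by its modulus is the one carried by R[i]^o. *)
HB.instance Definition _ :=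
  Topological.copy U (initial_topology (@umx R n : U -> 'M[R[i]^o]_n)).

HB.instance Definition _ := isPointed.Build U uone.

(* The Borel sigma-algebra. *)
HB.instance Definition _ :=
  Measurable.copy U (g_sigma_algebraType (@open U)).

End unitary_group.

(* The Haar probability measure of the compact group is the Borel probability
   measure that is invariant under left translations. *)
Definition is_haar (R : realType) (n : nat)
    (mu : probability (unitary R n) R) : Prop :=
  forall (g : unitary R n) (A : set (unitary R n)), measurable A ->
    mu [set (g * h)%g | h in A] = mu A.

Definition mutually_independent (R : realType) (d d' : measure_display)
    (Omega : measurableType d) (T : measurableType d')
    (P : probability Omega R) (I : finType) (X : I -> {mfun Omega >-> T})
    : Prop :=
  forall (J : {set I}) (A : I -> set T), (forall i, measurable (A i)) ->
    P (\bigcap_(i in [set` J]) X i @^-1` A i) =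
    (\big[*%E/1]_(i in J) P (X i @^-1` A i))%E.

Definition eigenvalues (R : realType) (n : nat) (g : 'M[R[i]]_n) : seq R[i] :=
  sval (closed_field_poly_normal (char_poly g)).

Lemma char_poly_eigenvalues (R : realType) (n : nat) (g : 'M[R[i]]_n) :
  char_poly g = \prod_(z <- eigenvalues g) ('X - z%:P).
Proof.
rewrite /eigenvalues; case: closed_field_poly_normal => s /= {1}->.
by rewrite (monicP (char_poly_monic g)) scale1r.
Qed.

(* The closed arc of the unit circle of angular length l starting at the angle
   a; it is the whole circle when l >= 2 pi. *)
Definition arc (R : realType) (a l : R) : set R[i] :=
  [set cos t +i* sin t | t in `[a, a + l]].

Definition spread (R : realType) (n : nat) (alpha eps : R) (g : unitary R n)
    : Prop :=
  forall a : R,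
    (count (fun z => z \in arc a (2 * eps)) (eigenvalues g))%:R
      <= alpha * n%:R.

(* Main.v *)
Require Import Defs.
From HB Require Import structures.
From mathcomp Require Import all_boot all_order all_algebra all_fingroup.
From mathcomp Require Import all_classical all_reals all_analysis.
From mathcomp Require Import measurable_realfun complex.
From mathcomp Require Import zify ring lra.

(** Write [l] for the length of [w], [L = l + 1] and [k] for the integer part of
    [n / (4 L)]. Unitary matrices act on row vectors, from the right.

    Suppose that [g = w(G)] is not spread. Then more than half of its eigenvalues
    lie within [eps] of a point [c] of the circle, and counting linear
    conditions yields unit vectors that are supported on the first [D] basis
    vectors, [D] being about [n / 2 + k], are orthogonal to fewer than [k]
    prescribed vectors, and satisfy [|v g - c v| <= eps]. Choosing [k] such
    vectors one after the other and rounding them to points of an [eps]-net of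
    the unit sphere of [C^D] gives net points [v_1, ..., v_k] which are uniformly
    independent and which [g] maps to within squared distance [10 eps ^ 2] of
    their span ([exists_almost_eigenframe]). The net has about [eps ^ (- 2 D)]
    points ([sphere_net]), and the theorem follows from a union bound
    ([nonspread_bound]) once this event is controlled for fixed vectors.

    For fixed vectors the trajectories of [v_1, ..., v_k] under the successive
    letters of [w] are exposed one vector at a time. Given the past, the matrix
    of a letter is [a K b] with [K] uniform among the unitary matrices that fix
    some first basis vectors ([consistent]). Since [w] is reduced, a letter is
    never applied just after its inverse; hence the part of a vector on which
    the letter is not yet determined is at least as large as the distance from
    this vector to the vectors before it ([gap_undetermined]), and this part is
    sent to a uniform direction. The squared distance [x] of the image to the
    span of the past is therefore comparable to a beta variable, whose negative
    moment of order [s = n - k L] is at most [2 ^ n] as long as at most [k L]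
    vectors have been exposed ([moment_bound]). Consequently the product over
    the last [k] vectors of the weights [(x + e2) ^ (- s)] grows in mean at most
    by the factor [2 ^ n] at each step ([step_undetermined]). It is at most
    [4 ^ (s k)] at the start, because the vectors are uniformly independent,
    and at least [(2 e2) ^ (- s k)] at the end on the event. With [e2] equal to
    [10 eps ^ 2] the probability is bounded by a constant times
    [eps ^ (2 s k)] ([ends_bound]).

    Altogether the exponent of [eps] is [2 (s - D) k], which is at least
    [n ^ 2 / (16 L)] for the chosen [k], and the constants multiply to less than
    [2 ^ (3 n ^ 2)] ([parametersP]). For [eps >= 1 / 2] the claimed bound exceeds
    one.

    The moment bound is proved by integration by parts on the group: the mean
    of a function of a uniform vector does not change when two coordinates are
    rotated, and the derivative in the angle gives a recursion between the
    moments ([esp_stein], [esp_W_rec]). *)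

Set Implicit Arguments.
Unset Strict Implicit.
Unset Printing Implicit Defensive.

Import Order.TTheory GRing.Theory Num.Theory.
Import numFieldNormedType.Exports.

Local Open Scope classical_set_scope.
Local Open Scope ring_scope.
Local Notation Re := (@complex.Re _).
Local Notation Im := (@complex.Im _).

(** * Measurability of complex-valued maps and of maps into the unitary group *)

Section cmeas.
Context {R : realType} d (T : measurableType d).
Implicit Types f g : T -> R[i].

Definition sqn (z : R[i]) : R := Re z ^+ 2 + Im z ^+ 2.

Definition cmeas f : Prop :=
  measurable_fun setT (fun t => Re (f t)) /\
  measurable_fun setT (fun t => Im (f t)).

Lemma cmeas_cst z : cmeas (fun=> z).
Proof. by split; exact: measurable_cst. Qed.

Lemma cmeasD f g : cmeas f -> cmeas g -> cmeas (fun t => f t + g t).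
Proof.
move=> [f1 f2] [g1 g2]; split.
- rewrite (_ : (fun _ => _) = (fun t => Re (f t) + Re (g t))).
    exact: measurable_funD.
  by apply/funext => t; case: (f t) => ? ?; case: (g t).
- rewrite (_ : (fun _ => _) = (fun t => Im (f t) + Im (g t))).
    exact: measurable_funD.
  by apply/funext => t; case: (f t) => ? ?; case: (g t).
Qed.

Lemma cmeasN f : cmeas f -> cmeas (fun t => - f t).
Proof.
move=> [f1 f2]; split.
- rewrite (_ : (fun _ => _) = (fun t => - Re (f t))).
    exact: measurableT_comp.
  by apply/funext => t; case: (f t).
- rewrite (_ : (fun _ => _) = (fun t => - Im (f t))).
    exact: measurableT_comp.
  by apply/funext => t; case: (f t).
Qed.

Lemma cmeasM f g : cmeas f -> cmeas g -> cmeas (fun t => f t * g t).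
Proof.
move=> [f1 f2] [g1 g2]; split.
- rewrite (_ : (fun _ => _) =
      (fun t => Re (f t) * Re (g t) - Im (f t) * Im (g t))).
    by apply: measurable_funB; apply: measurable_funM.
  by apply/funext => t; case: (f t) => ? ?; case: (g t).
- rewrite (_ : (fun _ => _) =
      (fun t => Re (f t) * Im (g t) + Im (f t) * Re (g t))).
    by apply: measurable_funD; apply: measurable_funM.
  by apply/funext => t; case: (f t) => ? ?; case: (g t).
Qed.

Lemma cmeasJ f : cmeas f -> cmeas (fun t => (f t)^*).
Proof.
move=> [f1 f2]; split.
- rewrite (_ : (fun _ => _) = (fun t => Re (f t)))//.
  by apply/funext => t; case: (f t).
- rewrite (_ : (fun _ => _) = (fun t => - Im (f t))).
    exact: measurableT_comp.
  by apply/funext => t; case: (f t).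
Qed.

Lemma measurable_sqn f : cmeas f -> measurable_fun setT (fun t => sqn (f t)).
Proof.
by move=> [f1 f2]; apply: measurable_funD; exact: measurable_funX.
Qed.

(** The inverse of [x ^+ 2] is a real power of a nonnegative number, and real
    powers are measurable. *)
Lemma measurable_invr (f : T -> R) :
  measurable_fun setT f -> measurable_fun setT (fun t => (f t)^-1).
Proof.
move=> mf.
rewrite (_ : (fun _ => _) = (fun t => f t * (f t ^+ 2)^-1)).
  apply: measurable_funM => //.
  rewrite (_ : (fun _ => _) = (fun t => (f t ^+ 2) `^ (-1))).
    by apply: measurableT_comp (measurable_powR _) _; exact: measurable_funX.
  by apply/funext => t; rewrite powR_inv1// sqr_ge0.
apply/funext => t; have [->|f0] := eqVneq (f t) 0; first by rewrite invr0 mul0r.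
by rewrite expr2 invfM mulrA divff// mul1r.
Qed.

Lemma cmeasV f : cmeas f -> cmeas (fun t => (f t)^-1).
Proof.
move=> mf; have ms := measurable_invr (measurable_sqn mf).
case: mf => f1 f2; split.
- rewrite (_ : (fun _ => _) = (fun t => Re (f t) * (sqn (f t))^-1)).
    exact: measurable_funM.
  by apply/funext => t; case: (f t).
- rewrite (_ : (fun _ => _) = (fun t => - (Im (f t) * (sqn (f t))^-1))).
    by apply: measurableT_comp => //; exact: measurable_funM.
  by apply/funext => t; case: (f t).
Qed.

Lemma cmeas_sum (I : Type) (s : seq I) (p : pred I) (F : I -> T -> R[i]) :
  (forall i, cmeas (F i)) -> cmeas (fun t => \sum_(i <- s | p i) F i t).
Proof.
move=> mF; elim: s => [|i s ih].
  by under eq_fun do rewrite big_nil; exact: cmeas_cst.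
under eq_fun do rewrite big_cons.
by case: (p i) => //; exact: cmeasD.
Qed.

End cmeas.

Section mxmeas.
Context {R : realType} d (T : measurableType d).

Definition mxmeas m n (F : T -> 'M[R[i]]_(m, n)) : Prop :=
  forall i j, cmeas (fun t => F t i j).

Lemma mxmeas_cst m n (A : 'M[R[i]]_(m, n)) : mxmeas (fun=> A).
Proof. by move=> i j; exact: cmeas_cst. Qed.

Lemma mxmeasM m n p (F : T -> 'M[R[i]]_(m, n)) (G : T -> 'M[R[i]]_(n, p)) :
  mxmeas F -> mxmeas G -> mxmeas (fun t => F t *m G t).
Proof.
move=> mF mG i j; under eq_fun do rewrite mxE.
by apply: cmeas_sum => k; exact: cmeasM.
Qed.

Lemma mxmeasD m n (F G : T -> 'M[R[i]]_(m, n)) :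
  mxmeas F -> mxmeas G -> mxmeas (fun t => F t + G t).
Proof. by move=> mF mG i j; under eq_fun do rewrite mxE; exact: cmeasD. Qed.

Lemma mxmeasN m n (F : T -> 'M[R[i]]_(m, n)) :
  mxmeas F -> mxmeas (fun t => - F t).
Proof. by move=> mF i j; under eq_fun do rewrite mxE; exact: cmeasN. Qed.

Lemma mxmeasZ m n (a : T -> R[i]) (F : T -> 'M[R[i]]_(m, n)) :
  cmeas a -> mxmeas F -> mxmeas (fun t => a t *: F t).
Proof. by move=> ma mF i j; under eq_fun do rewrite mxE; exact: cmeasM. Qed.

Lemma mxmeasJ m n (F : T -> 'M[R[i]]_(m, n)) :
  mxmeas F -> mxmeas (fun t => (F t)^t*%sesqui).
Proof. by move=> mF i j; under eq_fun do rewrite !mxE; exact: cmeasJ. Qed.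

End mxmeas.

Section unitary_measurable.
Context {R : realType} {n : nat}.
Local Notation U := (unitary R n).

Let qc (q : rat * rat) : R[i] := (ratr q.1 +i* ratr q.2)%C.

Lemma sqn_normc (z : R[i]) : `|z| ^+ 2 = (sqn z)%:C%C.
Proof. by rewrite -add_Re2_Im2. Qed.

Lemma ltr_normc_sqn (z : R[i]) (e : R) : 0 < e ->
  (`|z| < e%:C%C) = (sqn z < e ^+ 2).
Proof.
move=> e0; rewrite -(@ltr_pXn2r _ 2) ?nnegrE ?normr_ge0//; last first.
  by rewrite (lecR 0 e) ltW.
by rewrite sqn_normc -rmorphXn ltcR.
Qed.

Lemma ltr_sqnD (z w : R[i]) (e : R) : 0 < e ->
  sqn z < e ^+ 2 -> sqn w < e ^+ 2 -> sqn (z + w) < (e + e) ^+ 2.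
Proof.
move=> e0; rewrite -!ltr_normc_sqn// ?addr_gt0// => ze we.
by rewrite rmorphD; apply: le_lt_trans (ler_normD _ _) _; exact: ltrD.
Qed.

Lemma rat_approx (z : R[i]) (e : R) : 0 < e ->
  exists q, sqn (qc q - z) < e ^+ 2.
Proof.
case: z => a b e0.
have e20 : 0 < e / 2 by rewrite divr_gt0.
have aux (c : R) : exists q : rat, (ratr q - c) ^+ 2 < (e / 2) ^+ 2.
  have [q] := @rat_in_itvoo _ (c - e / 2) (c + e / 2) ltac:(lra).
  rewrite in_itv/= => /andP[q1 q2]; exists q.
  rewrite -real_normK ?num_real// ltr_pXn2r ?nnegrE ?normr_ge0 ?ltW//.
  by rewrite ltr_norml; apply/andP; split; lra.
have [q1 h1] := aux a; have [q2 h2] := aux b.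
exists (q1, q2); rewrite /sqn /=.
rewrite expr_div_n in h1 h2; nra.
Qed.

(** Rational boxes form a countable base of the topology, so that the Borel
    sigma-algebra is the one generated by the matrix entries. *)
Lemma measurable_unitaryP d (T : measurableType d) (F : T -> U) :
  measurable_fun setT F <-> mxmeas (fun t => umx (F t)).
Proof.
split=> [mF i j|mF].
  have mC (f : U -> R) : continuous f -> measurable_fun setT (f \o F).
    move=> cf; apply: measurableT_comp mF.
    apply: (measurability _ (RGenOpens.measurableE R)) => _ [_ [a [b ->] <-]].
    rewrite setTI; apply: sub_sigma_algebra.
    by move/continuousP : cf; apply; exact: interval_open.
  have cE : continuous (fun g : U => (umx g i j : R[i]^o)).
    move=> g; apply: (@continuous_comp _ _ _ (@umx R n : U -> 'M[R[i]^o]_n)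
      (fun M : 'M[R[i]^o]_n => M i j)).
      exact: initial_continuous.
    exact: coord_continuous.
  have cRe : continuous (complex.Re (R:=R) : R[i]^o -> R).
    move=> z A /nbhs_ballP[e /= e0 eA]; apply/nbhs_ballP.
    exists (e%:C)%C => /=; first by rewrite (ltcR 0 e).
    move=> w; rewrite -ball_normE /= ltr_normc_sqn// /sqn => h; apply: eA.
    rewrite -ball_normE /= -(@ltr_pXn2r _ 2) ?nnegrE ?normr_ge0 ?ltW//.
    rewrite real_normK ?num_real//; apply: le_lt_trans h.
    by case: z => ? ?; case: w => ? ? /=; rewrite lerDl sqr_ge0.
  have cIm : continuous (complex.Im (R:=R) : R[i]^o -> R).
    move=> z A /nbhs_ballP[e /= e0 eA]; apply/nbhs_ballP.
    exists (e%:C)%C => /=; first by rewrite (ltcR 0 e).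
    move=> w; rewrite -ball_normE /= ltr_normc_sqn// /sqn => h; apply: eA.
    rewrite -ball_normE /= -(@ltr_pXn2r _ 2) ?nnegrE ?normr_ge0 ?ltW//.
    rewrite real_normK ?num_real//; apply: le_lt_trans h.
    by case: z => ? ?; case: w => ? ? /=; rewrite lerDr sqr_ge0.
  split.
  - apply: (mC (fun g => Re (umx g i j))) => g.
    by apply: (@continuous_comp _ _ _ (fun g : U => (umx g i j : R[i]^o)));
      [exact: cE|exact: cRe].
  - apply: (mC (fun g => Im (umx g i j))) => g.
    by apply: (@continuous_comp _ _ _ (fun g : U => (umx g i j : R[i]^o)));
      [exact: cE|exact: cIm].
apply: (@measurability _ _ _ _ _ F (@open U)) => // _ [_ [B oB <-] <-].
rewrite setTI.
pose I : countType := ('M[rat * rat]_n * nat)%type.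
pose bx (p : I) : set 'M[R[i]^o]_n :=
  [set M | forall i j, sqn (qc (p.1 i j) - M i j) < (p.2.+1%:R^-1) ^+ 2].
rewrite (_ : _ @^-1` _ = \bigcup_(p in [set p | bx p `<=` B])
    [set t | bx p (umx (F t))]).
  rewrite bigcup_mkcond; apply: countable_bigcupT_measurable => [|p]; first exact: countableP.
  case: ifPn => _ //.
  rewrite (_ : [set _ | _] = \bigcap_(ij in [set: 'I_n * 'I_n])
    [set t | sqn (qc (p.1 ij.1 ij.2) - umx (F t) ij.1 ij.2) <
      (p.2.+1%:R^-1) ^+ 2]).
    apply: fin_bigcap_measurable => // -[i j] _ /=.
    rewrite -[X in measurable X]setTI; apply: measurable_fun_ltr => //.
    by apply: measurable_sqn; apply: cmeasD; [exact: cmeas_cst|exact: cmeasN].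
  by apply/seteqP; split => [t h [i j] _ //=|t h i j]; exact: (h (i, j)).
apply/seteqP; split => [t /= Bt|t [p pB]]; last exact: pB.
have /nbhs_ballP[e /= e0 eB] : nbhs (umx (F t) : 'M[R[i]^o]_n) B.
  exact: open_nbhs_nbhs.
have [e' ee' e'0] : exists2 e' : R, e = e'%:C%C & 0 < e'.
  move: e0; case: (e) => a b; rewrite ltcE /= => /andP[/eqP-> a0].
  by exists a.
have [k ke] : exists k, k.+1%:R^-1 < e' / 2.
  have [k _ /(_ k (leqnn k)) /= ke] := near_infty_natSinv_lt (PosNum (divr_gt0 e'0 (ltr0Sn R 1))).
  by exists k.
have k0 : 0 < k.+1%:R^-1 :> R by rewrite invr_gt0.
pose q := \matrix_(i, j) sval (cid (rat_approx (umx (F t) i j) k0)).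
exists (q, k); last by move=> i j; rewrite mxE; case: cid.
move=> M /= h; apply: eB; split => // i j.
rewrite -ball_normE /= ee' ltr_normc_sqn//.
have -> : umx (F t) i j - M i j =
    (qc (q i j) - M i j) + - (qc (q i j) - umx (F t) i j).
  by rewrite opprB [RHS]addrC addrA subrK.
apply: lt_trans (ltr_sqnD k0 (h i j) _) _.
  rewrite mxE; case: cid => x /=.
  by case: (qc x - _) => ? ?; rewrite /sqn /= !sqrrN.
rewrite ltr_pXn2r ?nnegrE ?addr_ge0//; [|exact: ltW..].
by rewrite (splitr e') ltrD.
Unshelve. all: end_near. Qed.

End unitary_measurable.

(** * Haar probability measures on subgroups of a power of the unitary group *)

Section tuple_group.
Context {R : realType} {n r : nat}.
Local Notation U := (unitary R n).
Local Notation Gam := (r.-tuple U).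
Implicit Types a b c : Gam.

Definition tmul a b : Gam := [tuple (tnth a i * tnth b i)%g | i < r].
Definition tinv a : Gam := [tuple ((tnth a i)^-1)%g | i < r].
Definition tone : Gam := [tuple (1%g : U) | i < r].

Lemma tnth_tmul a b i : tnth (tmul a b) i = (tnth a i * tnth b i)%g.
Proof. by rewrite tnth_mktuple. Qed.

Lemma tnth_tinv a i : tnth (tinv a) i = ((tnth a i)^-1)%g.
Proof. by rewrite tnth_mktuple. Qed.

Lemma tnth_tone i : tnth tone i = 1%g.
Proof. by rewrite tnth_mktuple. Qed.

Lemma tmulA : associative tmul.
Proof. by move=> a b c; apply: eq_from_tnth => i; rewrite !tnth_tmul mulgA. Qed.

Lemma tmul1g : left_id tone tmul.
Proof.
by move=> a; apply: eq_from_tnth => i; rewrite tnth_tmul tnth_tone mul1g.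
Qed.

Lemma tmulg1 : right_id tone tmul.
Proof.
by move=> a; apply: eq_from_tnth => i; rewrite tnth_tmul tnth_tone mulg1.
Qed.

Lemma tmulVg : left_inverse tone tinv tmul.
Proof.
move=> a; apply: eq_from_tnth => i.
by rewrite tnth_tmul tnth_tinv tnth_tone mulVg.
Qed.

Lemma tinvM a b : tinv (tmul a b) = tmul (tinv b) (tinv a).
Proof.
by apply: eq_from_tnth => i; rewrite !(tnth_tmul, tnth_tinv) invMg.
Qed.

Lemma tinvK : involutive tinv.
Proof. by move=> a; apply: eq_from_tnth => i; rewrite !tnth_tinv invgK. Qed.

Lemma umxM (g h : U) : umx (g * h)%g = umx g *m umx h. Proof. by []. Qed.

Lemma umxV (g : U) : umx (g^-1)%g = (umx g)^t*%sesqui.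
Proof. by rewrite -invmx_unitary// umxP. Qed.

Lemma measurable_umul d (T : measurableType d) (F G : T -> U) :
  measurable_fun setT F -> measurable_fun setT G ->
  measurable_fun setT (fun t => (F t * G t)%g).
Proof.
move=> /measurable_unitaryP mF /measurable_unitaryP mG.
by apply/measurable_unitaryP; exact: mxmeasM.
Qed.

Lemma measurable_uinv d (T : measurableType d) (F : T -> U) :
  measurable_fun setT F -> measurable_fun setT (fun t => (F t)^-1%g).
Proof.
move=> /measurable_unitaryP mF; apply/measurable_unitaryP.
under eq_fun do rewrite umxV; exact: mxmeasJ.
Qed.

Lemma measurable_tmul d (T : measurableType d) (F G : T -> Gam) :
  measurable_fun setT F -> measurable_fun setT G ->
  measurable_fun setT (fun t => tmul (F t) (G t)).
Proof.
move=> /measurable_fun_tnthP mF /measurable_fun_tnthP mG.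
apply/measurable_fun_tnthP => i.
rewrite (_ : _ \o _ = (fun t => tnth (F t) i * tnth (G t) i)%g).
  by apply: measurable_umul; [exact: mF|exact: mG].
by apply/funext => t /=; rewrite tnth_tmul.
Qed.

Lemma measurable_tinv d (T : measurableType d) (F : T -> Gam) :
  measurable_fun setT F -> measurable_fun setT (fun t => tinv (F t)).
Proof.
move=> /measurable_fun_tnthP mF; apply/measurable_fun_tnthP => i.
rewrite (_ : _ \o _ = (fun t => (tnth (F t) i)^-1)%g).
  by apply: measurable_uinv; exact: mF.
by apply/funext => t /=; rewrite tnth_tinv.
Qed.

End tuple_group.

Section full_measure.
Context {R : realType} d (T : measurableType d) (nu : probability T R).
Local Open Scope ereal_scope.

(** A Haar measure on a subgroup lives on all matrix tuples but is carried by
    the subgroup; the next lemmas let a property known on the subgroup only be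
    used under the integral. *)
Lemma full_ae (H : set T) (Q : T -> Prop) : measurable H -> nu H = 1 ->
  (forall x, H x -> Q x) -> {ae nu, forall x, Q x}.
Proof.
move=> mH nuH HQ; exists (~` H); split.
- exact: measurableC.
- by rewrite probability_setC// nuH subee.
- by move=> x /= nQ /HQ.
Qed.

Lemma full_eq_integral (H : set T) (f g : T -> \bar R) :
  measurable H -> nu H = 1 ->
  measurable_fun setT f -> measurable_fun setT g ->
  (forall x, H x -> f x = g x) -> \int[nu]_x f x = \int[nu]_x g x.
Proof.
move=> mH nuH mf mg fg; apply: ae_eq_integral => //.
by apply: full_ae nuH _ => // x Hx _; exact: fg.
Qed.

Lemma full_le_integral (H : set T) (f g : T -> \bar R) :
  measurable H -> nu H = 1 ->
  measurable_fun setT f -> measurable_fun setT g ->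
  (forall x, 0 <= f x) -> (forall x, 0 <= g x) ->
  (forall x, H x -> f x <= g x) -> \int[nu]_x f x <= \int[nu]_x g x.
Proof.
move=> mH nuH mf mg f0 g0 fg; apply: ae_ge0_le_integral => //.
by apply: full_ae nuH _ => // x Hx _; exact: fg.
Qed.

Lemma full_eq_measure (H A B : set T) : measurable H -> nu H = 1 ->
  measurable A -> measurable B -> (forall x, H x -> A x <-> B x) ->
  nu A = nu B.
Proof.
move=> mH nuH mA mB AB.
have E C : measurable C -> nu C = \int[nu]_x (\1_C x)%:E.
  by move=> mC; rewrite integral_indic// setIT.
rewrite !E//.
apply: (full_eq_integral mH nuH).
- by apply/measurable_EFinP; exact: measurable_indic.
- by apply/measurable_EFinP; exact: measurable_indic.
- move=> x Hx; rewrite !indicE; congr (_%:R%:E).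
  by congr nat_of_bool; apply/idP/idP; rewrite !inE => /(AB x Hx).
Qed.

End full_measure.

Section fubini_set.
Context {R : realType} d1 d2 (T1 : measurableType d1) (T2 : measurableType d2).
Variables (m1 : probability T1 R) (m2 : probability T2 R).
Local Open Scope ereal_scope.

Lemma fubini_set (S : set (T1 * T2)) : measurable S ->
  \int[m1]_x m2 [set y | S (x, y)] = \int[m2]_y m1 [set x | S (x, y)].
Proof.
move=> mS.
have := indic_fubini_tonelli m1 m2 mS.
rewrite indic_fubini_tonelli_FE// indic_fubini_tonelli_GE//.
under eq_integral do rewrite /comp xsectionE.
by under [in X in _ = X -> _]eq_integral do rewrite /comp ysectionE.
Qed.

Lemma measurable_fun_section1 (S : set (T1 * T2)) : measurable S ->
  measurable_fun setT (fun x => m2 [set y | S (x, y)]).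
Proof.
move=> mS; have := measurable_fun_xsection m2 mS.
by congr (measurable_fun _ _); apply/funext => x /=; rewrite xsectionE.
Qed.

Lemma measurable_fun_section2 (S : set (T1 * T2)) : measurable S ->
  measurable_fun setT (fun y => m1 [set x | S (x, y)]).
Proof.
move=> mS; have := measurable_fun_ysection m1 mS.
by congr (measurable_fun _ _); apply/funext => x /=; rewrite ysectionE.
Qed.

End fubini_set.

Section haar_subgroup.
Context {R : realType} {n r : nat}.
Local Notation U := (unitary R n).
Local Notation Gam := (r.-tuple U).
Local Open Scope ereal_scope.

Record subgroup (H : set Gam) : Prop := Subgroup {
  subgroup_measurable : measurable H ;
  subgroupM : forall a b, H a -> H b -> H (tmul a b) ;
  subgroupV : forall a, H a -> H (tinv a) }.

(** Haar measures on subgroups are kept as measures on the whole product that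
    give mass one to the subgroup, so that all subgroups share one type. *)
Definition haar_on (H : set Gam) (nu : probability Gam R) : Prop :=
  nu H = 1 /\
  forall h A, H h -> measurable A -> nu [set K | A (tmul h K)] = nu A.

Lemma measurable_preim d (T : measurableType d) d' (T' : measurableType d')
    (f : T -> T') (A : set T') :
  measurable_fun setT f -> measurable A -> measurable [set x | A (f x)].
Proof. by move=> mf mA; rewrite -[X in measurable X]setTI; exact: mf. Qed.

(** Integrating the indicator of [x^-1 y \in A] in both orders compares the
    measure of [A] with that of its set of inverses. *)
Lemma haar_onV H nu : subgroup H -> haar_on H nu ->
  forall A, measurable A -> nu [set K | A (tinv K)] = nu A.
Proof.
move=> sH [nuH inv] A mA; have mH := subgroup_measurable sH.
pose S : set (Gam * Gam) := [set p | A (tmul (tinv p.1) p.2)].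
have mS : measurable S.
  apply: (measurable_preim (f := fun p => tmul (tinv p.1) p.2)) => //.
  by apply: measurable_tmul => //; exact: measurable_tinv.
have mA' : measurable [set K | A (tinv K)].
  by apply: measurable_preim mA; exact: measurable_tinv.
transitivity (\int[nu]_y nu [set x | S (x, y)]).
  rewrite -[LHS]mule1 -(@probability_setT _ _ _ nu) -integral_cst//.
  apply: (full_eq_integral mH nuH) => //.
    exact: measurable_fun_section2.
  move=> y Hy; rewrite -(inv (tinv y) _ (subgroupV sH Hy) mA').
  by congr (nu _); apply/funext => x; rewrite /S/= tinvM tinvK.
rewrite -fubini_set// -[RHS]mule1 -(@probability_setT _ _ _ nu) -integral_cst//.
apply: (full_eq_integral mH nuH) => //.
  exact: measurable_fun_section1.
by move=> x Hx; rewrite -(inv (tinv x) _ (subgroupV sH Hx) mA).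
Qed.

(** Right translations are left translations conjugated by the inversion. *)
Lemma haar_onR H nu : subgroup H -> haar_on H nu ->
  forall h A, H h -> measurable A -> nu [set K | A (tmul K h)] = nu A.
Proof.
move=> sH hnu h A Hh mA.
have mA' : measurable [set K | A (tinv K)].
  by apply: measurable_preim mA; exact: measurable_tinv.
rewrite -[RHS](haar_onV sH hnu mA) -(hnu.2 (tinv h) _ (subgroupV sH Hh) mA').
rewrite -[RHS](haar_onV sH hnu); last first.
  apply: (measurable_preim (f := fun K => tmul (tinv h) K)) => //.
  by apply: measurable_tmul.
by congr (nu _); apply/funext => K /=; rewrite tinvM !tinvK.
Qed.

(** A Haar element [K] of [H] factors as an independent product of the coset
    representative [sigma K] and of a Haar element of the subgroup [H']. *)
Lemma haar_on_coset H H' nu (sigma : Gam -> Gam) :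
  subgroup H -> subgroup H' -> H' `<=` H -> haar_on H nu ->
  measurable_fun setT sigma ->
  (forall h K, H' h -> sigma (tmul h K) = sigma K) ->
  (forall K, H K -> H' (tmul K (tinv (sigma K)))) ->
  exists nu' : probability Gam R, haar_on H' nu' /\
    forall B, measurable B ->
      measurable_fun setT (fun K => nu' [set h | B (tmul h (sigma K))]) /\
      nu B = \int[nu]_K nu' [set h | B (tmul h (sigma K))].
Proof.
move=> sH sH' H'H [nuH inv] ms sigmah sigmaH'.
have mH := subgroup_measurable sH; have mH' := subgroup_measurable sH'.
pose k K := tmul K (tinv (sigma K)).
have mk : measurable_fun setT k.
  by apply: measurable_tmul => //; exact: measurable_tinv.
pose km : {mfun Gam >-> Gam} := HB.pack k (isMeasurableFun.Build _ _ _ _ k mk).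
pose nu' : probability Gam R := distribution nu km.
have nu'E A : nu' A = nu [set K | A (k K)] by [].
have hnu' : haar_on H' nu'.
  split.
    rewrite nu'E -(@probability_setT _ _ _ nu).
    apply: (full_eq_measure mH nuH) => //; first exact: measurable_preim.
    by move=> x Hx; split=> // _; exact: sigmaH'.
  move=> h A H'h mA; rewrite !nu'E.
  rewrite -(inv h [set K | A (k K)] (H'H _ H'h)); last exact: measurable_preim.
  by congr (nu _); apply/funext => K /=; rewrite /k sigmah// tmulA.
exists nu'; split => // B mB.
have mS : measurable [set p : Gam * Gam | B (tmul p.2 (sigma p.1))].
  apply: (measurable_preim (f := fun p => tmul p.2 (sigma p.1))) => //.
  by apply: measurable_tmul => //; exact: measurableT_comp.
have mS1 : measurable [set p : Gam * Gam | B (tmul p.2 p.1)].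
  apply: (measurable_preim (f := fun p => tmul p.2 p.1)) => //.
  exact: measurable_tmul.
split; first exact: (measurable_fun_section1 _ mS).
transitivity (\int[nu']_h nu [set K | B (tmul h K)]).
  rewrite -[LHS]mule1 -(@probability_setT _ _ _ nu') -integral_cst//.
  apply: (full_eq_integral mH' hnu'.1) => //.
    exact: (measurable_fun_section2 _ mS1).
  by move=> h Hh; rewrite inv//; exact: H'H.
rewrite -(fubini_set _ _ mS1); apply: (full_eq_integral mH nuH).
- exact: (measurable_fun_section1 _ mS1).
- exact: (measurable_fun_section1 _ mS).
move=> K HK /=.
rewrite -[RHS](haar_onR sH' hnu' (sigmaH' K HK)); last first.
  apply: (measurable_preim (f := fun h => tmul h (sigma K))) => //.
  exact: measurable_tmul.
congr (nu' _); apply/funext => h /=.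
by rewrite -!tmulA tmulVg tmulg1.
Qed.

End haar_subgroup.

(** * Hermitian geometry of row vectors *)

Section row_geometry.
Context {R : realType} {n : nat}.
Local Notation C := R[i].
Local Notation U := (unitary R n).
Local Notation V := 'rV[C]_n.
Implicit Types (u v x y : V) (g h : U) (q m : nat).

Lemma sqn_ge0 (z : C) : 0 <= sqn z.
Proof. by rewrite addr_ge0 ?sqr_ge0. Qed.

Lemma sqnM (z w : C) : sqn (z * w) = sqn z * sqn w.
Proof. by case: z => a b; case: w => c d; rewrite /sqn/=; ring. Qed.

Lemma sqnN (z : C) : sqn (- z) = sqn z.
Proof. by case: z => a b; rewrite /sqn /= !sqrrN. Qed.

Lemma sqn0 : sqn (0 : C) = 0.
Proof. by rewrite /sqn /= expr0n addr0. Qed.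

Lemma sqnR (a : R) : sqn (a%:C)%C = a ^+ 2.
Proof. by rewrite /sqn /= expr0n addr0. Qed.

Lemma sqn_eq0 (z : C) : (sqn z == 0) = (z == 0).
Proof.
rewrite paddr_eq0 ?sqr_ge0// !sqrf_eq0.
by case: z => a b; rewrite eq_complex.
Qed.

Lemma mulcJ (z : C) : z * z^* = (sqn z)%:C%C.
Proof. by rewrite -sqn_normc sqr_normc. Qed.

Lemma sqnD_le (z w : C) : sqn (z + w) <= 2 * sqn z + 2 * sqn w.
Proof.
case: z => a b; case: w => c d; rewrite /sqn/=.
have := sqr_ge0 (a - c); have := sqr_ge0 (b - d); nra.
Qed.

(** The squared norm of the projection that forgets the first [q] coordinates. *)
Definition tail q v : R := \sum_(l < n | (q <= l)%N) sqn (v 0 l).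
Definition nrm2 v : R := tail 0 v.

Lemma tail_ge0 q v : 0 <= tail q v.
Proof. by apply: sumr_ge0 => l _; exact: sqn_ge0. Qed.

Lemma nrm2_ge0 v : 0 <= nrm2 v. Proof. exact: tail_ge0. Qed.

Lemma tail_le q q' v : (q <= q')%N -> tail q' v <= tail q v.
Proof.
move=> qq'; rewrite /tail big_mkcond [leRHS]big_mkcond/=; apply: ler_sum => l _.
case: ifPn => q'l; first by rewrite (leq_trans qq' q'l).
by case: ifP => // _; exact: sqn_ge0.
Qed.

Lemma tail_nrm2 q v : tail q v <= nrm2 v. Proof. exact: tail_le. Qed.

Lemma tailZ q (a : C) v : tail q (a *: v) = sqn a * tail q v.
Proof. by rewrite mulr_sumr; apply: eq_bigr => l _; rewrite mxE sqnM. Qed.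

Lemma tailN q v : tail q (- v) = tail q v.
Proof. by apply: eq_bigr => l _; rewrite mxE sqnN. Qed.

Lemma tailD_le q u v : tail q (u + v) <= 2 * tail q u + 2 * tail q v.
Proof.
rewrite !mulr_sumr -big_split/=; apply: ler_sum => l _; rewrite mxE.
exact: sqnD_le.
Qed.

Lemma nrm2E v : (v *m v^t*%sesqui) 0 0 = (nrm2 v)%:C%C.
Proof.
rewrite mxE /nrm2 /tail rmorph_sum/=; apply: eq_bigr => l _.
by rewrite !mxE mulcJ.
Qed.

Lemma mulmx11 (u v : V) : u *m v^t*%sesqui = ((u *m v^t*%sesqui) 0 0)%:M.
Proof. by apply/matrixP => i j; rewrite !ord1 [RHS]mxE eqxx mulr1n. Qed.

Lemma nrm2_eq0 v : (nrm2 v == 0) = (v == 0).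
Proof.
apply/eqP/eqP => [v0|->]; last first.
  by rewrite /nrm2 /tail big1// => l _; rewrite mxE sqn0.
apply/rowP => l; rewrite mxE; apply/eqP; rewrite -sqn_eq0.
have := v0; rewrite /nrm2 /tail => /eqP.
rewrite psumr_eq0; last by move=> *; exact: sqn_ge0.
by move=> /allP/(_ l); rewrite mem_index_enum => /(_ isT).
Qed.

Lemma umxK g p (A : 'M[C]_(p, n)) : A *m umx g *m umx (g^-1)%g = A.
Proof. by rewrite -mulmxA -umxM mulgV mulmx1. Qed.

Lemma umxKV g p (A : 'M[C]_(p, n)) : A *m umx (g^-1)%g *m umx g = A.
Proof. by rewrite -mulmxA -umxM mulVg mulmx1. Qed.

Lemma nrm2U v g : nrm2 (v *m umx g) = nrm2 v.
Proof.
apply: complexI; rewrite -!nrm2E trmx_mul map_mxM mulmxA -umxV.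
by rewrite umxK.
Qed.

Lemma sub_umx p p' (A : 'M[C]_(p, n)) (B : 'M[C]_(p', n)) g :
  (A *m umx g <= B *m umx g)%MS = (A <= B)%MS.
Proof. by apply/idP/idP => [/(submxMr (umx (g^-1)%g))|]; rewrite ?umxK//; exact: submxMr. Qed.

Lemma nrm2_row g (i : 'I_n) : nrm2 (row i (umx g)) = 1.
Proof.
apply: complexI; rewrite -nrm2E; have /unitarymxP gg := umxP g.
move/matrixP : gg => /(_ i i); rewrite !mxE eqxx mulr1n => g1.
rewrite rmorph1 -{}g1.
by apply: eq_bigr => l _; rewrite !mxE.
Qed.

(** ** The stabilizer of the first basis vectors *)

Definition lowsupp q v := forall l : 'I_n, (q <= l)%N -> v 0 l = 0.
Definition hisupp m v := forall l : 'I_n, (l < m)%N -> v 0 l = 0.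
Definition lo m v : V := \row_l (if (l < m)%N then v 0 l else 0).
Definition hi m v : V := \row_l (if (l < m)%N then 0 else v 0 l).

Lemma lohi m v : lo m v + hi m v = v.
Proof. by apply/rowP => l; rewrite !mxE; case: ifP; rewrite ?addr0 ?add0r. Qed.

Lemma lo_lowsupp m v : lowsupp m (lo m v).
Proof. by move=> l ml; rewrite mxE ltnNge ml. Qed.

Lemma hi_hisupp m v : hisupp m (hi m v).
Proof. by move=> l lm; rewrite mxE lm. Qed.

Lemma nrm2_hi m v : nrm2 (hi m v) = tail m v.
Proof.
rewrite /nrm2 /tail [RHS]big_mkcond/=; apply: eq_bigr => l _.
by rewrite mxE; case: ltnP => //= _; exact: sqn0.
Qed.

Lemma tail_lowsuppD q u v : lowsupp q u -> tail q (u + v) = tail q v.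
Proof. by move=> qu; apply: eq_bigr => l ql; rewrite mxE qu// add0r. Qed.

Lemma lowsupp_sum q v : lowsupp q v ->
  v = \sum_(l < n | (l < q)%N) v 0 l *: delta_mx 0 l.
Proof.
move=> qv; rewrite {1}(row_sum_delta v) (bigID (fun l : 'I_n => (l < q)%N))/=.
rewrite [X in _ + X]big1 ?addr0// => l; rewrite -leqNgt => ql.
by rewrite qv// scale0r.
Qed.

Definition stab m g := forall l : 'I_n, (l < m)%N ->
  (delta_mx 0 l : V) *m umx g = delta_mx 0 l.

Lemma stab1 m : stab m 1%g. Proof. by move=> l lm; rewrite mulmx1. Qed.

Lemma stabM m g h : stab m g -> stab m h -> stab m (g * h)%g.
Proof. by move=> sg sh l lm; rewrite umxM mulmxA sg// sh. Qed.

Lemma stabV m g : stab m g -> stab m g^-1%g.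
Proof. by move=> sg l lm; rewrite -{1}(sg l lm) umxK. Qed.

Lemma stabW m m' g : (m <= m')%N -> stab m' g -> stab m g.
Proof. by move=> mm' sg l lm; apply: sg; exact: leq_trans mm'. Qed.

Lemma stab_lowsupp m g v : stab m g -> lowsupp m v -> v *m umx g = v.
Proof.
move=> sg mv; rewrite (lowsupp_sum mv) mulmx_suml; apply: eq_bigr => l lm.
by rewrite -scalemxAl sg.
Qed.

Lemma stab_hisupp m g v : stab m g -> hisupp m v -> hisupp m (v *m umx g).
Proof.
move=> sg mv l lm; rewrite mxE big1// => j _.
have [->|jl] := eqVneq j l; first by rewrite mv// mul0r.
have /rowP/(_ j) := stabV sg lm.
by rewrite -rowE umxV !mxE eqxx (negPf jl)/= => /eqP; rewrite conjC_eq0 => /eqP->; rewrite mulr0.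
Qed.

(** ** A measurable section of the action on unit vectors *)

(** For unit vectors this is the unitary map which sends [x] to [y] and fixes the
    orthogonal of [w = x - y]; it is written [1 - k^-1 w^* w] below. *)
Definition householder x y : 'M[C]_n :=
  1%:M - (1 - (x *m y^t*%sesqui) 0 0)^-1 *: ((x - y)^t*%sesqui *m (x - y)).

Lemma adjmx_sub (A B : V) : (A - B)^t*%sesqui = A^t*%sesqui - B^t*%sesqui.
Proof. by rewrite linearB/= map_mxB. Qed.

Lemma adj_entry x y : (y *m x^t*%sesqui) 0 0 = ((x *m y^t*%sesqui) 0 0)^*.
Proof.
rewrite !mxE rmorph_sum/=; apply: eq_bigr => l _; rewrite !mxE rmorphM/= conjCK.
by rewrite mulrC.
Qed.

Section householder.
Variables x y : V.
Hypotheses (x1 : nrm2 x = 1) (y1 : nrm2 y = 1).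
Let w := x - y.
Let k := 1 - (x *m y^t*%sesqui) 0 0.

Let xw : (x *m w^t*%sesqui) 0 0 = k.
Proof. by rewrite adjmx_sub mulmxBr mxE nrm2E x1 mxE. Qed.

Let ww : (w *m w^t*%sesqui) 0 0 = k + k^*.
Proof.
rewrite {1}/w mulmxBl mxE xw; congr (_ + _).
rewrite mxE adjmx_sub mulmxBr mxE [X in _ + X]mxE nrm2E y1 adj_entry /k.
by rewrite rmorphB/= !rmorph1 opprB.
Qed.

Let k0w : k = 0 -> w = 0.
Proof.
move=> k0; apply/eqP; rewrite -nrm2_eq0; apply/eqP/complexI.
by rewrite -nrm2E ww k0 rmorph0 addr0.
Qed.

(** [1 - k^-1 w^* w] is unitary exactly when [|w|^2 = k + k^*]: with a complex
    coefficient no phase has to be corrected. *)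
Lemma householder_unitary : householder x y \is unitarymx.
Proof.
apply/unitarymxP; rewrite /householder -/w -/k.
have [k0|k0] := eqVneq k 0.
  by rewrite k0w// mulmx0 scaler0 subr0 trmx1 map_mx1 mulmx1.
set P := _^t*%sesqui *m w.
have PJ : P^t*%sesqui = P by rewrite /P trmx_mul map_mxM trmxCK.
have PP : P *m P = (k + k^*) *: P.
  rewrite /P mulmxA -(mulmxA _ w) mulmx11 ww mul_mx_scalar -scalemxAl.
  by [].
have -> : (1%:M - k^-1 *: P)^t*%sesqui = 1%:M - k^-1^* *: P.
  by rewrite linearB/= map_mxB trmx1 map_mx1 linearZ/= map_mxZ PJ.
rewrite mulmxBl mul1mx mulmxBr mulmx1 -scalemxAl -scalemxAr PP !scalerA.
rewrite -addrA -opprD -scalerBl -scalerDl [X in X *: _](_ : _ = 0).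
  by rewrite scale0r subr0.
have kJ : k^* != 0 by rewrite conjC_eq0.
rewrite fmorphV/=; move: kJ; move: (k^*) => b b0; move: k0; move: (k) => a a0.
by field; rewrite a0 b0.
Qed.

Lemma householderE : x *m householder x y = y.
Proof.
rewrite /householder -/w -/k mulmxBr mulmx1 -scalemxAr mulmxA mulmx11 xw.
rewrite mul_scalar_mx scalerA.
have [k0|k0] := eqVneq k 0.
  rewrite k0w// scaler0 subr0; apply/eqP; rewrite -subr_eq0 -/w.
  by apply/eqP; exact: k0w.
by rewrite mulVf// scale1r subKr.
Qed.

End householder.

(** The default value only matters when [x] or [y] is not a unit vector. *)
Definition hhU x y : U := insubd (1%g : U) (householder x y).

Lemma hhUE x y : nrm2 x = 1 -> nrm2 y = 1 -> umx (hhU x y) = householder x y.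
Proof. by move=> x1 y1; rewrite -[LHS]/(val _) val_insubd householder_unitary. Qed.

Lemma mul_hhU x y : nrm2 x = 1 -> nrm2 y = 1 -> x *m umx (hhU x y) = y.
Proof. by move=> x1 y1; rewrite hhUE// householderE. Qed.

(** The vectors fixed are those orthogonal to [x - y]. *)
Lemma stab_hhU m x y : nrm2 x = 1 -> nrm2 y = 1 -> hisupp m x -> hisupp m y ->
  stab m (hhU x y).
Proof.
move=> x1 y1 mx my l lm; rewrite hhUE// /householder mulmxBr mulmx1.
rewrite -scalemxAr mulmxA [_ *m (x - y)^t*%sesqui](_ : _ = 0).
  by rewrite mul0mx scaler0 subr0.
by apply/matrixP => i j; rewrite -rowE !ord1 !mxE mx// my// subrr conjC0.
Qed.

Lemma nrm2_delta (l : 'I_n) : nrm2 (delta_mx 0 l) = 1.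
Proof.
rewrite /nrm2 /tail (bigD1 l)//= big1 => [|j jl].
  by rewrite addr0 mxE !eqxx /sqn /= expr1n expr0n addr0.
by rewrite mxE eqxx (negPf jl) sqn0.
Qed.

Lemma hisupp_delta (l : 'I_n) m : (m <= l)%N -> hisupp m (delta_mx 0 l).
Proof.
move=> ml j jm; rewrite mxE eqxx; case: eqVneq => // jl.
by move: jm; rewrite jl ltnNge ml.
Qed.

Lemma hisuppZ m (a : C) v : hisupp m v -> hisupp m (a *: v).
Proof. by move=> mv l lm; rewrite mxE mv// mulr0. Qed.

Lemma lowsupp_sub p (A : 'M[C]_(p, n)) m v :
  (forall l : 'I_n, (l < m)%N -> ((delta_mx 0 l : V) <= A)%MS) ->
  lowsupp m v -> (v <= A)%MS.
Proof.
move=> mA /lowsupp_sum ->; rewrite summx_sub// => l lm.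
by rewrite scalemx_sub// mA.
Qed.

Lemma normalize v : v != 0 ->
  exists2 a : C, a != 0 & nrm2 (a *: v) = 1.
Proof.
rewrite -nrm2_eq0 => v0.
have vp : 0 < nrm2 v by rewrite lt_neqAle eq_sym v0 nrm2_ge0.
exists ((Num.sqrt (nrm2 v))^-1%:C)%C.
  by rewrite fmorph_eq0 invr_eq0 sqrtr_eq0 -ltNge.
by rewrite /nrm2 tailZ -/(nrm2 v) sqnR exprVn sqr_sqrtr ?ltW// mulVf.
Qed.

(** Gram-Schmidt relative to a flag: the first [m] vectors stay fixed and the
    subspace moves below level [q]. *)
Lemma flag_frame m q p (A : 'M[C]_(p, n)) :
  (m <= q)%N -> (q <= n)%N -> (\rank A <= q)%N ->
  (forall l : 'I_n, (l < m)%N -> ((delta_mx 0 l : V) <= A)%MS) ->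
  exists2 h : U, stab m h & forall v, (v <= A)%MS -> lowsupp q (v *m umx h).
Proof.
move=> mq qn; have [j] := ubnP (q - m)%N; elim: j m mq p A => // j ih m mq p A.
rewrite ltnS => qmj rA mA.
have [lowA|nlowA] := pselect (forall i, lowsupp m (row i A)).
  exists 1%g; first exact: stab1.
  move=> v /submxP[a ->]; rewrite mulmx1 mulmx_sum_row => l ql.
  rewrite summxE big1// => i _; rewrite mxE lowA ?mulr0//.
  exact: leq_trans ql.
have [i ni] : exists i, ~ lowsupp m (row i A).
  by apply: contrapT => /forallNP h; apply: nlowA => i; apply: contrapT.
have hi0 : hi m (row i A) != 0.
  apply/eqP => h0; apply: ni => l ml.
  have /rowP/(_ l) := h0; rewrite !mxE ltnNge ml//.
have hiA : (hi m (row i A) <= A)%MS.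
  rewrite (_ : hi _ _ = row i A - lo m (row i A)); last first.
    by rewrite -{2}(lohi m (row i A)) addrC addKr.
  by rewrite addmx_sub ?row_sub// eqmx_opp (lowsupp_sub mA)//; exact: lo_lowsupp.
have [a a0 au] := normalize hi0; set u := a *: _ in au.
have uA : (u <= A)%MS by rewrite scalemx_sub.
have mu : hisupp m u by apply/hisuppZ/hi_hisupp.
have mltq : (m < q)%N.
  rewrite ltn_neqAle mq andbT; apply/eqP => mqE.
  have rpid : \rank (pid_mx m : 'M[C]_n) = m.
    by rewrite rank_pid_mx ?(leq_trans mq qn).
  have pidA : ((pid_mx m : 'M[C]_n) <= A)%MS.
    apply/row_subP => l; have [lm|ml] := ltnP l m.
      rewrite (_ : row l _ = delta_mx 0 l); first exact: mA.
      by apply/rowP => k; rewrite !mxE eqxx lm andbT eq_sym.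
    rewrite (_ : row l _ = 0) ?sub0mx//.
    by apply/rowP => k; rewrite !mxE ltnNge ml andbF.
  have : (A <= (pid_mx m : 'M[C]_n))%MS.
    have := mxrank_leqif_sup pidA; rewrite rpid => -[_ <-].
    by rewrite eqn_leq -{1}rpid mxrankS//= mqE.
  move=> Apid; apply: ni => l ml.
  have /submxP[b ->] : (row i A <= (pid_mx m : 'M[C]_n))%MS.
    exact: submx_trans (row_sub _ _) Apid.
  rewrite mxE big1// => k _; rewrite mxE.
  case kl: (k == l :> nat); last by rewrite mulr0.
  by rewrite (eqP kl) ltnNge ml mulr0.
pose e : 'I_n := Ordinal (leq_trans mltq qn).
pose c := hhU (delta_mx 0 e) u.
have ec : (delta_mx 0 e : V) *m umx c = u by apply: mul_hhU => //; exact: nrm2_delta.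
have sc : stab m c.
  by apply: stab_hhU => //; [exact: nrm2_delta|exact: hisupp_delta].
have [||||h sh hA] := ih m.+1 _ _ (A *m umx (c^-1)%g).
- exact: mltq.
- by rewrite subnS (leq_trans _ qmj)// prednK// subn_gt0.
- by rewrite mxrankMfree// row_free_unit unitarymx_unit// umxP.
- move=> l; rewrite ltnS leq_eqVlt => /predU1P[lm|lm].
    have -> : l = e by exact: val_inj.
    by rewrite -[delta_mx 0 e : V](umxK c) ec submxMr.
  by rewrite -(stabV sc lm) submxMr// mA.
exists (c^-1 * h)%g; first exact: stabM (stabV sc) (stabW (leqnSn m) sh).
by move=> v vA; rewrite umxM mulmxA; apply: hA; rewrite submxMr.
Qed.

(** ** Squared distance to a row space *)

(** In a suitable orthonormal frame a row space consists of vectors supported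
    on its first [rank] coordinates, which turns distances to it into [tail]. *)
Lemma frame_exists p (A : 'M[C]_(p, n)) :
  exists h : U, forall v, (v <= A)%MS -> lowsupp (\rank A) (v *m umx h).
Proof.
have [//|h _ hA] :=
  @flag_frame 0 (\rank A) p A (leq0n _) (rank_leq_col A) (leqnn _).
by exists h.
Qed.

Definition frame p (A : 'M[C]_(p, n)) : U := sval (cid (frame_exists A)).

Lemma frameP p (A : 'M[C]_(p, n)) v :
  (v <= A)%MS -> lowsupp (\rank A) (v *m umx (frame A)).
Proof. by rewrite /frame; case: cid => h /= hA; exact: hA. Qed.

Definition dist2 p (A : 'M[C]_(p, n)) v : R :=
  tail (\rank A) (v *m umx (frame A)).

Lemma dist2_ge0 p (A : 'M[C]_(p, n)) v : 0 <= dist2 A v.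
Proof. exact: tail_ge0. Qed.

Lemma dist2D p (A : 'M[C]_(p, n)) s v : (s <= A)%MS ->
  dist2 A (s + v) = dist2 A v.
Proof. by move=> sA; rewrite /dist2 mulmxDl tail_lowsuppD//; exact: frameP. Qed.

Lemma dist2_le p (A : 'M[C]_(p, n)) s v : (s <= A)%MS ->
  dist2 A v <= nrm2 (v - s).
Proof.
move=> sA; rewrite -(@dist2D _ _ (- s)) ?eqmx_opp// addrC.
by rewrite -(nrm2U _ (frame A)); exact: tail_nrm2.
Qed.

Lemma dist2Z p (A : 'M[C]_(p, n)) (a : C) v :
  dist2 A (a *: v) = sqn a * dist2 A v.
Proof. by rewrite /dist2 -scalemxAl tailZ. Qed.

Lemma dist2D_le p (A : 'M[C]_(p, n)) u v :
  dist2 A (u + v) <= 2 * dist2 A u + 2 * dist2 A v.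
Proof. by rewrite /dist2 mulmxDl; exact: tailD_le. Qed.

(** The nearest point is read off in the frame as the low part of [v]. *)
Lemma dist2_attained p (A : 'M[C]_(p, n)) v :
  exists2 s, (s <= A)%MS & dist2 A v = nrm2 (v - s).
Proof.
pose h := frame A; pose q := \rank A.
have rpid : \rank (pid_mx q : 'M[C]_n) = q by rewrite rank_pid_mx ?rank_leq_col.
have Ahpid : (A *m umx h <= (pid_mx q : 'M[C]_n))%MS.
  apply/row_subP => i; rewrite row_mul.
  have lowi := frameP (row_sub i A); rewrite -/h -/q in lowi.
  apply: lowsupp_sub lowi => l lq.
  rewrite (_ : delta_mx 0 l = row l (pid_mx q)) ?row_sub//.
  by apply/rowP => k; rewrite !mxE eqxx lq andbT eq_sym.
have pidAh : ((pid_mx q : 'M[C]_n) <= A *m umx h)%MS.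
  have := mxrank_leqif_sup Ahpid; rewrite rpid => -[_ <-].
  by rewrite mxrankMfree// row_free_unit unitarymx_unit// umxP.
exists (lo q (v *m umx h) *m umx (h^-1)%g).
  rewrite -(sub_umx _ _ h) umxKV; apply: submx_trans pidAh.
  apply: lowsupp_sub (@lo_lowsupp q _) => l lq.
  rewrite (_ : delta_mx 0 l = row l (pid_mx q)) ?row_sub//.
  by apply/rowP => k; rewrite !mxE eqxx lq andbT eq_sym.
rewrite -(nrm2U _ h) mulmxBl umxKV /dist2 -/h -/q -nrm2_hi.
by rewrite -{2}(lohi q (v *m umx h)) addrC addKr.
Qed.

Lemma dist2_sub p p' (A : 'M[C]_(p, n)) (B : 'M[C]_(p', n)) v :
  (A <= B)%MS -> dist2 B v <= dist2 A v.
Proof.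
move=> AB; have [s sA ->] := dist2_attained A v.
by apply: dist2_le; exact: submx_trans AB.
Qed.

Lemma dist2_orth p (A : 'M[C]_(p, n)) v :
  (forall s : V, (s <= A)%MS -> v *m s^t*%sesqui = 0) -> dist2 A v = nrm2 v.
Proof.
move=> vA; apply/eqP; rewrite eq_le; apply/andP; split.
  by rewrite -{2}(subr0 v) dist2_le// sub0mx.
have [s sA ->] := dist2_attained A v.
have sv : s *m v^t*%sesqui = 0.
  have := vA s sA => /(congr1 (fun M => M^t*%sesqui)).
  by rewrite trmx_mul map_mxM trmxCK trmx0 map_mx0.
rewrite -lecR -!nrm2E adjmx_sub mulmxBr !mulmxBl (vA s sA) sv subr0 sub0r.
rewrite opprK [leRHS]mxE [X in _ <= _ + X]nrm2E nrm2E -rmorphD lecR.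
by rewrite lerDl nrm2_ge0.
Qed.

(** The distance of [y b] to [S] is bounded below in a frame which fixes the
    first [m] basis vectors, so that it can be averaged over their stabilizer. *)
Lemma dist2_frame m q p (S : 'M[C]_(p, n)) (b : U) :
  (m <= q)%N -> (q <= n)%N -> (\rank S <= q)%N ->
  (forall l : 'I_n, (l < m)%N -> ((delta_mx 0 l : V) *m umx b <= S)%MS) ->
  exists2 h : U, stab m h &
    forall y, tail q (y *m umx h) <= dist2 S (y *m umx b).
Proof.
move=> mq qn rS mS.
have [||h sh hA] := @flag_frame m q p (S *m umx (b^-1)%g) mq qn.
- by rewrite mxrankMfree// row_free_unit unitarymx_unit// umxP.
- by move=> l lm; rewrite -(sub_umx _ _ b) umxKV mS.
exists h => // y; have [s sS ->] := dist2_attained S (y *m umx b).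
rewrite -(nrm2U _ (b^-1)%g) mulmxBl umxK -(nrm2U _ h) mulmxBl.
rewrite [X in nrm2 X]addrC.
rewrite -(@tail_lowsuppD q (- (s *m umx b^-1%g *m umx h)) (y *m umx h)).
  exact: tail_nrm2.
move=> l ql; rewrite mxE hA ?oppr0//; exact: submxMr.
Qed.

End row_geometry.

Section row_geometry_measurable.
Context {R : realType} {n : nat} d (T : measurableType d).
Local Notation V := 'rV[R[i]]_n.

Lemma measurable_tail (F : T -> V) q : mxmeas F ->
  measurable_fun setT (fun t => tail q (F t)).
Proof.
move=> mF; rewrite (_ : (fun t => _) =
    (fun t => \sum_(l < n) if (q <= l)%N then sqn (F t 0 l) else 0)).
  apply: (@measurable_sum _ _ _ _ _ _
      (fun (l : 'I_n) t => if (q <= l)%N then sqn (F t 0 l) else 0)) => l.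
  by case: (q <= l)%N; [exact: measurable_sqn|exact: measurable_cst].
by apply/funext => t; rewrite /tail big_mkcond.
Qed.

Lemma measurable_dist2 (F : T -> V) p (A : 'M[R[i]]_(p, n)) : mxmeas F ->
  measurable_fun setT (fun t => dist2 A (F t)).
Proof.
by move=> mF; apply: measurable_tail; apply: mxmeasM => //; exact: mxmeas_cst.
Qed.

Lemma measurable_hhU (x : V) (F : T -> V) : nrm2 x = 1 ->
  (forall t, nrm2 (F t) = 1) -> mxmeas F ->
  measurable_fun setT (fun t => hhU x (F t)).
Proof.
move=> x1 F1 mF; apply/measurable_unitaryP.
under eq_fun do rewrite hhUE//.
have mw : mxmeas (fun t => x - F t).
  by apply: mxmeasD; [exact: mxmeas_cst|exact: mxmeasN].
apply: mxmeasD; first exact: mxmeas_cst.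
apply/mxmeasN/mxmeasZ; last by apply: mxmeasM => //; exact: mxmeasJ.
apply/cmeasV/cmeasD; first exact: cmeas_cst.
apply: cmeasN; apply: mxmeasM; [exact: mxmeas_cst|exact: mxmeasJ].
Qed.

End row_geometry_measurable.

(** * A negative moment of a projection of a uniform unit vector *)

Section bounded_expectation.
Context {R : realType} d (T : measurableType d) (nu : probability T R).
Implicit Types f g : T -> R.

Definition bmeas f : Prop :=
  measurable_fun setT f /\ exists c, forall t, `|f t| <= c.

Lemma bmeas_cst c : bmeas (fun=> c).
Proof. by split; [exact: measurable_cst|exists `|c|]. Qed.

Lemma bmeasD f g : bmeas f -> bmeas g -> bmeas (fun t => f t + g t).
Proof.
move=> [mf [a fa]] [mg [b gb]]; split; first exact: measurable_funD.
by exists (a + b) => t; apply: le_trans (ler_normD _ _) _; exact: lerD.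
Qed.

Lemma bmeasM f g : bmeas f -> bmeas g -> bmeas (fun t => f t * g t).
Proof.
move=> [mf [a fa]] [mg [b gb]]; split; first exact: measurable_funM.
by exists (a * b) => t; rewrite normrM ler_pM.
Qed.

Lemma bmeasX f k : bmeas f -> bmeas (fun t => f t ^+ k).
Proof.
move=> bf; elim: k => [|k ih]; first by under eq_fun do rewrite expr0; exact: bmeas_cst.
by under eq_fun do rewrite exprS; exact: bmeasM.
Qed.

Lemma bmeasN f : bmeas f -> bmeas (fun t => - f t).
Proof.
move=> bf; rewrite (_ : (fun _ => _) = (fun t => -1 * f t)).
  by apply: bmeasM => //; exact: bmeas_cst.
by apply/funext => t; rewrite mulN1r.
Qed.

Lemma bmeas_sum (I : Type) (s : seq I) (P : pred I) (F : I -> T -> R) :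
  (forall i, bmeas (F i)) -> bmeas (fun t => \sum_(i <- s | P i) F i t).
Proof.
move=> mF; elim: s => [|i s ih].
  by under eq_fun do rewrite big_nil; exact: bmeas_cst.
by under eq_fun do rewrite big_cons; case: (P i) => //; exact: bmeasD.
Qed.

Lemma bmeas_integrable f : bmeas f -> nu.-integrable setT (EFin \o f).
Proof.
move=> [mf [c fc]].
apply: (@le_integrable _ _ _ nu setT _ _ (cst c%:E)) => //.
- exact/measurable_EFinP.
- by move=> x _ /=; rewrite lee_fin (le_trans (fc x))// ler_norm.
- exact: finite_measure_integrable_cst.
Qed.

Definition esp f : R := \int[nu]_t f t.

Lemma esp_cst c : esp (fun=> c) = c.
Proof. by rewrite /esp /Rintegral integral_cst//= probability_setT mule1. Qed.

Lemma espD f g : bmeas f -> bmeas g -> esp (fun t => f t + g t) = esp f + esp g.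
Proof. by move=> bf bg; rewrite /esp RintegralD//; exact: bmeas_integrable. Qed.

Lemma espZ c f : bmeas f -> esp (fun t => c * f t) = c * esp f.
Proof. by move=> bf; rewrite /esp RintegralZl//; exact: bmeas_integrable. Qed.

Lemma esp_sum (I : Type) (s : seq I) (P : pred I) (F : I -> T -> R) :
  (forall i, bmeas (F i)) ->
  esp (fun t => \sum_(i <- s | P i) F i t) = \sum_(i <- s | P i) esp (F i).
Proof.
move=> mF; elim: s => [|i s ih].
  by rewrite big_nil -[RHS](esp_cst 0); congr esp; apply/funext => t; rewrite big_nil.
rewrite big_cons -ih; case: ifP => Pi.
  rewrite -espD//; last exact: bmeas_sum.
  by congr esp; apply/funext => t; rewrite big_cons Pi.
by congr esp; apply/funext => t; rewrite big_cons Pi.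
Qed.

Lemma esp_ge0 f : (forall t, 0 <= f t) -> 0 <= esp f.
Proof. by move=> f0; apply: Rintegral_ge0. Qed.

Lemma espE f : bmeas f -> (esp f)%:E = (\int[nu]_t (f t)%:E)%E.
Proof.
by move=> bf; rewrite fineK//; apply: integrable_fin_num => //; exact: bmeas_integrable.
Qed.

Lemma full_le_esp (H : set T) f g : measurable H -> nu H = 1%E ->
  bmeas f -> bmeas g -> (forall t, H t -> f t <= g t) -> esp f <= esp g.
Proof.
move=> mH nuH bf bg fg; rewrite -subr_ge0.
have -> : esp g - esp f = esp (fun t => g t + -1 * f t).
  rewrite espD// ?espZ// ?mulN1r//.
  by apply: bmeasM => //; exact: bmeas_cst.
pose h t := g t + -1 * f t.
have bh : bmeas h.
  by apply: bmeasD => //; apply: bmeasM => //; exact: bmeas_cst.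
have -> : esp h = esp (fun t => Num.max 0 (h t)).
  rewrite /esp /Rintegral; congr fine; apply: (full_eq_integral mH nuH).
  - by apply/measurable_EFinP; case: bh.
  - apply/measurable_EFinP; apply: measurable_maxr => //; by case: bh.
  - by move=> t Ht; rewrite max_r// /h mulN1r subr_ge0 fg.
by apply: esp_ge0 => t; rewrite le_max lexx.
Qed.

End bounded_expectation.

Section rotation_calculus.
Context {R : realType}.
Variables (u v rho X eta : R) (p : nat).

(** The squared norm [X] of the projection onto some coordinates, the real part
    [rho] of the product of two coordinates, of squared moduli [u] outside and
    [v] inside, and the normalized inverse of [X], as they become after a
    rotation by [t] of these two coordinates. *)
Definition rotX (t : R) : R :=
  X - v + (sin t ^+ 2 * u + cos t ^+ 2 * v + 2 * (sin t * cos t) * rho).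
Definition rotrho (t : R) : R :=
  sin t * cos t * (u - v) + (cos t ^+ 2 - sin t ^+ 2) * rho.
Definition rotW (t : R) : R := ((rotX t + eta) / (1 + eta))^-1.

Lemma is_derive_rotX (t : R) : is_derive t (1 : R) rotX (2 * rotrho t).
Proof.
rewrite /rotX; apply: is_derive_eq.
rewrite /rotrho /GRing.scale/=; ring.
Qed.

Lemma is_derive_rotrho (t : R) : is_derive t (1 : R) rotrho
  ((cos t ^+ 2 - sin t ^+ 2) * (u - v) - 4 * (sin t * cos t) * rho).
Proof.
rewrite /rotrho; apply: is_derive_eq.
rewrite /GRing.scale/=; ring.
Qed.

Lemma is_derive_rotF (t : R) : 0 < 1 + eta -> 0 < rotX t + eta ->
  is_derive t (1 : R) (fun t => rotW t ^+ p.+1 * rotrho t)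
  (rotW t ^+ p.+1 *
     ((cos t ^+ 2 - sin t ^+ 2) * (u - v) - 4 * (sin t * cos t) * rho)
   - p.+1%:R * rotW t ^+ p.+2 / (1 + eta) * 2 * rotrho t ^+ 2).
Proof.
move=> e0 Xe0.
have h1 := is_derive_rotX t; have h2 := is_derive_rotrho t.
have N0 : (rotX t + eta) / (1 + eta) != 0 by rewrite gt_eqF// divr_gt0.
have h3 : is_derive t (1 : R) (fun t => (rotX t + eta) / (1 + eta))
    (2 * rotrho t / (1 + eta)).
  by apply: is_derive_eq; rewrite /GRing.scale/=; ring.
have h4 : is_derive t (1 : R) rotW
    (- (rotW t ^+ 2) * (2 * rotrho t / (1 + eta))).
  apply: DeriveDef; first exact: derivableV.
  by rewrite /rotW deriveV// derive_val -exprVn.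
have h6 := is_deriveM (is_deriveX p.+1 h4) h2.
rewrite (_ : (fun _ => _) = rotW ^+ p.+1 * rotrho); last first.
  by apply/funext => x; rewrite !fctE.
apply: is_derive_eq h6 _.
rewrite /GRing.scale/= !fctE !exprS.
by move: (rotW t) (rotrho t) => W r; ring.
Qed.

End rotation_calculus.

Section rotations.
Context {R : realType} {n : nat}.
Local Notation C := R[i].
Local Notation U := (unitary R n).
Local Notation V := 'rV[C]_n.

Lemma adjmxD m p (A B : 'M[C]_(m, p)) :
  (A + B)^t*%sesqui = A^t*%sesqui + B^t*%sesqui.
Proof. by rewrite linearD/= map_mxD. Qed.

Lemma adjmxZ m p (a : C) (A : 'M[C]_(m, p)) :
  (a *: A)^t*%sesqui = a^* *: A^t*%sesqui.
Proof. by rewrite linearZ/= map_mxZ. Qed.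

Lemma adjmx1 m : (1%:M : 'M[C]_m)^t*%sesqui = 1%:M.
Proof. by rewrite trmx1 map_mx1. Qed.

Lemma conj_real (x : R) : ((x%:C)%C : C)^* = (x%:C)%C.
Proof. exact: conjc_real. Qed.

Definition rot_mx (a b : 'I_n) (c s : C) : 'M[C]_n :=
  1%:M + (c - 1) *: (delta_mx a a + delta_mx b b)
       + s *: (delta_mx a b - delta_mx b a).

Lemma row_delta (v : V) (a b : 'I_n) :
  v *m delta_mx a b = v 0 a *: (delta_mx 0 b : V).
Proof.
apply/rowP => l; rewrite !mxE (bigD1 a)//= big1 => [|k ka].
  by rewrite addr0 !mxE !eqxx.
by rewrite !mxE (negPf ka) mulr0.
Qed.

Lemma row_rotE (v : V) a b c s (l : 'I_n) : (v *m rot_mx a b c s) 0 l =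
  v 0 l + (c - 1) * (v 0 a * (l == a)%:R + v 0 b * (l == b)%:R)
        + s * (v 0 a * (l == b)%:R - v 0 b * (l == a)%:R).
Proof.
rewrite /rot_mx !mulmxDr mulmx1 -!scalemxAr mulmxDr mulmxBr !row_delta !mxE.
by rewrite !eqxx.
Qed.

Lemma rot_unitary a b (c s : R) : a != b -> c ^+ 2 + s ^+ 2 = 1 ->
  rot_mx a b (c%:C)%C (s%:C)%C \is unitarymx.
Proof.
move=> ab cs1; apply/unitarymxP.
set P : 'M[C]_n := delta_mx a a + delta_mx b b.
set J : 'M[C]_n := delta_mx a b - delta_mx b a.
have ba : b != a by rewrite eq_sym.
have dJ (x y : 'I_n) : (delta_mx x y : 'M[C]_n)^t*%sesqui = delta_mx y x.
  by rewrite trmx_delta map_delta_mx.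
have PJ : P^t*%sesqui = P by rewrite /P linearD/= map_mxD !dJ.
have JJ : J^t*%sesqui = - J by rewrite /J linearB/= map_mxB !dJ opprB.
have PP : P *m P = P.
  rewrite /P !mulmxDl !mulmxDr !mul_delta_mx_cond !eqxx (negPf ab) (negPf ba).
  by rewrite !mulr1n !mulr0n addr0 add0r.
have PJm : P *m J = J.
  rewrite /P /J mulmxDl !mulmxBr !mul_delta_mx_cond !eqxx (negPf ab) (negPf ba).
  by rewrite !mulr1n !mulr0n subr0 sub0r.
have JPm : J *m P = J.
  rewrite /P /J mulmxBl !mulmxDr !mul_delta_mx_cond !eqxx (negPf ab) (negPf ba).
  by rewrite !mulr1n !mulr0n addr0 add0r.
have JJm : J *m J = - P.
  rewrite /P /J mulmxBl !mulmxBr !mul_delta_mx_cond !eqxx (negPf ab) (negPf ba).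
  by rewrite !mulr1n !mulr0n subr0 sub0r opprD.
rewrite /rot_mx -/P -/J; clearbody P J; move: PJ JJ PP PJm JPm JJm.
move=> PJ JJ PP PJm JPm JJm.
rewrite !adjmxD !adjmxZ adjmx1 PJ JJ rmorphB/= rmorph1 !conj_real scalerN.
have cs1' : (c%:C)%C ^+ 2 + (s%:C)%C ^+ 2 = 1 :> C.
  by rewrite -!rmorphXn -rmorphD cs1 rmorph1.
move: cs1'; move: ((c%:C)%C : C) ((s%:C)%C : C) => c' s' cs.
rewrite mulmxBr !mulmxDr !mulmxDl !mulmx1 !mul1mx -!scalemxAl -!scalemxAr.
rewrite PP PJm JPm JJm -[(1%:C)%C]/(1 : C).
apply/matrixP => k l; rewrite !mxE.
move: (P k l) (J k l) ((k == l)%:R : C) => p j d.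
transitivity (d + (c' ^+ 2 + s' ^+ 2 - 1) * p); last by rewrite cs; ring.
by ring.
Qed.

Lemma rot_row_out (v : V) (a b l : 'I_n) c s : l != a -> l != b ->
  (v *m rot_mx a b c s) 0 l = v 0 l.
Proof.
move=> la lb; rewrite row_rotE (negPf la) (negPf lb).
by rewrite !mulr0n; ring.
Qed.

Lemma rot_row_l (v : V) (a b : 'I_n) c s : a != b ->
  (v *m rot_mx a b c s) 0 a = c * v 0 a - s * v 0 b.
Proof. by move=> ab; rewrite row_rotE eqxx (negPf ab) mulr1n mulr0n; ring. Qed.

Lemma rot_row_r (v : V) (a b : 'I_n) c s : a != b ->
  (v *m rot_mx a b c s) 0 b = s * v 0 a + c * v 0 b.
Proof.
by move=> ab; rewrite row_rotE eqxx eq_sym (negPf ab) mulr1n mulr0n; ring.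
Qed.

Definition phase_mx (b : 'I_n) : 'M[C]_n := 1%:M + ('i%C - 1) *: delta_mx b b.

Lemma phase_unitary b : phase_mx b \is unitarymx.
Proof.
apply/unitarymxP; rewrite /phase_mx; set P : 'M[C]_n := delta_mx b b.
have PJ : P^t*%sesqui = P by rewrite /P trmx_delta map_delta_mx.
have PP : P *m P = P by rewrite /P mul_delta_mx.
clearbody P; rewrite adjmxD adjmxZ adjmx1 PJ mulmxDr !mulmxDl !mulmx1 !mul1mx.
rewrite -!scalemxAl -!scalemxAr PP !scalerA -addrA -!scalerDl.
rewrite [X in X *: _](_ : _ = 0) ?scale0r ?addr0//.
by apply/eqP; rewrite eq_complex /=; apply/andP; split; apply/eqP; ring.
Qed.

Lemma phase_row_out (v : V) (b l : 'I_n) : l != b ->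
  (v *m phase_mx b) 0 l = v 0 l.
Proof.
move=> lb; rewrite /phase_mx mulmxDr mulmx1 -scalemxAr row_delta !mxE.
by rewrite (negPf lb) !mulr0 addr0.
Qed.

Lemma phase_row (v : V) (b : 'I_n) : (v *m phase_mx b) 0 b = 'i%C * v 0 b.
Proof.
by rewrite /phase_mx mulmxDr mulmx1 -scalemxAr row_delta !mxE !eqxx mulr1; ring.
Qed.

Definition rho2 (z w : C) : R := Re z * Re w + Im z * Im w.

Lemma rho2_rot (z w : C) (c s : R) :
  rho2 ((c%:C)%C * z - (s%:C)%C * w) ((s%:C)%C * z + (c%:C)%C * w) =
  s * c * (sqn z - sqn w) + (c ^+ 2 - s ^+ 2) * rho2 z w.
Proof. by case: z => a b; case: w => a' b'; rewrite /rho2 /sqn/=; ring. Qed.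

Lemma sqn_rot (z w : C) (c s : R) : sqn ((s%:C)%C * z + (c%:C)%C * w) =
  s ^+ 2 * sqn z + c ^+ 2 * sqn w + 2 * (s * c) * rho2 z w.
Proof. by case: z => a b; case: w => a' b'; rewrite /rho2 /sqn/=; ring. Qed.

Lemma rho2_phase (z w : C) :
  rho2 z ('i%C * w) ^+ 2 + rho2 z w ^+ 2 = sqn z * sqn w.
Proof. by case: z => a b; case: w => a' b'; rewrite /rho2 /sqn/=; ring. Qed.

Lemma sqn_phase (w : C) : sqn ('i%C * w) = sqn w.
Proof. by case: w => a b; rewrite /sqn/=; ring. Qed.

Lemma tail_rot (v : V) (a b : 'I_n) q (c s : R) : (a < q)%N -> (q <= b)%N ->
  tail q (v *m rot_mx a b (c%:C)%C (s%:C)%C) = tail q v - sqn (v 0 b) +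
  (s ^+ 2 * sqn (v 0 a) + c ^+ 2 * sqn (v 0 b)
   + 2 * (s * c) * rho2 (v 0 a) (v 0 b)).
Proof.
move=> aq qb.
have ab : a != b by apply: contraTneq aq => ->; rewrite -leqNgt.
rewrite /tail (bigD1 b)//= [X in _ = X - _ + _](bigD1 b)//=.
rewrite rot_row_r// sqn_rot (eq_bigr (fun l : 'I_n => sqn (v 0 l))); first by ring.
move=> l /andP[ql lb]; rewrite rot_row_out//.
by apply: contraTneq aq => <-; rewrite -leqNgt.
Qed.

Lemma tail_phase (v : V) (b : 'I_n) q : tail q (v *m phase_mx b) = tail q v.
Proof.
apply: eq_bigr => l _; have [->|lb] := eqVneq l b.
  by rewrite phase_row sqn_phase.
by rewrite phase_row_out.
Qed.

Lemma delta_row0 (l a : 'I_n) : l != a -> (delta_mx 0 l : V) 0 a = 0.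
Proof. by move=> la; rewrite mxE eqxx eq_sym (negPf la). Qed.

Lemma stab_rot (m : nat) (a b : 'I_n) (c s : C) (g : U) :
  umx g = rot_mx a b c s -> (m <= a)%N -> (m <= b)%N -> stab m g.
Proof.
move=> gE ma mb l lm; apply/rowP => j; rewrite gE row_rotE.
have la : l != a by apply: contraTneq lm => ->; rewrite -leqNgt.
have lb : l != b by apply: contraTneq lm => ->; rewrite -leqNgt.
by rewrite (delta_row0 la) (delta_row0 lb); ring.
Qed.

Lemma stab_phase (m : nat) (b : 'I_n) (g : U) :
  umx g = phase_mx b -> (m <= b)%N -> stab m g.
Proof.
move=> gE mb l lm; apply/rowP => j; rewrite gE.
have lb : l != b by apply: contraTneq lm => ->; rewrite -leqNgt.
have [->|jb] := eqVneq j b; last by rewrite phase_row_out.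
by rewrite phase_row (delta_row0 lb) mulr0.
Qed.

Lemma sqn_le_nrm2 (v : V) l : sqn (v 0 l) <= nrm2 v.
Proof.
rewrite /nrm2 /tail (bigD1 l)//= lerDl sumr_ge0// => j _; exact: sqn_ge0.
Qed.

End rotations.

Lemma norm_sin_le1 (R : realType) (t : R) : `|sin t| <= 1.
Proof. by rewrite ler_norml sin_geN1 sin_le1. Qed.

Lemma norm_cos_le1 (R : realType) (t : R) : `|cos t| <= 1.
Proof. by rewrite ler_norml cos_geN1 cos_le1. Qed.

(** The derivative is dominated by a constant, as differentiation under the
    integral requires. *)
Lemma rot_derivative_bound (R : realType) (u v rho s c w M eta : R) (p : nat) :
  0 <= u -> u <= 1 -> 0 <= v -> v <= 1 -> `|rho| <= 1 -> `|s| <= 1 ->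
  `|c| <= 1 -> 0 <= w -> w <= M -> 0 < 1 + eta ->
  `|w ^+ p.+1 * ((c ^+ 2 - s ^+ 2) * (u - v) - 4 * (s * c) * rho)
    - p.+1%:R * w ^+ p.+2 / (1 + eta) * 2 *
      (s * c * (u - v) + (c ^+ 2 - s ^+ 2) * rho) ^+ 2| <=
  M ^+ p.+1 * 6 + p.+1%:R * M ^+ p.+2 / (1 + eta) * 2 * 9.
Proof.
move=> u1 u2 v1 v2 nr ns nc w0 wM eta1.
have absM (x1 x2 c1' c2' : R) : `|x1| <= c1' -> `|x2| <= c2' ->
    `|x1 * x2| <= c1' * c2' by move=> *; rewrite normrM ler_pM.
have nD (x1 x2 c1' c2' : R) : `|x1| <= c1' -> `|x2| <= c2' ->
    `|x1 - x2| <= c1' + c2'.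
  by move=> *; apply: le_trans (ler_normB _ _) _; exact: lerD.
have nuv : `|u - v| <= 1 by rewrite ler_norml; apply/andP; split; lra.
have ncs : `|c ^+ 2 - s ^+ 2| <= 1.
  have le1 (x : R) : `|x| <= 1 -> 0 <= x ^+ 2 <= 1.
    by move=> x1; rewrite sqr_ge0 -real_normK ?num_real// exprn_ile1.
  have /andP[a1 a2] := le1 _ nc; have /andP[b1 b2] := le1 _ ns.
  by rewrite ler_norml; apply/andP; split; lra.
have nM k : `|w ^+ k| <= M ^+ k.
  by rewrite normrX ger0_norm// lerXn2r// nnegrE (le_trans w0).
have ge0_id (x1 : R) : 0 <= x1 -> `|x1| <= x1 by move=> ?; rewrite ger0_norm.
apply: (@nD).
  apply: (@absM) => //; apply: le_trans (nD _ _ (1 * 1) (4 * (1 * 1) * 1) _ _) _.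
  - exact: (@absM).
  - by apply: (@absM) => //; apply: (@absM); [exact: (@ge0_id)|exact: (@absM)].
  - lra.
apply: (@absM).
  apply: (@absM); last exact: (@ge0_id).
  apply: (@absM); last by apply: (@ge0_id); rewrite invr_ge0 ltW.
  by apply: (@absM) => //; exact: (@ge0_id).
rewrite normrX (_ : 9 = 3 ^+ 2 :> R); last by rewrite -natrX.
rewrite lerXn2r ?nnegrE//.
apply: le_trans (ler_normD _ _) _.
apply: (@le_trans _ _ (1 * 1 * 1 + 1 * 1)); last lra.
by apply: lerD; [apply: (@absM) => //; exact: (@absM)|exact: (@absM)].
Qed.

Section moment.
Context {R : realType} {n r : nat}.
Local Notation C := R[i].
Local Notation U := (unitary R n).
Local Notation V := 'rV[C]_n.
Local Notation Gam := (r.-tuple U).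
Variables (H : set Gam) (nu : probability Gam R).
Variables (i : 'I_r) (e : 'I_n) (q : nat) (eta : R).

Definition tset (j : 'I_r) (h : U) : Gam :=
  [tuple (if k == j then h else 1%g) | k < r].

Lemma tnth_tset j h k : tnth (tset j h) k = if k == j then h else 1%g.
Proof. by rewrite tnth_mktuple. Qed.

Hypotheses (sH : subgroup H) (hnu : haar_on H nu).
Hypothesis Hstab : forall K, H K -> stab e (tnth K i).
Hypothesis Hset : forall h, stab e h -> H (tset i h).
Hypotheses (eq_ : (e <= q)%N) (qn : (q < n)%N) (eta0 : 0 < eta).

Let y (K : Gam) : V := row e (umx (tnth K i)).

Let mH : measurable H. Proof. exact: subgroup_measurable. Qed.
Let nuH : nu H = 1%E. Proof. exact: hnu.1. Qed.

Lemma mxmeas_tnth_row : mxmeas y.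
Proof.
move=> k l; rewrite /y.
have /measurable_unitaryP h : measurable_fun [set: Gam] (@tnth r U ^~ i).
  exact: measurable_tnth.
by under eq_fun do rewrite mxE; exact: h.
Qed.

Let my := mxmeas_tnth_row.

Let y1 K : nrm2 (y K) = 1. Proof. exact: nrm2_row. Qed.

Lemma haar_espR (f : Gam -> R) h : bmeas f -> H h ->
  esp nu (fun K => f (tmul K h)) = esp nu f.
Proof.
move=> [mf bf] Hh; rewrite /esp /Rintegral; congr fine.
have mh : measurable_fun setT (fun K : Gam => tmul K h).
  exact: measurable_tmul.
pose hm : {mfun Gam >-> Gam} := HB.pack (fun K : Gam => tmul K h)
  (isMeasurableFun.Build _ _ _ _ (fun K : Gam => tmul K h) mh).
rewrite -[RHS](@eq_measure_integral _ _ _ _ nu (distribution nu hm)); last first.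
  by move=> A mA _; exact: (haar_onR sH hnu Hh mA).
rewrite integral_pushforward//=.
- exact/measurable_EFinP.
- apply: (@bmeas_integrable _ _ _ nu (fun K => f (tmul K h))); split.
    exact: measurableT_comp.
  by case: bf => c fc; exists c.
Qed.

Lemma yR K h : y (tmul K (tset i h)) = y K *m umx h.
Proof.
by rewrite /y tnth_tmul tnth_tset eqxx umxM rowE mulmxA -rowE.
Qed.

Lemma esp_row_rot (f : V -> R) h : bmeas (fun K => f (y K)) -> stab e h ->
  esp nu (fun K => f (y K *m umx h)) = esp nu (fun K => f (y K)).
Proof.
move=> bf sh; rewrite -(haar_espR bf (Hset sh)).
by congr esp; apply/funext => K; rewrite yR.
Qed.

Let W (v : V) : R := ((tail q v + eta) / (1 + eta))^-1.
Let M : R := (1 + eta) / eta.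

Let eta1 : 0 < 1 + eta. Proof. by rewrite addr_gt0. Qed.

Let WE v : W v = (1 + eta) / (tail q v + eta).
Proof. by rewrite /W invf_div. Qed.

Let W0 v : 0 < W v.
Proof. by rewrite WE divr_gt0// ltr_wpDl// tail_ge0. Qed.

Let WM v : W v <= M.
Proof.
by rewrite WE /M ler_pM2l// lef_pV2 ?posrE ?lerDr ?tail_ge0// ltr_wpDl// tail_ge0.
Qed.

Let M0 : 0 < M. Proof. by rewrite divr_gt0. Qed.

Lemma bmeas_sqn l : bmeas (fun K => sqn (y K 0 l)).
Proof.
split; first by apply: measurable_sqn.
by exists 1 => K; rewrite ger0_norm ?sqn_ge0// -(y1 K) sqn_le_nrm2.
Qed.

Lemma bmeas_W k : bmeas (fun K => W (y K) ^+ k).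
Proof.
apply: bmeasX; split; last first.
  by exists M => K; rewrite (ger0_norm (ltW (W0 _))).
apply/measurable_invr/measurable_funM => //; apply: measurable_funD => //.
exact: measurable_tail.
Qed.

Lemma rho2_le1 K a b : `|rho2 (y K 0 a) (y K 0 b)| <= 1.
Proof.
rewrite -(@ler_pXn2r _ 2) ?nnegrE// real_normK ?num_real// expr1n.
have h := rho2_phase (y K 0 a) (y K 0 b).
apply: (@le_trans _ _ (sqn (y K 0 a) * sqn (y K 0 b))).
  by rewrite -h lerDr sqr_ge0.
by apply: mulr_ile1; rewrite ?sqn_ge0// -(y1 K) sqn_le_nrm2.
Qed.

Lemma measurable_rho2 a b : measurable_fun setT (fun K => rho2 (y K 0 a) (y K 0 b)).
Proof.
have [ra ia] := my 0 a; have [rb ib] := my 0 b.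
by apply: measurable_funD; exact: measurable_funM.
Qed.

Lemma bmeas_rho2 a b : bmeas (fun K => rho2 (y K 0 a) (y K 0 b)).
Proof.
split; first exact: measurable_rho2.
by exists 1 => K; exact: rho2_le1.
Qed.

Let stein (p : nat) (a b : 'I_n) (v : V) : R :=
  W v ^+ p.+1 * (sqn (v 0 a) - sqn (v 0 b))
  - p.+1%:R * W v ^+ p.+2 / (1 + eta) * 2 * rho2 (v 0 a) (v 0 b) ^+ 2.

Lemma bmeas_stein p a b : bmeas (fun K => stein p a b (y K)).
Proof.
have h1 := bmeas_sqn a; have h2 := bmeas_sqn b; have h3 := bmeas_rho2 a b.
have h4 := bmeas_W p.+1; have h5 := bmeas_W p.+2.
apply: bmeasD.
  by apply: bmeasM => //; apply: bmeasD => //; exact: bmeasN.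
apply/bmeasN/bmeasM; last exact: bmeasX.
apply: bmeasM; last exact: bmeas_cst.
by apply: bmeasM; [apply: bmeasM => //|]; exact: bmeas_cst.
Qed.

(** The expectation of [F t = W^(p+1) rho] after a rotation by the angle [t]
    does not depend on [t]; its derivative at [0] is the expectation below. *)
Lemma esp_stein p (a b : 'I_n) : (e <= a)%N -> (a < q)%N -> (q <= b)%N ->
  esp nu (fun K => stein p a b (y K)) = 0.
Proof.
move=> ea aq qb.
have ab : a != b by apply: contraTneq aq => ->; rewrite -leqNgt.
pose f (v : V) : R := W v ^+ p.+1 * rho2 (v 0 a) (v 0 b).
have bf : bmeas (fun K => f (y K)).
  by apply: bmeasM; [exact: bmeas_W|exact: bmeas_rho2].
pose F (t : R) (K : Gam) : R :=
  rotW (sqn (y K 0 a)) (sqn (y K 0 b)) (rho2 (y K 0 a) (y K 0 b))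
       (tail q (y K)) eta t ^+ p.+1 *
  rotrho (sqn (y K 0 a)) (sqn (y K 0 b)) (rho2 (y K 0 a) (y K 0 b)) t.
have rotu (t : R) : rot_mx a b ((cos t)%:C)%C ((sin t)%:C)%C \is unitarymx.
  by apply: rot_unitary => //; exact: cos2Dsin2.
pose g (t : R) : U := Unitary (rotu t).
have FE t K : F t K = f (y K *m umx (g t)).
  rewrite /F /f /W tail_rot// /rotW /rotX.
  by rewrite /= rot_row_l// rot_row_r// rho2_rot.
have sg t : stab e (g t).
  by apply: (stab_rot (erefl (umx (g t)))) => //; rewrite (leq_trans eq_).
have eF t : esp nu (F t) = esp nu (fun K => f (y K)).
  rewrite -(esp_row_rot bf (sg t)); congr esp.
  by apply/funext => K; rewrite FE.
have rX0 t K : 0 <= rotX (sqn (y K 0 a)) (sqn (y K 0 b))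
    (rho2 (y K 0 a) (y K 0 b)) (tail q (y K)) t.
  by rewrite /rotX -tail_rot// tail_ge0.
have dF t K := @is_derive_rotF R (sqn (y K 0 a)) (sqn (y K 0 b))
  (rho2 (y K 0 a) (y K 0 b)) (tail q (y K)) eta p t eta1
  (ltr_wpDl (rX0 t K) eta0).
pose B : R := M ^+ p.+1 * 6 + p.+1%:R * M ^+ p.+2 / (1 + eta) * 2 * 9.
have bF t : bmeas (F t).
  have [mf [c fc]] := bf.
  rewrite (_ : F t = (fun K => f (y (tmul K (tset i (g t)))))); last first.
    by apply/funext => K; rewrite FE yR.
  split; last by exists c => K; exact: fc.
  by apply: (measurableT_comp mf); exact: measurable_tmul.
have := @differentiation_under_integral R _ Gam nu F setT measurableT 0 (-1) 1.
move=> /(_ _ _ _ (fun=> B)) h.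
have {}h : (fun x => \int[nu]_(K in setT) F x K)^`()%classic 0 =
    \int[nu]_(K in setT) partial1of2 F 0 K.
  apply: h.
  - by rewrite /= in_itv/= ltrN10 ltr01.
  - by move=> x _; exact: bmeas_integrable.
  - move=> x K _ _; have [] := dF x K; by [].
  - move=> _; have Mp k : 0 <= M ^+ k by rewrite exprn_ge0 ?ltW.
    by apply: addr_ge0; repeat first
      [exact: Mp|exact: ler0n|by rewrite invr_ge0 ltW|apply: mulr_ge0].
  - by apply: (bmeas_integrable nu (f := fun=> B)); exact: bmeas_cst.
  - move=> x K _ _; rewrite partial1of2E.
    have [_ ->] := dF x K.
    set rW := rotW _ _ _ _ _ _; set rr := rotrho _ _ _ _.
    have rW0 : 0 <= rW.
      by rewrite invr_ge0 divr_ge0 ?ltW// ltr_wpDl.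
    have rWM : rW <= M.
      rewrite /rW /rotW invf_div /M ler_pM2l// lef_pV2 ?posrE ?ltr_wpDl//.
      by rewrite lerDr.
    have u0 l : 0 <= sqn (y K 0 l) <= 1.
      by rewrite sqn_ge0 -(y1 K) sqn_le_nrm2.
    apply: rot_derivative_bound => //.
    - by have /andP[] := u0 a.
    - by have /andP[] := u0 a.
    - by have /andP[] := u0 b.
    - by have /andP[] := u0 b.
    - exact: rho2_le1.
    - exact: norm_sin_le1.
    - exact: norm_cos_le1.
rewrite (_ : (fun x => _) = cst (esp nu (fun K => f (y K)))) in h; last first.
  by apply/funext => t; rewrite -(eF t).
rewrite derive1_cst in h; rewrite [RHS]h; congr esp; apply/funext => K.
rewrite partial1of2E; have [_ ->] := dF 0 K.
rewrite /stein /rotrho /rotW /rotX cos0 sin0 /W.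
rewrite (_ : tail q (y K) - _ + _ = tail q (y K)); last by ring.
by ring.
Qed.

Let stein2 (p : nat) (a b : 'I_n) (v : V) : R :=
  W v ^+ p.+1 * (sqn (v 0 a) - sqn (v 0 b))
  - p.+1%:R * W v ^+ p.+2 / (1 + eta) * (sqn (v 0 a) * sqn (v 0 b)).

Lemma bmeas_stein2 p a b : bmeas (fun K => stein2 p a b (y K)).
Proof.
have h1 := bmeas_sqn a; have h2 := bmeas_sqn b.
have h4 := bmeas_W p.+1; have h5 := bmeas_W p.+2.
apply: bmeasD.
  by apply: bmeasM => //; apply: bmeasD => //; exact: bmeasN.
apply/bmeasN/bmeasM; last exact: bmeasM.
by apply: bmeasM; [apply: bmeasM => //|]; exact: bmeas_cst.
Qed.

(** Multiplying the coordinate [b] by the imaginary unit turns the real part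
    of the mixed term into its imaginary part; the two squares add up. *)
Lemma esp_stein2 p (a b : 'I_n) : (e <= a)%N -> (a < q)%N -> (q <= b)%N ->
  esp nu (fun K => stein2 p a b (y K)) = 0.
Proof.
move=> ea aq qb.
have ab : a != b by apply: contraTneq aq => ->; rewrite -leqNgt.
pose g : U := Unitary (phase_unitary b).
have sg : stab e g.
  by apply: (stab_phase (erefl (umx g))); rewrite (leq_trans eq_).
have bs := bmeas_stein p a b.
have h : esp nu (fun K => stein p a b (y K *m umx g)) = 0.
  by rewrite (@esp_row_rot (stein p a b))// esp_stein.
have bsg : bmeas (fun K => stein p a b (y K *m umx g)).
  have [ms [c sc]] := bs; split; last first.
    by exists c => K; rewrite -yR.
  rewrite (_ : (fun _ => _) =
      (fun K => stein p a b (y (tmul K (tset i g))))); last first.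
    by apply/funext => K; rewrite yR.
  by apply: (measurableT_comp ms); exact: measurable_tmul.
have := espD nu bs bsg; rewrite h esp_stein// addr0.
rewrite (_ : (fun _ => _) = (fun K => 2 * stein2 p a b (y K))).
  by rewrite espZ; [move/eqP; rewrite mulf_eq0 pnatr_eq0/= => /eqP|exact: bmeas_stein2].
apply/funext => K; rewrite /stein /stein2 /W tail_phase phase_row_out// phase_row.
by rewrite sqn_phase -rho2_phase; ring.
Qed.

Lemma sum_ord_ge : \sum_(b < n | (q <= b)%N) (1 : R) = (n - q)%:R.
Proof.
rewrite -(@natr_sum R _ _ _ (fun=> 1%N)); congr _%:R.
by rewrite -(big_geq_mkord q n xpredT (fun=> 1%N)) sum_nat_const_nat muln1.
Qed.

Lemma sum_ord_range :
  \sum_(a < n | ((e <= a) && (a < q))%N) (1 : R) = (q - e)%:R.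
Proof.
rewrite -(@natr_sum R _ _ _ (fun=> 1%N)); congr _%:R.
transitivity (\sum_(e <= a < q) 1)%N; last by rewrite sum_nat_const_nat muln1.
rewrite (big_nat_widen _ _ _ _ _ (ltnW qn)) big_geq_mkord.
by apply: eq_bigl => a; rewrite andbC.
Qed.

Let X K : R := tail q (y K).
Let Z K : R := \sum_(a < n | ((e <= a) && (a < q))%N) sqn (y K 0 a).

Let X01 K : 0 <= X K <= 1.
Proof. by rewrite tail_ge0 -(y1 K) tail_nrm2. Qed.

Let Z0 K : 0 <= Z K.
Proof. by apply: sumr_ge0 => a _; exact: sqn_ge0. Qed.

Let ZX K : H K -> Z K = 1 - X K.
Proof.
move=> HK; apply/eqP; rewrite eq_sym subr_eq -(y1 K) /nrm2 /tail; apply/eqP.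
rewrite (bigID (fun a : 'I_n => (e <= a)%N))/=.
rewrite [X in _ + X]big1 ?addr0.
  rewrite (bigID (fun a : 'I_n => (a < q)%N))/=; congr (_ + _).
  apply: eq_bigl => a; rewrite -leqNgt andb_idl// => qa.
  exact: leq_trans eq_ qa.
move=> a; rewrite -ltnNge => ae.
have /(_ a ae) := stab_hisupp (Hstab HK) (hisupp_delta (leqnn e)).
by rewrite -rowE /y => ->; exact: sqn0.
Qed.

(** Summing [esp_stein2] over the coordinates [a] below [q] and [b] above it
    replaces the squared moduli by [1 - X] and [X]. As [W] is [(1 + eta) / (X
    + eta)], the factor [X W] is at most one, and the identity becomes a
    recursion between consecutive negative moments. *)
Lemma esp_W_rec p :
  ((n - q)%:R - p.+1%:R) * esp nu (fun K => W (y K) ^+ p.+1) <=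
  ((n - e)%:R - p.+1%:R) * esp nu (fun K => W (y K) ^+ p) \/
  (n - e)%:R - p.+1%:R < 0 :> R.
Proof.
have [ap|ap] := leP 0 ((n - e)%:R - p.+1%:R : R); last by right.
left.
pose T K : R := \sum_(a < n | ((e <= a) && (a < q))%N)
  \sum_(b < n | (q <= b)%N) stein2 p a b (y K).
have bT : bmeas T.
  by apply: bmeas_sum => a; apply: bmeas_sum => b; exact: bmeas_stein2.
have eT : esp nu T = 0.
  rewrite /T esp_sum; last by move=> a; apply: bmeas_sum => b; exact: bmeas_stein2.
  rewrite big1// => a /andP[ea aq]; rewrite esp_sum; last first.
    by move=> b; exact: bmeas_stein2.
  by rewrite big1// => b qb; exact: esp_stein2.
have TE K : T K = W (y K) ^+ p.+1 * ((n - q)%:R * Z K - (q - e)%:R * X K)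
    - p.+1%:R * W (y K) ^+ p.+2 / (1 + eta) * (Z K * X K).
  rewrite /T /stein2.
  under eq_bigr => a _ do rewrite big_split/= sumrN -!mulr_sumr big_split/= sumrN.
  rewrite big_split/= sumrN -!mulr_sumr big_split/= sumrN -/(X K).
  congr (_ * (_ - _) - _ * _).
  - rewrite -sum_ord_ge mulr_suml exchange_big/=.
    by apply: eq_bigr => b _; rewrite mul1r.
  - by rewrite -sum_ord_range mulr_suml; apply: eq_bigr => a _; rewrite mul1r.
  - by rewrite /Z mulr_suml.
have b1 := bmeas_W p.+1; have b0 := bmeas_W p.
have bc (c : R) := @bmeas_cst R _ Gam c.
set A := (n - q)%:R - _; set B := (n - e)%:R - _.
have bA : bmeas (fun K => A * W (y K) ^+ p.+1) by exact: bmeasM.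
have bB : bmeas (fun K => B * W (y K) ^+ p) by exact: bmeasM.
suff : esp nu (fun K => A * W (y K) ^+ p.+1) <=
    esp nu (fun K => B * W (y K) ^+ p + T K).
  by rewrite espD// !espZ// eT addr0.
apply: (full_le_esp mH nuH) => //; first exact: bmeasD.
rewrite /A /B.
move=> K HK; rewrite TE (ZX HK).
have /andP[X0 X1] := X01 K.
have w0 := W0 (y K).
have wE : W (y K) * (X K + eta) = 1 + eta.
  by rewrite WE divfK// gt_eqF// ltr_wpDl.
have XW1 : W (y K) * X K <= 1 + eta.
  by rewrite -wE ler_pM2l// lerDl ltW.
have XW : W (y K) * X K <= 1.
  rewrite WE mulrAC ler_pdivrMr ?ltr_wpDl// mul1r mulrDl mul1r lerD2l.
  by rewrite ler_piMr// ltW.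
have ne : (n - e)%:R = (n - q)%:R + (q - e)%:R :> R.
  by rewrite -natrD addnBA// subnK// ltnW.
move: ap; rewrite ne.
have Wp : 0 <= W (y K) ^+ p by rewrite exprn_ge0 ?ltW.
have h2 : W (y K) * X K / (1 + eta) <= 1 by rewrite ler_pdivrMr// mul1r.
rewrite !exprS.
move: h2 Wp XW w0 X0 X1 (ler0n R (n - q)) (ler0n R (q - e)) (ler0n R p.+1).
move: (W (y K) ^+ p) => wp.
move: (W (y K)) (X K) ((n - q)%:R : R) ((q - e)%:R : R).
move: (p.+1%:R : R) => p' w x b c h2 wp0 XW w0 x0 x1 b0' c0 p0 ap.
rewrite (_ : p' * (w * (w * wp)) / (1 + eta) * ((1 - x) * x) =
  p' * (w * wp) * ((1 - x) * (w * x / (1 + eta)))); last by ring.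
have h3 : p' * (w * wp) * ((1 - x) * (w * x / (1 + eta))) <=
    p' * (w * wp) * ((1 - x) * 1).
  apply: ler_wpM2l; first by rewrite !mulr_ge0// ltW.
  by apply: ler_wpM2l => //; rewrite subr_ge0.
have h4 : (b + c - p') * (w * x * wp) <= (b + c - p') * (1 * wp).
  by apply: ler_wpM2l => //; exact: ler_wpM2r.
lra.
Qed.

(** The bound is the value of the [s]-th negative moment of a beta variable
    with parameters [s + 1] and [q - e], namely a binomial coefficient. *)
Lemma moment_bound (h : U) : stab e h ->
  esp nu (fun K => W (y K *m umx h) ^+ (n - q).-1) <= 2 ^+ n.
Proof.
move=> sh; rewrite (@esp_row_rot (fun v => W v ^+ (n - q).-1))//; last exact: bmeas_W.
pose b := (n - q)%N; pose a := (n - e)%N.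
have b0 : (0 < b)%N by rewrite subn_gt0.
have ba : (b <= a)%N by exact: leq_sub2l.
have rec p : (p <= b.-1)%N ->
    esp nu (fun K => W (y K) ^+ p) * (b.-1 ^_ p)%:R <= (a.-1 ^_ p)%:R.
  elim: p => [_|p ih pb].
    rewrite !ffactn0 mulr1 -[leRHS](esp_cst nu); apply: (full_le_esp mH nuH).
    - exact: bmeas_W.
    - exact: bmeas_cst.
    - by move=> K _; rewrite expr0.
  have pa : (p < a.-1)%N by apply: leq_trans pb _; rewrite -!subn1 leq_sub2r.
  have eqb k : (p < k.-1)%N -> k%:R - p.+1%:R = (k.-1 - p)%:R :> R.
    by case: k => // k /= pk; rewrite -natrB//= ltnW.
  have [] := esp_W_rec p; rewrite -/a -/b (eqb _ pa); last by rewrite ltNge ler0n.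
  rewrite (eqb _ pb) => rec; rewrite !ffactnSr !natrM.
  rewrite mulrCA mulrA [leLHS]mulrC.
  rewrite mulrCA; apply: (@le_trans _ _ ((b.-1 ^_ p)%:R *
     ((a.-1 - p)%:R * esp nu (fun K => W (y K) ^+ p)))).
    by apply: ler_wpM2l => //; rewrite mulrC.
  rewrite mulrCA [leRHS]mulrC; apply: ler_wpM2l => //.
  by rewrite mulrC; apply: ih; exact: ltnW.
have := rec b.-1 (leqnn _); rewrite ffactnn -bin_ffact natrM ler_pM2r.
  move=> /le_trans; apply; rewrite -natrX ler_nat.
  apply: leq_trans (_ : 2 ^ a.-1 <= _)%N; last first.
    by rewrite leq_exp2l// (leq_trans (leq_pred _))// leq_subr.
  rewrite (Pascal 1 1) (bigD1 (inord b.-1))//= !exp1n !muln1.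
  rewrite inordK ?leq_addr// ltnS -!subn1 leq_sub2r//.
by rewrite ltr0n fact_gt0.
Qed.

End moment.

(** * Exposing the trajectory of the word step by step *)

Section letters.
Context {r : nat}.

Definition flip (x : 'I_r * bool) : 'I_r * bool := (x.1, ~~ x.2).

Lemma flipK : involutive flip.
Proof. by case=> i s; rewrite /flip/= negbK. Qed.

Lemma flip_neq x : flip x != x.
Proof. by case: x => i [] /=; apply/eqP => -[]. Qed.

Lemma flip_inj : injective flip. Proof. exact: (can_inj flipK). Qed.

Lemma reduced_flip (w : word r) : reduced (map flip w) = reduced w.
Proof.
rewrite /reduced sorted_map; apply: eq_sorted => x y /=.
by rewrite -/(flip (flip x)) -/(flip x) (inj_eq flip_inj).
Qed.

Lemma reduced_nth x0 (w : word r) t : reduced w -> (t.+1 < size w)%N ->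
  nth x0 w t.+1 != flip (nth x0 w t).
Proof. by move=> /(sortedP x0) h ts; exact: h. Qed.

End letters.

Section row_span.
Context {R : realType} {n : nat}.
Local Notation V := 'rV[R[i]]_n.

Definition span (h : nat -> V) t : 'M[R[i]]_(t, n) := \matrix_(u < t) h u.

Lemma span_sub (h : nat -> V) t u : (u < t)%N -> (h u <= span h t)%MS.
Proof.
move=> ut; rewrite -[h u]/(h (Ordinal ut)).
by rewrite -(rowK (fun u : 'I_t => h u)) row_sub.
Qed.

Lemma spanP (h : nat -> V) t p (A : 'M[R[i]]_(p, n)) :
  (forall u, (u < t)%N -> (h u <= A)%MS) -> (span h t <= A)%MS.
Proof. by move=> hA; apply/row_subP => u; rewrite rowK; exact: hA. Qed.

Lemma eq_span (h h' : nat -> V) t : (forall u, (u < t)%N -> h u = h' u) ->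
  span h t = span h' t.
Proof. by move=> hh; apply/row_matrixP => u; rewrite !rowK hh. Qed.

End row_span.

Section prod_ord.
Context {R : pzSemiRingType}.

Lemma prod_ord_first k (F : nat -> R) : (0 < k)%N ->
  \prod_(j < k) F j = F 0%N * \prod_(j < k.-1) F j.+1.
Proof. by case: k => // k _; rewrite big_ord_recl. Qed.

Lemma prod_ord_last k (F : nat -> R) : (0 < k)%N ->
  \prod_(j < k) F j = (\prod_(j < k.-1) F j) * F k.-1.
Proof. by case: k => // k _; rewrite big_ord_recr. Qed.

Lemma prod_window_first k t (F : nat -> R) : (0 < k)%N -> (k <= t)%N ->
  \prod_(j < k) F (t - k + j)%N =
  F (t - k)%N * \prod_(j < k.-1) F (t - k.-1 + j)%N.
Proof.
move=> k0 kt; rewrite (prod_ord_first (fun j => F (t - k + j)%N))// addn0.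
congr *%R; apply: eq_bigr => j _; congr F.
by move: (nat_of_ord j) => c; lia.
Qed.

Lemma prod_window_last k t (F : nat -> R) : (0 < k)%N -> (k <= t)%N ->
  \prod_(j < k) F (t.+1 - k + j)%N =
  (\prod_(j < k.-1) F (t - k.-1 + j)%N) * F t.
Proof.
move=> k0 kt; rewrite (prod_ord_last (fun j => F (t.+1 - k + j)%N))//.
have -> : (t.+1 - k = t - k.-1)%N by rewrite -[in LHS](prednK k0) subSS.
by rewrite subnK// (leq_trans (leq_pred k)).
Qed.

End prod_ord.

Section trajectory.
Context {R : realType} {n r : nat}.
Local Notation C := R[i].
Local Notation U := (unitary R n).
Local Notation V := 'rV[C]_n.
Local Notation Gam := (r.-tuple U).
Variables (x0 : 'I_r * bool) (k l : nat) (v : nat -> V) (e2 : R).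
Hypotheses (k0 : (0 < k)%N) (l0 : (0 < l)%N) (e20 : 0 < e2).
Let N := (k * l.+1)%N.
Hypothesis Nn : (N <= n)%N.
Let s := (n - N)%N.

Definition act (G : Gam) (x : 'I_r * bool) : U :=
  if x.2 then tnth G x.1 else (tnth G x.1)^-1%g.

Definition wprod (w : word r) (G : Gam) : U := (\prod_(x <- w) act G x)%g.

(** The time [t = k * c + j] stands for the vector number [j] after the first
    [c] letters. *)
Definition traj (w : word r) (G : Gam) (t : nat) : V :=
  v (t %% k)%N *m umx (wprod (take (t %/ k)%N w) G).

(** The letter that produces the vector at time [t]; this is meaningful for
    [k <= t] only. *)
Definition letter (w : word r) (t : nat) := nth x0 w (t %/ k).-1.

Lemma traj_start w G t : (t < k)%N -> traj w G t = v t.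
Proof.
by move=> tk; rewrite /traj divn_small// modn_small// take0 /wprod big_nil mulmx1.
Qed.

Lemma traj_step w G t : size w = l -> (k <= t < N)%N ->
  traj w G t = traj w G (t - k) *m umx (act G (letter w t)).
Proof.
move=> wl /andP[kt tN]; rewrite /traj /letter.
have -> : ((t - k) %% k = t %% k)%N.
  by rewrite -{2}(subnK kt) modnDr.
have td : (t %/ k = ((t - k) %/ k).+1)%N.
  by rewrite -{1}(subnK kt) divnDr ?dvdnn// divnn k0 addn1.
have ts : (((t - k) %/ k) < size w)%N.
  by rewrite wl -ltnS -td ltn_divLR// mulnC.
by rewrite td (take_nth x0)// /wprod -cats1 big_cat big_seq1 umxM mulmxA.
Qed.

Lemma act_flip G x : act (tinv G) (flip x) = act G x.
Proof. by case: x => i [] /=; rewrite /act/= tnth_tinv// invgK. Qed.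

Lemma wprod_flip w G : wprod (map flip w) (tinv G) = wprod w G.
Proof. by rewrite /wprod big_map; apply: eq_bigr => x _; rewrite act_flip. Qed.

Lemma traj_flip w G t : traj (map flip w) (tinv G) t = traj w G t.
Proof. by rewrite /traj -map_take wprod_flip. Qed.

Lemma letter_flip w t : size w = l -> (k <= t < N)%N ->
  letter (map flip w) t = flip (letter w t).
Proof.
move=> wl /andP[kt tN]; rewrite /letter (nth_map x0)// wl.
have t1 : (0 < t %/ k)%N by rewrite divn_gt0.
by rewrite -ltnS prednK// ltn_divLR// mulnC.
Qed.

(** Consecutive rounds never use mutually inverse letters, so that an earlier use
    of the inverse letter lies at least two rounds back. *)
Lemma letter_gap w t u : size w = l -> reduced w -> (k <= u)%N -> (u < t < N)%N ->
  letter w u = flip (letter w t) -> (u < t - k)%N.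
Proof.
move=> wl rw ku /andP[ut tN] fu.
have u1 : (0 < u %/ k)%N by rewrite divn_gt0.
have kt : (k <= t)%N by exact: leq_trans ku (ltnW ut).
have t1 : (0 < t %/ k)%N by rewrite divn_gt0.
have tl : ((t %/ k).-1 < size w)%N by rewrite wl -ltnS prednK// ltn_divLR// mulnC.
have utd : (u %/ k <= t %/ k)%N by rewrite leq_div2r// ltnW.
have ne : (u %/ k != t %/ k)%N.
  by apply/eqP => ute; move: fu; rewrite /letter ute => /esym/eqP; rewrite (negPf (flip_neq _)).
have ne1 : ((u %/ k).+1 != t %/ k)%N.
  apply/eqP => ute; have := @reduced_nth r x0 w (u %/ k).-1 rw.
  rewrite prednK// => /(_ ltac:(by move: tl; rewrite -ute)).
  by rewrite -/(letter w u) fu flipK /letter -ute/= eqxx.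
have utd2 : ((u %/ k).+2 <= t %/ k)%N.
  by rewrite ltn_neqAle ne1 ltn_neqAle ne.
rewrite ltn_subRL.
have h1 : (u < (u %/ k).+1 * k)%N by rewrite ltn_ceil.
have h2 : ((u %/ k).+2 * k <= t)%N.
  by apply: leq_trans (leq_trunc_div t k); rewrite leq_mul2r utd2 orbT.
by apply: leq_trans h2; rewrite mulSn ltn_add2l.
Qed.

(** The span of the vectors whose image under the letter [x] is determined by
    the steps before [t]: those to which [x] was applied, and those that were
    obtained by applying its inverse. *)
Definition exposed (w : word r) (h : nat -> V) (t : nat) (x : 'I_r * bool) :
    'M[C]_n :=
  (\sum_(u < t | (k <= u)%N && (letter w u == x)) <<h (u - k)%N>> +
   \sum_(u < t | (k <= u)%N && (letter w u == flip x)) <<h u>>)%MS.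

Lemma exposed_in w h t x u : (k <= u < t)%N -> letter w u = x ->
  (h (u - k)%N <= exposed w h t x)%MS.
Proof.
move=> /andP[ku ut] ux; apply: submx_trans (addsmxSl _ _).
have -> : forall m (B : 'M[C]_(m, n)) (y : V), (y <= B)%MS = (<<y>> <= B)%MS.
  by move=> *; rewrite genmxE.
by apply: (sumsmx_sup (Ordinal ut)) => //=; rewrite ku ux/=.
Qed.

Lemma exposed_out w h t x u : (k <= u < t)%N -> letter w u = flip x ->
  (h u <= exposed w h t x)%MS.
Proof.
move=> /andP[ku ut] ux; apply: submx_trans (addsmxSr _ _).
have -> : forall m (B : 'M[C]_(m, n)) (y : V), (y <= B)%MS = (<<y>> <= B)%MS.
  by move=> *; rewrite genmxE.
by apply: (sumsmx_sup (Ordinal ut)) => //=; rewrite ku ux/=.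
Qed.

Lemma exposedP w h t x p (A : 'M[C]_(p, n)) :
  (forall u, (k <= u < t)%N -> letter w u = x -> (h (u - k)%N <= A)%MS) ->
  (forall u, (k <= u < t)%N -> letter w u = flip x -> (h u <= A)%MS) ->
  (exposed w h t x <= A)%MS.
Proof.
move=> h1 h2; rewrite addsmx_sub; apply/andP; split.
  apply/sumsmx_subP => u /andP[ku /eqP ux]; rewrite genmxE h1// ku/=.
  exact: ltn_ord.
apply/sumsmx_subP => u /andP[ku /eqP ux]; rewrite genmxE h2// ku/=.
exact: ltn_ord.
Qed.

Lemma exposed_mono w h h' t x : (forall u, (u < t)%N -> h u = h' u) ->
  (exposed w h t x <= exposed w h' t.+1 x)%MS.
Proof.
move=> hh; apply: exposedP => u /andP[ku ut] ux.
  rewrite hh; last exact: leq_ltn_trans (leq_subr _ _) ut.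
  by apply: exposed_in ux; rewrite ku ltnW.
by rewrite hh//; apply: exposed_out ux; rewrite ku ltnW.
Qed.

Lemma exposed_span w h t x : (exposed w h t x <= span h t)%MS.
Proof.
apply: exposedP => u /andP[ku ut] ux; last exact: span_sub.
by apply: span_sub; exact: leq_ltn_trans (leq_subr _ _) ut.
Qed.

(** Earlier uses of the letter act on earlier vectors, and uses of its inverse
    are old enough by [letter_gap]. Hence the vector to which the letter is
    applied is at least as far from everything that this letter has met as it
    is from the vectors before it. *)
Lemma exposed_past w h t : size w = l -> reduced w -> (t < N)%N ->
  (exposed w h t (letter w t) <= span h (t - k))%MS.
Proof.
move=> wl rw tN; apply: exposedP => u /andP[ku ut] ux; apply: span_sub.
  by rewrite ltn_sub2r// (leq_ltn_trans ku).
by apply: (letter_gap wl rw ku) => //; rewrite ut.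
Qed.

Lemma exposed_flip w h t x : size w = l -> (t <= N)%N ->
  (exposed w h t (flip x) <= exposed (map flip w) h t x)%MS.
Proof.
move=> wl tN; apply: exposedP => u /andP[ku ut] ux.
  apply: exposed_in; first by rewrite ku.
  by rewrite letter_flip// ?ku ?(leq_trans ut)// ux flipK.
apply: exposed_out; first by rewrite ku.
by rewrite letter_flip// ?ku ?(leq_trans ut)// ux flipK.
Qed.

Definition stabs (m : 'I_r -> nat) : set Gam :=
  [set K | forall i, stab (m i) (tnth K i)].

Lemma stabs_subgroup m : subgroup (stabs m).
Proof.
split.
- rewrite (_ : stabs m = \bigcap_(p in [set: 'I_r * 'I_n * 'I_n])
    [set K : Gam | (p.1.2 < m p.1.1)%N ->
        sqn ((umx (tnth K p.1.1) - 1%:M) p.1.2 p.2) <= 0]); last first.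
    apply/seteqP; split=> [K sK [[i a] b] _ /= am|K sK i a am].
      have /rowP/(_ b) := sK i a am.
      by rewrite -rowE !mxE eqxx/= [b == a]eq_sym => ->; rewrite subrr sqn0.
    apply/rowP => b; have /= := sK (i, a, b) I am.
    rewrite -rowE !mxE eqxx/= [b == a]eq_sym => h; apply/eqP.
    by rewrite -subr_eq0 -sqn_eq0 eq_le h sqn_ge0.
  apply: fin_bigcap_measurable => // -[[i a] b] _ /=.
  have [am|am] := boolP (a < m i)%N; last first.
    by rewrite (_ : [set _ | _] = setT)//; apply/seteqP; split.
  rewrite (_ : [set _ | _] =
      [set K : Gam | sqn ((umx (tnth K i) - 1%:M) a b) <= 0]); last first.
    by apply/seteqP; split=> [K /=|K /= h _//]; exact.
  rewrite -[X in measurable X]setTI; apply: measurable_fun_ler => //.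
  apply: measurable_sqn.
  have mt : mxmeas (fun K : Gam => umx (tnth K i)).
    by apply/measurable_unitaryP; exact: measurable_tnth.
  by apply: (mxmeasD mt); exact: mxmeas_cst.
- by move=> K K' sK sK' i; rewrite tnth_tmul; exact: stabM.
- by move=> K sK i; rewrite tnth_tinv; exact: stabV.
Qed.

(** The state of the exposure at time [t]. Conditionally on the vectors [h]
    exposed so far, the matrix of the letter [i] is [a_i K_i b_i] where [K_i]
    is uniform among the unitary matrices that fix the first [m_i] basis
    vectors; the fields say that [a_i] and [b_i] carry these basis vectors to
    the exposed part of the domain and of the image. *)
Record consistent (w : word r) (t : nat) (m : 'I_r -> nat) (a b : Gam)
    (h : nat -> V) : Prop := Consistent {
  consistent_traj : forall K, stabs m K ->
    forall u, (u < t)%N -> traj w (tmul (tmul a K) b) u = h u ;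
  consistent_dom : forall i (j : 'I_n), (j < m i)%N ->
    ((delta_mx 0 j : V) *m umx ((tnth a i)^-1)%g <= exposed w h t (i, true))%MS ;
  consistent_im : forall i (j : 'I_n), (j < m i)%N ->
    ((delta_mx 0 j : V) *m umx (tnth b i) <= exposed w h t (i, false))%MS ;
  consistent_size : forall i, (m i <= t)%N }.

(** Replacing every matrix by its inverse exchanges domains and images, which
    reduces negative letters to positive ones. *)
Lemma consistent_flip w t m a b h : size w = l -> (t <= N)%N ->
  consistent w t m a b h ->
  consistent (map flip w) t m (tinv b) (tinv a) h.
Proof.
move=> wl tN [h1 h2 h3 h4]; split => //.
- move=> K sK u ut; rewrite -(h1 (tinv K)) //; last first.
    exact: (subgroupV (stabs_subgroup m)).
  by rewrite -[RHS]traj_flip !tinvM tinvK tmulA.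
- move=> i j jm; rewrite tnth_tinv invgK.
  by apply: submx_trans (exposed_flip _ _ wl tN); exact: h3.
- move=> i j jm; rewrite tnth_tinv.
  by apply: submx_trans (exposed_flip _ _ wl tN); exact: h2.
Qed.

(** The weight of a vector at squared distance [x] from its predecessors. The
    exponent is the largest moment that stays bounded until the last step, and
    [e2] regularizes the weight at [0]. *)
Definition psi (x : R) : R := ((x + e2)^-1) ^+ s.
Definition gap (h : nat -> V) u : R := dist2 (span h u) (h u).
Definition ends (w : word r) : set Gam := [set G |
  forall j, (j < k)%N -> dist2 (span v k) (traj w G (k * l + j)) <= e2].

Lemma ends_flip w G : ends (map flip w) (tinv G) <-> ends w G.
Proof. by split=> h j jk; have := h j jk; rewrite traj_flip. Qed.

Lemma measurable_act x : measurable_fun setT (fun G : Gam => act G x).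
Proof.
case: x => i [] /=; rewrite /act/=; first exact: measurable_tnth.
by apply: measurable_uinv; exact: measurable_tnth.
Qed.

Lemma measurable_wprod w : measurable_fun setT (fun G : Gam => wprod w G).
Proof.
elim: w => [|x w ih]; rewrite /wprod.
  by under eq_fun do rewrite big_nil; exact: measurable_cst.
under eq_fun do rewrite big_cons.
by apply: measurable_umul => //; exact: measurable_act.
Qed.

Lemma measurable_ends w : measurable (ends w).
Proof.
rewrite (_ : ends w = \bigcap_(j in [set: 'I_k])
    [set G | dist2 (span v k) (traj w G (k * l + j)) <= e2]); last first.
  apply/seteqP; split=> [G h j _|G h j jk]; first exact: h.
  by have := h (Ordinal jk) I.
apply: fin_bigcap_measurable => // j _.
rewrite -[X in measurable X]setTI; apply: measurable_fun_ler => //.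
apply: measurable_dist2; apply: mxmeasM; first exact: mxmeas_cst.
by apply/measurable_unitaryP; exact: measurable_wprod.
Qed.

Lemma psi_ge0 x : 0 <= x -> 0 <= psi x.
Proof. by move=> x1; rewrite exprn_ge0// invr_ge0 addr_ge0// ltW. Qed.

Lemma psi_le x y : 0 <= x -> x <= y -> psi y <= psi x.
Proof.
move=> x1 xy; have y1 := le_trans x1 xy.
rewrite lerXn2r ?nnegrE ?invr_ge0 ?addr_ge0 ?(ltW e20)//.
by rewrite lef_pV2 ?posrE ?ltr_wpDl// lerD2r.
Qed.

Lemma gap_ge0 h u : 0 <= gap h u. Proof. exact: dist2_ge0. Qed.

(** The bound on the conditional probability of [ends] once [t] vectors have
    been exposed: every step exchanges the factor of the vector to which a
    letter is applied against the factor of its image, at the cost of the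
    constant of the moment bound. *)
Definition bound (t : nat) (h : nat -> V) : R :=
  (2 ^+ n) ^+ (N - t) * (2 * e2) ^+ (s * k) *
  \prod_(j < k) psi (gap h (t - k + j)).

Lemma bound_ge0 t h : 0 <= bound t h.
Proof.
rewrite /bound !mulr_ge0 ?exprn_ge0 ?mulr_ge0// ?(ltW e20)//.
by apply: prodr_ge0 => j _; rewrite psi_ge0// gap_ge0.
Qed.

Lemma eq_gap h h' t : (forall u, (u <= t)%N -> h u = h' u) ->
  gap h t = gap h' t.
Proof.
move=> hh; rewrite /gap -(hh _ (leqnn t)) (@eq_span _ _ h h')// => u ut.
by apply: hh; exact: ltnW.
Qed.

(** The factors common to the bounds at times [t] and [t + 1]. *)
Definition window t h : R := \prod_(j < k.-1) psi (gap h (t - k.-1 + j)).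

Lemma window_ge0 t h : 0 <= window t h.
Proof. by apply: prodr_ge0 => j _; rewrite psi_ge0// gap_ge0. Qed.

Lemma eq_window t h h' : (k.-1 <= t)%N -> (forall u, (u < t)%N -> h u = h' u) ->
  window t h = window t h'.
Proof.
move=> kt hh; apply: eq_bigr => j _; congr psi; apply: eq_gap => u uj.
by apply: hh; apply: leq_ltn_trans uj _; rewrite -{2}(subnK kt) ltn_add2l.
Qed.

Lemma bound_first t h : (k <= t)%N -> bound t h =
  (2 ^+ n) ^+ (N - t) * (2 * e2) ^+ (s * k) *
  (psi (gap h (t - k)) * window t h).
Proof.
move=> kt; rewrite /bound; congr *%R.
exact: (prod_window_first (fun c => psi (gap h c)) k0 kt).
Qed.

Lemma bound_last t h : (k <= t < N)%N -> bound t.+1 h =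
  (2 ^+ n) ^+ (N - t).-1 * (2 * e2) ^+ (s * k) *
  (window t h * psi (gap h t)).
Proof.
move=> /andP[kt tN]; rewrite /bound subnS; congr *%R.
exact: (prod_window_last (fun c => psi (gap h c)) k0 kt).
Qed.

Definition claim (t : nat) : Prop :=
  forall w m a b h (nu : probability Gam R),
    size w = l -> reduced w -> (forall j, (j < k)%N -> h j = v j) ->
    consistent w t m a b h -> haar_on (stabs m) nu ->
    (nu [set K | ends w (tmul (tmul a K) b)] <= (bound t h)%:E)%E.

Lemma tmul_shift (a g K b : Gam) :
  tmul (tmul a (tmul g K)) b = tmul (tmul (tmul a g) K) b.
Proof. by rewrite !tmulA. Qed.

Lemma measurable_ends_at w a b :
  measurable [set K | ends w (tmul (tmul a K) b)].
Proof.
apply: (measurable_preim (f := fun K => tmul (tmul a K) b)).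
  by apply: measurable_tmul => //; exact: measurable_tmul.
exact: measurable_ends.
Qed.

(** At the end everything is exposed. If the event holds then each of the last
    [k] weights is at least [(2 * e2)^-s], so that the bound is at least one. *)
Lemma claim_last : claim N.
Proof.
move=> w m a b h nu wl rw hv cons hnu.
have mH := subgroup_measurable (stabs_subgroup m).
set E := [set K | _]; have mE : measurable E by exact: measurable_ends_at.
have [[K [sK EK]]|nE] := pselect (exists K, stabs m K /\ E K); last first.
  rewrite (full_eq_measure mH hnu.1 mE measurable0) ?measure0 ?lee_fin ?bound_ge0//.
  by move=> K sK; split=> // EK; apply: nE; exists K.
apply: (@le_trans _ _ 1%E); first exact: probability_le1.
rewrite lee_fin /bound subnn expr0 mul1r.
have e2g0 : 0 < 2 * e2 by rewrite mulr_gt0.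
have -> : (2 * e2) ^+ (s * k) = \prod_(j < k) (2 * e2) ^+ s.
  by rewrite prodr_const card_ord exprM.
rewrite -big_split/= -[leLHS](@big1_eq _ _ *%R 'I_k (index_enum _) xpredT).
apply: ler_prod => j _; rewrite ler01/=.
have -> : (N - k = k * l)%N by rewrite /N mulnS addKn.
have jN : (k * l + j < N)%N by rewrite /N mulnS addnC ltn_add2r.
have := EK j (ltn_ord j).
rewrite (consistent_traj cons sK jN) => dj.
have gj : gap h (k * l + j) <= e2.
  apply: le_trans dj; apply: dist2_sub; apply: spanP => u uk.
  rewrite -hv//; apply: span_sub; apply: leq_trans uk _.
  by apply: leq_trans (leq_addr _ _); rewrite leq_pmulr.
have g0 : 0 < gap h (k * l + j) + e2 by rewrite ltr_wpDl// gap_ge0.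
rewrite /psi -exprMn exprn_ege1// ler_pdivlMr// mul1r; lra.
Qed.

Definition upd (h : nat -> V) (t : nat) (p : V) (u : nat) : V :=
  if u == t then p else h u.

Lemma upd_lt h t p u : (u < t)%N -> upd h t p u = h u.
Proof. by move=> ut; rewrite /upd ltn_eqF. Qed.

Lemma upd_eq h t p : upd h t p t = p. Proof. by rewrite /upd eqxx. Qed.

Lemma gap_upd h t p : gap (upd h t p) t = dist2 (span h t) p.
Proof.
rewrite /gap upd_eq (@eq_span _ _ (upd h t p) h)// => u ut.
exact: upd_lt.
Qed.

Section step.
Variables (t : nat) (w : word r) (m : 'I_r -> nat) (a b : Gam) (h : nat -> V).
Variables (nu : probability Gam R) (i : 'I_r).
Hypotheses (kt : (k <= t)%N) (tN : (t < N)%N) (ih : claim t.+1).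
Hypotheses (wl : size w = l) (rw : reduced w).
Hypothesis hv : forall j, (j < k)%N -> h j = v j.
Hypothesis cons : consistent w t m a b h.
Hypothesis hnu : haar_on (stabs m) nu.
Hypothesis lE : letter w t = (i, true).

Let x : V := h (t - k)%N *m umx (tnth a i).
Let D : R := tail (m i) x.
Let ktN : (k <= t < N)%N. Proof. by rewrite kt. Qed.
Let mt : (m i <= t)%N. Proof. exact: consistent_size cons i. Qed.
Let tkt : (t - k < t)%N.
Proof. by rewrite -{2}(subn0 t) ltn_sub2l// (leq_trans k0). Qed.

Lemma lo_im : (lo (m i) x *m umx (tnth b i) <= exposed w h t (i, false))%MS.
Proof.
rewrite (lowsupp_sum (@lo_lowsupp _ _ (m i) x)) mulmx_suml summx_sub// => j jm.
by rewrite -scalemxAl scalemx_sub// (consistent_im cons).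
Qed.

Lemma lo_dom : (lo (m i) x *m umx ((tnth a i)^-1)%g <= exposed w h t (i, true))%MS.
Proof.
rewrite (lowsupp_sum (@lo_lowsupp _ _ (m i) x)) mulmx_suml summx_sub// => j jm.
by rewrite -scalemxAl scalemx_sub// (consistent_dom cons).
Qed.

(** The part of the vector that the letter has not determined yet is at least
    as large as its distance to the vectors exposed before it. *)
Lemma gap_undetermined : gap h (t - k) <= D.
Proof.
rewrite /D -nrm2_hi -(nrm2U _ ((tnth a i)^-1)%g).
have -> : hi (m i) x = x - lo (m i) x by rewrite -{2}(lohi (m i) x) addrC addKr.
rewrite mulmxBl /x umxK; apply: dist2_le; apply: submx_trans lo_dom _.
by rewrite -lE; exact: exposed_past.
Qed.

Lemma traj_next K : stabs m K -> traj w (tmul (tmul a K) b) t =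
  x *m umx (tnth K i) *m umx (tnth b i).
Proof.
move=> sK; rewrite traj_step// (consistent_traj cons)// lE /act/=.
by rewrite !tnth_tmul !umxM !mulmxA.
Qed.

Lemma expn2_ge1 : 1 <= 2 ^+ n :> R.
Proof. by rewrite exprn_ege1// ler1n. Qed.

(** If the image of the vector is already determined, both the vector and its
    image lie in the span of their predecessors and have the same weight. *)
Lemma step_determined : D = 0 ->
  (nu [set K | ends w (tmul (tmul a K) b)] <= (bound t h)%:E)%E.
Proof.
move=> D0; pose p := lo (m i) x *m umx (tnth b i).
have hi0 : hi (m i) x = 0.
  by apply/eqP; rewrite -nrm2_eq0 nrm2_hi -/D D0.
have xlo : x = lo (m i) x by rewrite -{1}(lohi (m i) x) hi0 addr0.
have hh u : (u < t)%N -> h u = upd h t p u by move=> ut; rewrite upd_lt.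
have cons' : consistent w t.+1 m a b (upd h t p).
  split.
  - move=> K sK u; rewrite ltnS leq_eqVlt => /predU1P[->|ut]; last first.
      by rewrite upd_lt// (consistent_traj cons).
    rewrite upd_eq traj_next// /p [in LHS]xlo (stab_lowsupp (sK i))//.
    exact: lo_lowsupp.
  - move=> j e em; apply: submx_trans (exposed_mono _ _ hh).
    exact: (consistent_dom cons).
  - move=> j e em; apply: submx_trans (exposed_mono _ _ hh).
    exact: (consistent_im cons).
  - by move=> j; apply: leqW; exact: (consistent_size cons).
apply: le_trans (ih wl rw _ cons' hnu) _.
  by move=> j jk; rewrite upd_lt ?hv// (leq_trans jk).
rewrite lee_fin bound_last// bound_first// -(eq_window _ hh); last first.
  exact: leq_trans (leq_pred k) kt.
have g0 : gap h (t - k) = 0.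
  by apply/eqP; rewrite eq_le gap_ge0 -{1}D0 gap_undetermined.
have g1 : gap (upd h t p) t = 0.
  apply/eqP; rewrite eq_le gap_ge0 andbT gap_upd.
  apply: le_trans (dist2_le _ (_ : (p <= _)%MS)) _.
    exact: submx_trans lo_im (exposed_span _ _ _ _).
  by rewrite subrr /nrm2 /tail big1// => j _; rewrite mxE sqn0.
rewrite g0 g1 mulrC [leRHS]mulrC; apply: ler_pM.
- by rewrite mulr_ge0 ?window_ge0// psi_ge0.
- by rewrite mulr_ge0 ?exprn_ge0// mulr_ge0// ltW.
- by rewrite mulrC.
- apply: ler_wpM2r; first by rewrite exprn_ge0// mulr_ge0// ltW.
  by rewrite ler_weXn2l ?expn2_ge1// leq_pred.
Qed.

Section undetermined.
Hypothesis D0 : 0 < D.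

Let mn : (m i < n)%N.
Proof. by apply: leq_ltn_trans mt _; exact: leq_trans tN Nn. Qed.

Let e : 'I_n := Ordinal mn.
Let m' (j : 'I_r) : nat := if j == i then (m i).+1 else m j.
Let d : C := ((Num.sqrt D)%:C)%C.
Let u : V := d^-1 *: hi (m i) x.
Let c : U := hhU (delta_mx 0 e) u.
Let q : nat := N.-1.
(** A representative of the coset of [K] modulo the matrices that also fix the
    next basis vector [e]; it depends on the image of [e] only. *)
Let sigma (K : Gam) : Gam :=
  tset i (hhU (delta_mx 0 e) (row e (umx (tnth K i)))).

Let sqnd : sqn d = D.
Proof. by rewrite /d sqnR sqr_sqrtr// ltW. Qed.

Let d0 : d != 0.
Proof. by rewrite -sqn_eq0 sqnd gt_eqF. Qed.

Let u1 : nrm2 u = 1.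
Proof.
rewrite /u /nrm2 tailZ -/(nrm2 _) nrm2_hi -/D -sqnd -sqnM mulVf//.
by rewrite -[1]/((1%:C)%C : C) sqnR expr1n.
Qed.

Let hid : hi (m i) x = d *: u.
Proof. by rewrite /u scalerA divff// scale1r. Qed.

Let sc : stab (m i) c.
Proof.
apply: stab_hhU => //; [exact: nrm2_delta|exact: hisupp_delta|].
by apply: hisuppZ; exact: hi_hisupp.
Qed.

Let ec : (delta_mx 0 e : V) *m umx c = u.
Proof. by apply: mul_hhU => //; exact: nrm2_delta. Qed.

Let stab_tset g : stab (m i) g -> stabs m (tset i g).
Proof.
by move=> sg j; rewrite tnth_tset; case: eqP => [->|_] //; exact: stab1.
Qed.

Let m'm K : stabs m' K -> stabs m K.
Proof.
move=> sK j; have := sK j; rewrite /m'; case: eqP => [->|//].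
exact: stabW.
Qed.

Let e_hhU K : (delta_mx 0 e : V) *m umx (tnth (sigma K) i) = row e (umx (tnth K i)).
Proof. by rewrite tnth_tset eqxx mul_hhU ?nrm2_delta ?nrm2_row. Qed.

Let hisupp_row K : stabs m K -> hisupp (m i) (row e (umx (tnth K i))).
Proof. by move=> sK; rewrite rowE; apply: stab_hisupp (sK i) (hisupp_delta _). Qed.

Let s_sigma K : stabs m K -> stab (m i) (tnth (sigma K) i).
Proof.
move=> sK; rewrite tnth_tset eqxx.
apply: stab_hhU; rewrite ?nrm2_delta ?nrm2_row//; first exact: hisupp_delta.
exact: hisupp_row.
Qed.

Let sigma_quot K : stabs m K -> stabs m' (tmul K (tinv (sigma K))).
Proof.
move=> sK j; rewrite tnth_tmul tnth_tinv /m'; case: (eqVneq j i) => [->|ji].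
  move=> z; rewrite ltnS leq_eqVlt => /predU1P[le|lm].
    have -> : z = e by exact: val_inj.
    by rewrite umxM mulmxA -rowE -e_hhU umxK.
  by rewrite (stabM (sK i) (stabV (s_sigma sK))).
rewrite tnth_tset (negPf ji) invg1 mulg1; exact: sK.
Qed.

Let measurable_sigma : measurable_fun setT sigma.
Proof.
apply/measurable_fun_tnthP => j.
rewrite (_ : _ \o _ = fun K => if j == i then
    hhU (delta_mx 0 e) (row e (umx (tnth K i))) else 1%g); last first.
  by apply/funext => K /=; rewrite tnth_tset.
case: (j == i); last exact: measurable_cst.
apply: measurable_hhU; rewrite ?nrm2_delta//; last exact: mxmeas_tnth_row.
by move=> K; exact: nrm2_row.
Qed.

Let sigma_inv K' K : stabs m' K' -> sigma (tmul K' K) = sigma K.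
Proof.
move=> sK'; rewrite /sigma; congr (tset i (hhU _ _)).
rewrite tnth_tmul umxM !rowE mulmxA (sK' i)//.
by rewrite /m' eqxx ltnS.
Qed.

Let sigma_out K j : j != i -> tnth (sigma K) j = 1%g.
Proof. by move=> ji; rewrite tnth_tset (negPf ji). Qed.

Let c_in : Gam := tset i c.

Let c_inE : tnth c_in i = c. Proof. by rewrite tnth_tset eqxx. Qed.

Let c_out j : j != i -> tnth c_in j = 1%g.
Proof. by move=> ji; rewrite tnth_tset (negPf ji). Qed.

Let stabs_c : stabs m c_in. Proof. exact: stab_tset. Qed.

Let a' : Gam := tmul a (tinv c_in).

(** The vector exposed at time [t]: its low part is determined and its high part
    is moved to the uniform direction [row e K_i]. *)
Let image (K : Gam) : V :=
  lo (m i) x *m umx (tnth b i) + d *: (row e (umx (tnth K i)) *m umx (tnth b i)).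

Let x_c : x *m umx (c^-1)%g = lo (m i) x + d *: (delta_mx 0 e : V).
Proof.
rewrite -{1}(lohi (m i) x) mulmxDl hid -scalemxAl -ec umxK.
by rewrite (stab_lowsupp (stabV sc) (@lo_lowsupp _ _ _ _)).
Qed.

Let consistent_next K : stabs m K ->
  consistent w t.+1 m' a' (tmul (sigma K) b) (upd h t (image K)).
Proof.
move=> sK; clearbody c_in sigma.
have hh v' : (v' < t)%N -> h v' = upd h t (image K) v'.
  by move=> vt; rewrite upd_lt.
have grow y j : (exposed w h t (j, y) <=
    exposed w (upd h t (image K)) t.+1 (j, y))%MS by exact: exposed_mono.
have aE : tnth a' i = (tnth a i * c^-1)%g.
  by rewrite /a' tnth_tmul tnth_tinv c_inE.
have bE : tnth (tmul (sigma K) b) i = (tnth (sigma K) i * tnth b i)%g.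
  by rewrite tnth_tmul.
split.
- move=> K' sK' u'.
  have -> : tmul (tmul a' K') (tmul (sigma K) b) =
      tmul (tmul a (tmul (tmul (tinv c_in) K') (sigma K))) b.
    by rewrite /a' !tmulA.
  set K2 := tmul (tmul _ K') _.
  have sK2 : stabs m K2.
    apply: (subgroupM (stabs_subgroup m)); last first.
      move=> j; case: (eqVneq j i) => [->|ji]; first exact: s_sigma.
      by rewrite sigma_out//; exact: stab1.
    apply: (subgroupM (stabs_subgroup m)); last exact: m'm.
    exact: (subgroupV (stabs_subgroup m)).
  rewrite ltnS leq_eqVlt => /predU1P[->|ut]; last first.
    by rewrite upd_lt// (consistent_traj cons).
  have K2E : tnth K2 i = (c^-1 * tnth K' i * tnth (sigma K) i)%g.
    rewrite /K2 (tnth_tmul _ (sigma K)) (tnth_tmul _ K') tnth_tinv.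
    by rewrite c_inE.
  rewrite upd_eq traj_next// K2E.
  rewrite !umxM !mulmxA x_c !mulmxDl /image -!scalemxAl.
  have lo' := @lo_lowsupp _ _ (m i) x.
  have sKi : stab (m i) (tnth K' i) by have := @m'm K' sK'; exact.
  have sKe : (delta_mx 0 e : V) *m umx (tnth K' i) = delta_mx 0 e.
    by have := sK' i; rewrite /m' eqxx; apply; exact: ltnSn.
  by rewrite (stab_lowsupp sKi lo') (stab_lowsupp (s_sigma sK) lo') sKe e_hhU.
- move=> j z; rewrite /m'; case: (eqVneq j i) => [->|ji] lm; last first.
    rewrite /a' tnth_tmul tnth_tinv c_out// invg1 mulg1.
    by apply: submx_trans (grow _ _); exact: (consistent_dom cons).
  rewrite aE invMg invgK umxM mulmxA.
  move: lm; rewrite ltnS leq_eqVlt => /predU1P[le|lm]; last first.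
    rewrite (sc lm); apply: submx_trans (grow _ _).
    exact: (consistent_dom cons).
  have -> : z = e by exact: val_inj.
  rewrite ec /u -scalemxAl scalemx_sub//.
  have -> : hi (m i) x = x - lo (m i) x by rewrite -{2}(lohi (m i) x) addrC addKr.
  rewrite mulmxBl /x umxK addmx_sub//; last first.
    by rewrite eqmx_opp; apply: submx_trans (grow _ _); exact: lo_dom.
  rewrite (hh _ tkt); apply: exposed_in lE; rewrite kt/=; exact: ltnSn.
- move=> j z; rewrite /m'; case: (eqVneq j i) => [->|ji] lm; last first.
    rewrite tnth_tmul sigma_out// mul1g.
    by apply: submx_trans (grow _ _); exact: (consistent_im cons).
  rewrite bE umxM mulmxA.
  move: lm; rewrite ltnS leq_eqVlt => /predU1P[le|lm]; last first.
    rewrite (s_sigma sK lm); apply: submx_trans (grow _ _).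
    exact: (consistent_im cons).
  have -> : z = e by exact: val_inj.
  rewrite e_hhU.
  have -> : row e (umx (tnth K i)) *m umx (tnth b i) =
      d^-1 *: (image K - lo (m i) x *m umx (tnth b i)).
    by rewrite /image addrC addKr scalerA mulVf// scale1r.
  rewrite scalemx_sub// addmx_sub//; last first.
    by rewrite eqmx_opp; apply: submx_trans (grow _ _); exact: lo_im.
  rewrite -[X in (X <= _)%MS](upd_eq h t (image K)).
  by apply: exposed_out; rewrite ?kt ?ltnSn// lE.
- move=> j; rewrite /m'; case: ifP => _; first by rewrite ltnS.
  by apply: leqW; exact: (consistent_size cons).
Qed.

Let psi_scale (y : R) : 0 <= y ->
  psi (D * y) = psi D * (((y + e2 / D) / (1 + e2 / D))^-1) ^+ s.
Proof.
move=> y0; rewrite /psi -exprMn -invfM; congr (_^-1 ^+ _).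
have De : D + e2 != 0 by rewrite gt_eqF// addr_gt0.
by field; rewrite De gt_eqF.
Qed.

(** Conditioning on the coset of [K] exposes one more vector. Its distance to the
    previous ones is at least that of a uniform unit vector of size [D] to a
    subspace, so that the expected weight is at most [2 ^ n * psi D], and
    [psi D] is at most the weight of the vector that leaves the window. *)
Lemma step_undetermined :
  (nu [set K | ends w (tmul (tmul a K) b)] <= (bound t h)%:E)%E.
Proof.
clearbody c_in sigma.
have sH := stabs_subgroup m; have sH' := stabs_subgroup m'.
have mE := measurable_ends_at.
have -> : nu [set K | ends w (tmul (tmul a K) b)] =
    nu [set K | ends w (tmul (tmul a' K) b)].
  have hc := hnu.2 (tinv c_in) _ (subgroupV sH stabs_c) (mE w a b).
  apply: (etrans (esym hc)).
  by apply: (congr1 nu); apply/funext => K; rewrite /mkset /a' tmul_shift.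
have [nu' [hnu' dec]] := haar_on_coset sH sH' m'm hnu measurable_sigma
  sigma_inv sigma_quot.
have [mdec ->] := dec _ (mE w a' b).
have mq : (m i <= q)%N by rewrite (leq_trans mt)// -ltnS prednK// (leq_ltn_trans _ tN).
have qn : (q < n)%N by rewrite prednK// (leq_ltn_trans _ tN).
have rS : (\rank (span h t) <= q)%N.
  by rewrite (leq_trans (rank_leq_row _))// -ltnS prednK// (leq_ltn_trans _ tN).
have bS (j : 'I_n) : (j < m i)%N ->
    ((delta_mx 0 j : V) *m umx (tnth b i) <= span h t)%MS.
  move=> jm; apply: submx_trans (exposed_span _ _ _ _).
  exact: (consistent_im cons).
have [g sg gS] := dist2_frame mq (ltnW qn) rS bS.
pose cst := (2 ^+ n) ^+ (N - t).-1 * (2 * e2) ^+ (s * k) * window t h.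
have cst0 : 0 <= cst.
  by rewrite /cst !mulr_ge0 ?exprn_ge0 ?mulr_ge0 ?window_ge0// ltW.
pose eta := e2 / D.
have eta0 : 0 < eta by rewrite divr_gt0.
pose Wg (K : Gam) : R :=
  (((tail q (row e (umx (tnth K i)) *m umx g) + eta) / (1 + eta))^-1) ^+ s.
have sE : s = (n - q).-1 by rewrite /s /q -subnS prednK// (leq_ltn_trans _ tN).
have bW : bmeas Wg.
  apply: bmeasX; split; last first.
    exists ((1 + eta) / eta) => K; have g0 := tail_ge0 q (row e (umx (tnth K i)) *m umx g).
    have eta1 : 0 < 1 + eta by rewrite addr_gt0.
    rewrite ger0_norm ?invr_ge0 ?divr_ge0 ?addr_ge0// ?(ltW eta0)//.
    rewrite invf_div ler_pM2l// lef_pV2 ?posrE ?ltr_wpDl// lerDr//.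
  apply: measurable_invr; apply: measurable_funM => //.
  apply: measurable_funD => //; apply: measurable_tail.
  by apply: mxmeasM; [exact: mxmeas_tnth_row|exact: mxmeas_cst].
have Wge0 K : 0 <= Wg K.
  rewrite exprn_ge0// invr_ge0 divr_ge0 ?addr_ge0 ?tail_ge0//; exact: ltW.
have psiD : 0 <= psi D by rewrite psi_ge0// ltW.
have Wle : esp nu Wg <= 2 ^+ n.
  have Hst K : stabs m K -> stab e (tnth K i) by move=> sK; exact: sK.
  have Hse g' : stab e g' -> stabs m (tset i g') by exact: stab_tset.
  have := moment_bound sH hnu Hst Hse mq qn eta0 sg.
  by rewrite -sE.
apply: (@le_trans _ _ (\int[nu]_K (cst * psi D * Wg K)%:E)%E).
  apply: (full_le_integral (subgroup_measurable sH) hnu.1).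
  - exact: mdec.
  - by apply/measurable_EFinP; apply: measurable_funM => //; case: bW.
  - by [].
  - by move=> K; rewrite lee_fin; apply: mulr_ge0 (Wge0 K); exact: mulr_ge0.
  - move=> K sK.
    have -> : [set K' | ends w (tmul (tmul a' (tmul K' (sigma K))) b)] =
       [set K' | ends w (tmul (tmul a' K') (tmul (sigma K) b))].
      by apply/funext => K'; rewrite /mkset -!tmulA.
    apply: le_trans (ih wl rw _ (consistent_next sK) hnu') _.
      by move=> j jk; rewrite upd_lt ?hv// (leq_trans jk).
    rewrite lee_fin bound_last// -(eq_window _ (fun u ut => esym (@upd_lt h t (image K) u ut))); last first.
      exact: leq_trans (leq_pred k) kt.
    rewrite mulrA -/cst -mulrA; apply: ler_wpM2l => //.
    rewrite gap_upd /Wg -psi_scale ?tail_ge0//; apply: psi_le.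
      by rewrite mulr_ge0 ?tail_ge0// ltW.
    rewrite /image dist2D; last by apply: submx_trans lo_im (exposed_span _ _ _ _).
    by rewrite dist2Z sqnd ler_wpM2l// ltW.
rewrite -espE; last by apply: bmeasM => //; exact: bmeas_cst.
rewrite espZ// lee_fin bound_first//.
have cE : (2 ^+ n) ^+ (N - t) = 2 ^+ n * (2 ^+ n) ^+ (N - t).-1 :> R.
  by rewrite -exprS prednK// subn_gt0.
apply: (@le_trans _ _ (cst * psi (gap h (t - k)) * 2 ^+ n)).
  apply: ler_pM => //; first by rewrite mulr_ge0.
    by rewrite /esp Rintegral_ge0.
  apply: ler_wpM2l => //; apply: psi_le; first exact: gap_ge0.
  exact: gap_undetermined.
rewrite cE /cst le_eqVlt; apply/orP; left; apply/eqP.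
have comm (x1 x2 x3 x4 x5 : R) :
    x1 * x2 * x3 * x4 * x5 = x5 * x1 * x2 * (x4 * x3) by ring.
exact: comm.
Qed.

End undetermined.

End step.

Lemma claim_step t : (k <= t < N)%N -> claim t.+1 -> claim t.
Proof.
move=> /andP[kt tN] ih w m a b h nu wl rw hv cons hnu.
have pos w' a1 b1 : size w' = l -> reduced w' -> consistent w' t m a1 b1 h ->
    (letter w' t).2 -> (nu [set K | ends w' (tmul (tmul a1 K) b1)] <= (bound t h)%:E)%E.
  move=> wl' rw' cons'; case E : (letter w' t) => [i []]// _.
  have := tail_ge0 (m i) (h (t - k)%N *m umx (tnth a1 i)).
  rewrite le_eqVlt => /predU1P[/esym D0|D0].
    exact: step_determined kt tN ih wl' rw' hv cons' hnu E D0.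
  exact: step_undetermined kt tN ih wl' rw' hv cons' hnu E D0.
have [xt|xt] := boolP (letter w t).2; first exact: pos.
have -> : nu [set K | ends w (tmul (tmul a K) b)] =
    nu [set K | ends (map flip w) (tmul (tmul (tinv b) K) (tinv a))].
  have hV := haar_onV (stabs_subgroup m) hnu
    (measurable_ends_at (map flip w) (tinv b) (tinv a)).
  apply: etrans hV; apply: (congr1 nu); apply/funext => K; rewrite /mkset.
  apply/propext; rewrite -ends_flip !tinvM tmulA.
  by [].
apply: pos; rewrite ?size_map ?reduced_flip//.
  exact: (consistent_flip wl (ltnW tN)).
by rewrite letter_flip ?kt.
Qed.

(** There are [k * l] steps, each of which costs the factor [2 ^ n]. *)
Lemma ends_bound (w : word r) (nu : probability Gam R) :
  size w = l -> reduced w -> haar_on setT nu ->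
  (nu (ends w) <= ((2 ^+ n) ^+ (k * l) * (2 * e2) ^+ (s * k) *
     \prod_(j < k) psi (gap v j))%:E)%E.
Proof.
move=> wl rw hnu.
have claimP t : (k <= N - t)%N -> claim (N - t).
  elim: t => [_|t ih kt]; first by rewrite subn0; exact: claim_last.
  have tN : (t < N)%N by lia.
  have h : (N - t = (N - t.+1).+1)%N by lia.
  apply: claim_step; first by lia.
  by rewrite -h; apply: ih; lia.
have NE : (N - k * l = k)%N by rewrite /N mulnS addnK.
have := claimP (k * l)%N; rewrite NE => /(_ (leqnn k)) ck.
have H0 : stabs (fun=> 0%N) = setT by apply/seteqP; split.
have cons : consistent w k (fun=> 0%N) tone tone v.
  by split => // K _ u uk; rewrite traj_start.
have := ck w (fun=> 0%N) tone tone v nu wl rw (fun j _ => erefl) cons.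
rewrite H0 => /(_ hnu).
have -> : [set K | ends w (tmul (tmul tone K) tone)] = ends w.
  by apply/funext => K /=; rewrite tmul1g tmulg1.
move=> /le_trans; apply; rewrite lee_fin /bound subnn.
by rewrite (_ : N - k = k * l)%N// /N mulnS addKn.
Qed.

End trajectory.

(** * The joint law of independent Haar unitary matrices *)

Section joint_law.
Context {R : realType} {n r : nat} d (Omega : measurableType d).
Local Notation U := (unitary R n).
Local Notation Gam := (r.-tuple U).
Variables (P : probability Omega R) (G : 'I_r -> {mfun Omega >-> U}).
Hypothesis indep : mutually_independent P G.
Hypothesis haar : forall i, is_haar (distribution P (G i)).

Definition box (A : 'I_r -> set U) : set Gam :=
  [set K | forall i, A i (tnth K i)].

Definition boxes : set (set Gam) :=
  [set B | exists2 A : 'I_r -> set U, (forall i, measurable (A i)) & B = box A].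

Lemma measurable_box A : (forall i, measurable (A i)) -> measurable (box A).
Proof.
move=> mA; rewrite (_ : box A = \bigcap_(i in [set: 'I_r])
    [set K | A i (tnth K i)]); last first.
  by apply/seteqP; split=> [K h i _|K h i]; [exact: h|exact: h].
apply: fin_bigcap_measurable => // i _.
by apply: measurable_preim => //; exact: measurable_tnth.
Qed.

Lemma boxes_generate : (@measurable _ Gam) = <<s boxes >>.
Proof.
apply/seteqP; split.
- move=> B; apply: smallest_sub; first exact: smallest_sigma_algebra.
  rewrite -bigcup_seq/= => C [i _ [A mA <-]].
  apply: sub_sigma_algebra.
  exists (fun j => if j == i then A else setT).
    by move=> j; case: ifP.
  rewrite setTI; apply/seteqP; split=> [K AK j|K AK].
    by case: eqP => // ->.
  by have := AK i; rewrite eqxx.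
- apply: smallest_sub; first exact: sigma_algebra_measurable.
  by move=> B [A mA ->]; exact: measurable_box.
Qed.

Lemma boxesI : setI_closed boxes.
Proof.
move=> B1 B2 [A1 m1 ->] [A2 m2 ->].
exists (fun i => A1 i `&` A2 i); first by move=> i; exact: measurableI.
by apply/seteqP; split=> [K [h1 h2] i|K h]; [split|split=> i; have [] := h i].
Qed.

Definition jointf (o : Omega) : Gam := [tuple (G i o : U) | i < r].

Lemma measurable_jointf : measurable_fun setT jointf.
Proof.
apply/measurable_fun_tnthP => i.
rewrite (_ : _ \o _ = (fun o => G i o)); first exact: measurable_funP.
by apply/funext => o /=; rewrite tnth_mktuple.
Qed.

HB.instance Definition _ := isMeasurableFun.Build _ _ _ _
  jointf measurable_jointf.

Definition joint : {mfun Omega >-> Gam} := jointf.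

Definition joint_law : probability Gam R := distribution P joint.

Lemma joint_law_box A : (forall i, measurable (A i)) ->
  joint_law (box A) = (\big[*%E/1]_i distribution P (G i) (A i))%E.
Proof.
move=> mA; have := indep [set: 'I_r]%SET mA.
have -> : \bigcap_(i in [set` [set: 'I_r]%SET]) G i @^-1` A i =
    joint @^-1` box A.
  apply/seteqP; split=> [t h i|t h i _] /=.
    by rewrite tnth_mktuple; apply: h => /=; rewrite inE.
  by have := h i; rewrite tnth_mktuple.
move=> h; apply: (etrans h); apply: eq_bigl => i; exact: finset.in_setT.
Qed.

Lemma haar_preim i (g : U) A : measurable A ->
  distribution P (G i) [set h | A (g * h)%g] = distribution P (G i) A.
Proof.
move=> mA; rewrite -(haar i g^-1%g mA); congr (distribution _ _ _).
apply/seteqP; split=> [h Ah|_ [h Ah <-]] /=.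
  by exists (g * h)%g => //; rewrite mulKg.
by rewrite mulKVg.
Qed.

(** A translate of the joint law agrees with it on boxes by independence and by
    the invariance of each factor, and boxes are closed under intersection. *)
Lemma joint_law_haar : haar_on setT joint_law.
Proof.
split; first exact: probability_setT.
move=> h A _ mA.
have mh : measurable_fun setT (fun K : Gam => tmul h K).
  exact: measurable_tmul.
pose hm : {mfun Gam >-> Gam} := HB.pack (fun K : Gam => tmul h K)
  (isMeasurableFun.Build _ _ _ _ (fun K : Gam => tmul h K) mh).
suff : (distribution joint_law hm : probability Gam R) A = joint_law A by [].
apply: (@measure_unique _ R Gam boxes (fun=> setT) boxes_generate boxesI) => //.
- by move=> _; exists (fun=> setT) => //; apply/seteqP; split.
- by rewrite bigcup_const.
- move=> B [A' mA' ->].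
  have e1 : joint_law [set K | box A' (tmul h K)] =
      joint_law (box (fun i => [set g | A' i (tnth h i * g)%g])).
    apply: (congr1 joint_law); apply/seteqP; split=> K hK i /=.
      by have := hK i; rewrite /= tnth_tmul.
    by rewrite tnth_tmul; exact: hK.
  apply: (etrans e1); rewrite !joint_law_box//; last first.
    move=> i; apply: measurable_preim (mA' i).
    by apply: measurable_umul => //; exact: measurable_cst.
  apply: (etrans _ (esym (joint_law_box mA'))).
  by apply: eq_bigr => i _; exact: haar_preim.
- by move=> k; apply: (@le_lt_trans _ _ 1%E);
    [exact: probability_le1|exact: ltry].
Qed.

End joint_law.

(** * A net of lattice points *)

Section net.
Context {R : realType}.

(** Bernoulli's inequality with the ratio used in the net. *)
Lemma bernoulli_half (k : nat) : (0 < k)%N ->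
  2^-1 <= (1 - (2 * k%:R)^-1) ^+ k :> R.
Proof.
move=> k0; have kR : 0 < k%:R :> R by rewrite ltr0n.
pose y : R := (2 * k%:R)^-1.
have y0 : 0 <= y by rewrite invr_ge0 mulr_ge0.
have y1 : y <= 2^-1.
  by rewrite /y lef_pV2 ?posrE ?mulr_gt0// ler_pMr// ler1n.
have h j : 1 - j%:R * y <= (1 - y) ^+ j.
  elim: j => [|j ih]; first by rewrite mul0r subr0.
  rewrite exprS; apply: le_trans (_ : (1 - y) * (1 - j%:R * y) <= _).
    rewrite -natr1; have : 0 <= j%:R * y * y by rewrite !mulr_ge0.
    by nra.
  by apply: ler_wpM2l => //; lra.
apply: le_trans (h k); rewrite /y invfM mulrCA divff ?gt_eqF// mulr1; lra.
Qed.

Lemma geometric_le (x : R) B : 0 <= x -> x < 1 ->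
  \sum_(a < B) x ^+ a <= (1 - x)^-1.
Proof.
move=> x0 x1; rewrite -[leRHS]mul1r ler_pdivlMr ?subr_gt0//.
have h : (\sum_(a < B) x ^+ a) * (1 - x) = 1 - x ^+ B.
  elim: B => [|B ih]; first by rewrite big_ord0 mul0r subrr.
  by rewrite big_ord_recr/= mulrDl ih exprS; ring.
by rewrite h gerBl exprn_ge0.
Qed.

(** Each function with [\sum f <= #|I| * k] contributes at least [2^-#|I|] to
    the expansion of a product of geometric series of ratio [1 - 1/(2 k)]. *)
Lemma card_bounded_sum (I : finType) (k B : nat) : (0 < k)%N ->
  (#|[set f : {ffun I -> 'I_B * bool} |
      (\sum_i (f i).1 <= #|I| * k)%N]%SET| <= (8 * k) ^ #|I|)%N.
Proof.
move=> k0; rewrite -(ler_nat R) natrX.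
set S := [set f | _]%SET; pose x : R := 1 - (2 * k%:R)^-1.
have kR : 0 < k%:R :> R by rewrite ltr0n.
have x0 : 0 <= x.
  by rewrite subr_ge0 invf_le1 ?mulr_gt0// -natrM ler1n muln_gt0.
have x1 : x < 1 by rewrite ltrBlDr ltrDl invr_gt0 mulr_gt0.
have x1' := ltW x1.
have -> : #|S|%:R = \sum_(f in S) (1 : R).
  by rewrite sumr_const.
have one (f : {ffun I -> 'I_B * bool}) : f \in S ->
    (1 : R) <= \prod_i (2 * x ^+ (f i).1).
  rewrite finset.inE => fS.
  rewrite big_split/= prodr_const prodrXr.
  apply: le_trans (_ : 2 ^+ #|I| * x ^+ (#|I| * k) <= _).
    rewrite mulnC exprM -exprMn exprn_ege1//.
    by rewrite -ler_pdivrMl// mulr1; exact: bernoulli_half.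
  rewrite ler_pM2l ?exprn_gt0//.
  by apply: ler_wiXn2l.
apply: le_trans (ler_sum _ one) _.
apply: (@le_trans _ _
  (\sum_(f : {ffun I -> 'I_B * bool}) \prod_i (2 * x ^+ (f i).1))).
  rewrite [leLHS]big_mkcond/=; apply: ler_sum => f _; case: ifP => // _.
  by apply: prodr_ge0 => i _; rewrite mulr_ge0 ?exprn_ge0.
rewrite -(bigA_distr_bigA (fun (i : I) (j : 'I_B * bool) => 2 * x ^+ j.1)).
rewrite prodr_const lerXn2r ?nnegrE//.
  by apply: sumr_ge0 => j _; rewrite mulr_ge0 ?exprn_ge0.
rewrite -mulr_sumr.
have -> : \sum_(j : 'I_B * bool) x ^+ j.1 = \sum_(j < B) (x ^+ j + x ^+ j).
  rewrite (eq_bigr (fun j : 'I_B * bool => (fun a (_ : bool) => x ^+ a) j.1 j.2))//.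
  rewrite -(pair_bigA _ (fun (a : 'I_B) (_ : bool) => x ^+ a))/=.
  by apply: eq_bigr => a _; rewrite big_bool.
rewrite big_split/= natrM.
have := geometric_le B x0 x1.
have -> : (1 - x)^-1 = 2 * k%:R by rewrite /x opprB addrC subrK invrK.
by move: (\sum_(a < B) x ^+ a) => z; lra.
Qed.

End net.

Section sphere_net.
Context {R : realType} {n : nat}.
Local Notation C := R[i].
Local Notation V := 'rV[C]_n.

(** The net consists of the integer points of a grid of mesh [eps / sqrt M],
    where [M] is the real dimension. By Cauchy-Schwarz the coordinates of the
    point below a unit vector have sum at most [M * k], so that there are few
    of them. *)
Lemma sphere_net (D' k : nat) (eps : R) : (D'.+1 <= n)%N -> (0 < k)%N ->
  0 < eps -> eps^-1 <= k%:R ->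
  exists s : seq V, (size s <= (8 * k) ^ (2 * D'.+1))%N /\
    forall v : V, lowsupp D'.+1 v -> nrm2 v = 1 ->
      exists2 t, t \in s & nrm2 (v - t) <= eps ^+ 2.
Proof.
move=> Dn k0 e0 ek.
pose I : finType := ('I_D'.+1 * bool)%type.
have cI : #|I| = (2 * D'.+1)%N by rewrite card_prod card_ord card_bool mulnC.
pose M := #|I|; pose B := (M * k).+1.
pose c : R := Num.sqrt M%:R.
have M0 : 0 < M%:R :> R by rewrite ltr0n /M cI.
have c0 : 0 < c by rewrite sqrtr_gt0.
have cc : c ^+ 2 = M%:R by rewrite sqr_sqrtr// ltW.
pose h : R := eps / c.
have h0 : 0 < h by rewrite divr_gt0.
pose sg (p : 'I_B * bool) : R := (if p.2 then 1 else -1) * (p.1%:R * h).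
pose vec (f : {ffun I -> 'I_B * bool}) : V := \row_l
  (if (l < D'.+1)%N then (sg (f (inord l, true)) +i* sg (f (inord l, false)))%C
   else 0).
pose S := [set f : {ffun I -> 'I_B * bool} | (\sum_i (f i).1 <= M * k)%N]%SET.
exists [seq vec f | f <- enum S]; split.
  by rewrite size_map -cardE -cI; exact: card_bounded_sum.
move=> v lv v1.
pose co (u : V) (i : I) : R := let z := u 0 (widen_ord Dn i.1) in
  if i.2 then Re z else Im z.
have coE (u : V) : lowsupp D'.+1 u -> nrm2 u = \sum_i co u i ^+ 2.
  move=> lu; rewrite (eq_bigr (fun j : I => (fun l b => co u (l, b) ^+ 2) j.1 j.2)); last by case.
  rewrite -(pair_bigA _ (fun l b => co u (l, b) ^+ 2))/=.
  rewrite (eq_bigr (fun l : 'I_D'.+1 => sqn (u 0 (widen_ord Dn l)))); last first.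
    by move=> l _; rewrite big_bool.
  rewrite /nrm2 /tail (bigID (fun l : 'I_n => (l < D'.+1)%N))/=.
  rewrite [X in _ + X]big1 ?addr0; last first.
    by move=> l; rewrite -leqNgt => /lu ->; exact: sqn0.
  by rewrite (big_ord_narrow Dn).
pose a (i : I) : nat := Num.trunc (`|co v i| / h).
have aP i : (a i)%:R <= `|co v i| / h < (a i).+1%:R.
  by apply: truncn_itv; rewrite divr_ge0 ?normr_ge0 ?(ltW h0).
have sumco : \sum_i co v i ^+ 2 = 1 by rewrite -coE.
have suma : (\sum_i a i <= M * k)%N.
  rewrite -(ler_nat R) natr_sum natrM.
  apply: (@le_trans _ _ (\sum_i `|co v i| / h)).
    by apply: ler_sum => i _; have /andP[] := aP i.
  rewrite -mulr_suml ler_pdivrMr//.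
  apply: (@le_trans _ _ (\sum_i (c * co v i ^+ 2 + c^-1) / 2)).
    apply: ler_sum => i _; rewrite ler_pdivlMr// -(ler_pM2l c0).
    rewrite [leRHS]mulrDr divff ?gt_eqF// -(real_normK (num_real (co v i))).
    by have := sqr_ge0 (c * `|co v i| - 1); move: (c) `|co v i| => c' y; nra.
  rewrite -mulr_suml big_split/= -mulr_sumr sumco sumr_const -/M mulr1.
  rewrite -[_ *+ M]mulr_natr -cc /h.
  have -> : (c + c^-1 * c ^+ 2) / 2 = c by field; rewrite gt_eqF.
  have -> : c ^+ 2 * k%:R * (eps / c) = c * (k%:R * eps).
    by field; rewrite gt_eqF.
  apply: ler_peMr; first exact: ltW.
  by rewrite -ler_pdivrMr// div1r.
have aB i : (a i < B)%N.
  by rewrite ltnS; apply: leq_trans suma; rewrite (bigD1 i)//= leq_addr.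
pose f : {ffun I -> 'I_B * bool} := [ffun i => (Ordinal (aB i), 0 <= co v i)].
have lvec : lowsupp D'.+1 (v - vec f).
  by move=> l Dl; rewrite !mxE lv// ltnNge Dl/= subrr.
exists (vec f).
  apply/mapP; exists f => //; rewrite mem_enum finset.inE.
  by rewrite (eq_bigr a)// => i _; rewrite ffunE.
rewrite coE//; apply: (@le_trans _ _ (\sum_(i : I) h ^+ 2)); last first.
  rewrite sumr_const -/M -mulr_natr -cc -exprMn /h divfK ?gt_eqF//.
apply: ler_sum => -[l b] _.
have -> : co (v - vec f) (l, b) = co v (l, b) - sg (f (l, b)).
  rewrite /co !mxE /= ltn_ord.
  have -> : inord l = l by apply/val_inj; rewrite /= inordK.
  by case: b; case: (v 0 _).
have /andP[a1 a2] := aP (l, b).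
rewrite ler_pdivlMr// in a1; rewrite ltr_pdivrMr// in a2.
rewrite /sg ffunE/=; rewrite -natr1 mulrDl mul1r in a2.
move: a1 a2; move: ((a (l, b))%:R * h) (co v (l, b)) => z y.
have [y0|y0] := leP 0 y; [rewrite ger0_norm//|rewrite ltr0_norm//]; nra.
Qed.

End sphere_net.

Section chord.
Context {R : realType}.

Lemma sin_le_id (x : R) : sin x ^+ 2 <= x ^+ 2.
Proof.
have pos (y : R) : 0 <= y -> sin y ^+ 2 <= y ^+ 2.
  move=> y0.
  have dsin z : z \in `]0, y[%R -> is_derive z (1 : R) sin (cos z).
    by move=> _; exact: is_derive_sin.
  have [|c _] := MVT_segment y0 dsin.
    by apply: continuous_subspaceT => z; exact: continuous_sin.
  rewrite sin0 !subr0 => ->; rewrite exprMn ler_piMl ?sqr_ge0//.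
have [x0|x0] := leP 0 x; first exact: pos.
by rewrite -sqrrN -sinN -[leRHS]sqrrN; apply: pos; lra.
Qed.

Lemma chord_le (s t : R) :
  sqn ((cos s +i* sin s)%C - (cos t +i* sin t)%C) <= (s - t) ^+ 2.
Proof.
have -> : sqn ((cos s +i* sin s)%C - (cos t +i* sin t)%C) =
    2 - 2 * cos (s - t).
  rewrite /sqn /= cosB; have := cos2Dsin2 s; have := cos2Dsin2 t; nra.
have -> : s - t = (s - t) / 2 + (s - t) / 2 by rewrite -splitr.
rewrite cosD; have := sin_le_id ((s - t) / 2); have := cos2Dsin2 ((s - t) / 2).
move: ((s - t) / 2) => y; nra.
Qed.

End chord.

(** * Almost eigenvectors of a matrix whose spectrum is concentrated *)

Section spectrum.
Context {R : realType} {n : nat}.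
Local Notation C := R[i].
Local Notation V := 'rV[C]_n.
Local Notation U := (unitary R n).

(** Both characteristic matrices are intertwined by [Q], whose determinant can
    be cancelled. *)
Lemma char_poly_intertwined (A B Q : 'M[C]_n) : Q \in unitmx ->
  Q *m A = B *m Q -> char_poly A = char_poly B.
Proof.
rewrite unitmxE unitfE => Q0 QA; have : \det (map_mx polyC Q) != 0.
  by rewrite det_map_mx polyC_eq0.
move=> /mulIf; apply; rewrite /char_poly mulrC -!det_mulmx; congr (\det _).
rewrite /char_poly_mx mulmxBr mulmxBl -!map_mxM QA.
by rewrite scalar_mxC.
Qed.

Lemma unitary_diag (g : U) : exists (P : U) (sp : V),
  umx g = invmx P *m diag_mx sp *m P /\
  perm_eq (eigenvalues (umx g)) [seq sp 0 i | i <- enum 'I_n].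
Proof.
have gn : umx g \is normalmx.
  apply/normalmxP; have gU := umxP g.
  by rewrite (unitarymxP gU) -invmx_unitary// mulVmx// unitarymx_unit.
have gE := orthomx_spectralP gn.
have PU := spectral_unitarymx (umx g).
exists (Unitary PU), (spectral_diag (umx g)); split=> //.
apply: prod_XsubC_eq; rewrite -char_poly_eigenvalues big_map big_enum/=.
have -> : char_poly (umx g) = char_poly (diag_mx (spectral_diag (umx g))).
  apply: (char_poly_intertwined (spectral_unit (umx g))).
  have conj (A Q D : 'M[C]_n) : Q \in unitmx ->
      A = invmx Q *m D *m Q -> Q *m A = D *m Q.
    by move=> Qu ->; rewrite !mulmxA mulmxV// mul1mx.
  exact: conj (spectral_unit _) gE.
rewrite char_poly_trig ?diag_mx_is_trig//.
by apply: eq_bigr => i _; rewrite !mxE eqxx mulr1n.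
Qed.

(** The point [c] is the middle of the arc: chords are shorter than arcs. *)
Lemma nonspreadP (eps : R) (g : U) : 0 < eps -> ~ spread 2^-1 eps g ->
  exists (c : C) (P : U) (sp : V) (I : {set 'I_n}),
    [/\ sqn c = 1, umx g = invmx P *m diag_mx sp *m P, (n < 2 * #|I|)%N &
        forall i, i \in I -> sqn (sp 0 i - c) <= eps ^+ 2].
Proof.
move=> e0 /existsNP[a /negP]; rewrite -ltNge => na.
have [P [sp [gE /seq.permP pe]]] := unitary_diag g.
pose I := [set i | sp 0 i \in Defs.arc a (2 * eps)]%SET.
exists (cos (a + eps) +i* sin (a + eps))%C, P, sp, I; split=> //.
- by rewrite /sqn/= cos2Dsin2.
- rewrite -(ltr_nat R) natrM -ltr_pdivrMl//; apply: lt_le_trans na _.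
  by rewrite pe count_map ler_nat -sum1_card -sum1_count big_enum_cond/=;
     under [leqRHS]eq_bigl do rewrite finset.inE.
- move=> i; rewrite finset.inE => /set_mem[t /=]; rewrite in_itv/= => /andP[t1 t2] <-.
  apply: le_trans (chord_le _ _) _.
  by rewrite -subr_ge0 subr_sqr mulr_ge0//; lra.
Qed.

Lemma exists_annihilated (s : seq 'cV[C]_n) : (size s < n)%N ->
  exists2 x : V, x != 0 & forall y, y \in s -> x *m y = 0.
Proof.
move=> sn; pose M := \matrix_(i < n, j < size s) (nth 0 s j) i 0.
have : kermx M != 0.
  rewrite -mxrank_eq0 mxrank_ker -lt0n subn_gt0.
  by apply: leq_ltn_trans sn; exact: rank_leq_col.
move=> /rowV0Pn[x /sub_kermxP xM x0]; exists x => // y /(nthP 0)[j js <-].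
apply/matrixP => p q; rewrite !ord1.
have /matrixP/(_ 0 (Ordinal js)) := xM.
by rewrite !mxE => xM0; rewrite -[RHS]xM0; apply: eq_bigr => i _; rewrite mxE.
Qed.

(** The vector is found by counting linear conditions: [n - #|I|] to lie in the
    spectral subspace, [n - D] for the support and [size o] for orthogonality. *)
Lemma exists_almost_eigenvector (eps : R) (g P : U) (c : C) (sp : V)
    (I : {set 'I_n}) (D : nat) (o : seq V) :
  umx g = invmx P *m diag_mx sp *m P ->
  (forall i, i \in I -> sqn (sp 0 i - c) <= eps ^+ 2) ->
  (D <= n)%N -> (n + size o < #|I| + D)%N ->
  exists v : V, [/\ nrm2 v = 1, lowsupp D v,
    forall u, u \in o -> v *m (u ^t*)%sesqui = 0 &
    nrm2 (v *m g - c *: v) <= eps ^+ 2].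
Proof.
move=> gE hI Dn on.
pose s : seq 'cV[C]_n := [seq delta_mx i 0 | i <- enum (~: I)%SET]
  ++ [seq col l P | l <- [seq l : 'I_n <- enum 'I_n | (D <= l)%N]]
  ++ [seq P *m (u ^t*)%sesqui | u <- o].
have sz : (size s < n)%N.
  rewrite !size_cat !size_map -cardE.
  have -> : size [seq l : 'I_n <- enum 'I_n | (D <= l)%N] = (n - D)%N.
    rewrite size_filter -sum1_count big_enum_cond/= -(big_mkord (fun l => D <= l)%N (fun=> 1%N)).
    rewrite (big_cat_nat (n := D))//= big_nat_cond big1 ?add0n; last first.
      by move=> l /andP[/andP[_ lD] Dl]; move: lD; rewrite ltnNge Dl.
    rewrite big_nat_cond (eq_bigl (fun l => D <= l < n)%N); last first.
      by move=> l; case: (D <= l)%N; rewrite ?andbT ?andbF.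
    rewrite -[RHS]muln1 -sum_nat_const_nat [RHS]big_nat_cond.
    by apply: eq_bigl => l; rewrite andbT.
  have cI : (#|I| + #|(~: I)%SET| = n)%N by rewrite cardsC card_ord.
  have ar p q b : (p + q = n -> n + b < p + D -> q + (n - D + b) < n)%N.
    by clear -Dn; lia.
  exact: ar cI on.
have [x x0 xs] := exists_annihilated sz.
have xI i : i \notin I -> x 0 i = 0.
  move=> iI; have : x *m delta_mx i (0 : 'I_1) = 0.
    apply: xs; rewrite mem_cat; apply/orP; left; apply/mapP; exists i => //.
    by rewrite mem_enum finset.inE.
  by move=> /matrixP/(_ 0 0); rewrite -colE !mxE.
have y0 : x *m P != 0.
  by rewrite -nrm2_eq0 nrm2U nrm2_eq0.
have [a a0 nv] := normalize y0.
exists (a *: (x *m P)); split=> //.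
- move=> l Dl; rewrite mxE.
  have : x *m col l P = 0.
    apply: xs; rewrite !mem_cat; apply/orP; right; apply/orP; left.
    by apply: map_f; rewrite mem_filter Dl mem_enum.
  move=> /matrixP/(_ 0 0); rewrite !mxE => xPl.
  by rewrite [X in a * X](_ : _ = 0) ?mulr0// -[RHS]xPl; apply: eq_bigr => u _;
    rewrite mxE.
- move=> u uo; rewrite -scalemxAl -mulmxA xs ?scaler0//.
  by rewrite !mem_cat (map_f (fun u : V => P *m (u ^t*)%sesqui)) ?orbT.
set z := a *: x; have zE : a *: (x *m P) = z *m P by rewrite scalemxAl.
have zI i : i \notin I -> z 0 i = 0 by move=> iI; rewrite mxE xI// mulr0.
rewrite zE; rewrite zE nrm2U in nv; clearbody z.
have -> : z *m P *m g - c *: (z *m P) = (z *m diag_mx sp - c *: z) *m P.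
  rewrite gE !mulmxA umxK mulmxBl -scalemxAl//.
rewrite nrm2U.
rewrite -[leRHS]mulr1 -nv /nrm2 /tail mulr_sumr.
apply: ler_sum => i _; rewrite mul_mx_diag !mxE.
have [iI|iI] := boolP (i \in I).
  have -> : z 0 i * sp 0 i - c * z 0 i = (sp 0 i - c) * z 0 i.
    by ring.
  by rewrite sqnM; apply: ler_wpM2r; [exact: sqn_ge0|exact: hI].
by rewrite zI// !(mulr0, mul0r) subrr sqn0 mulr0.
Qed.

End spectrum.

Section frames.
Context {R : realType} {n : nat}.
Local Notation C := R[i].
Local Notation V := 'rV[C]_n.
Local Notation U := (unitary R n).

(** Net points close to almost eigenvectors, each of which is chosen orthogonal
    to the net points found before, are uniformly independent. *)
Lemma exists_almost_eigenframe (eps : R) (g P : U) (c : C) (sp : V)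
    (I : {set 'I_n}) (D k : nat) (s : seq V) :
  0 < eps -> eps <= 2^-1 -> sqn c = 1 ->
  umx g = invmx P *m diag_mx sp *m P ->
  (forall i, i \in I -> sqn (sp 0 i - c) <= eps ^+ 2) ->
  (D <= n)%N -> (n + k <= #|I| + D)%N ->
  (forall v : V, lowsupp D v -> nrm2 v = 1 ->
     exists2 t, t \in s & nrm2 (v - t) <= eps ^+ 2) ->
  exists h : nat -> V, forall j, (j < k)%N ->
    [/\ h j \in s, 4^-1 <= gap h j &
        dist2 (span h k) (h j *m g) <= 10 * eps ^+ 2].
Proof.
move=> e0 e1 c1 gE hI Dn nk net.
suff [h hP] : exists h : nat -> V, forall j, (j < k)%N ->
    [/\ h j \in s, 4^-1 <= gap h j &
        nrm2 (h j *m g - c *: h j) <= 10 * eps ^+ 2].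
  exists h => j jk; have [hs hg hn] := hP j jk; split=> //.
  apply: le_trans hn; apply: dist2_le.
  by apply: scalemx_sub; exact: span_sub.
have : (k <= k)%N by [].
elim: {1 3}k => [|j ih] jk; first by exists (fun=> 0).
have [h hP] := ih (ltnW jk).
have oj : (n + size [seq h u | u <- iota 0 j] < #|I| + D)%N.
  by rewrite size_map size_iota; apply: leq_trans nk; rewrite ltn_add2l.
have [v [v1 lv vo vg]] := exists_almost_eigenvector gE hI Dn oj.
have [t ts vt] := net v lv v1.
pose h' u := if u == j then t else h u.
have hh u : (u < j)%N -> h' u = h u by rewrite /h' => uj; rewrite ltn_eqF.
exists h' => u; rewrite ltnS leq_eqVlt => /orP[/eqP ->|uj]; last first.
  have [hs hg hn] := hP u uj; rewrite (@eq_gap _ _ _ h) ?hh//.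
  by move=> u' uu'; apply: hh; exact: leq_ltn_trans uj.
have tj : h' j = t by rewrite /h' eqxx.
rewrite /gap (eq_span hh) tj.
have tv2 : nrm2 (t - v) <= eps ^+ 2.
  by rewrite -[t - v]opprB /nrm2 tailN.
have e22 : eps ^+ 2 <= 4^-1 by nra.
split=> //.
  have : dist2 (span h j) v <= 2 * dist2 (span h j) t + 2 * nrm2 (v - t).
    rewrite -[X in dist2 _ X <= _](subrK t) addrC.
    apply: le_trans (dist2D_le _ _ _) _; rewrite lerD2l ler_pM2l//.
    by rewrite -[X in _ <= nrm2 X]subr0; apply: dist2_le; exact: sub0mx.
  rewrite dist2_orth ?v1; first by lra.
  move=> z /submxP[D' ->].
  rewrite trmx_mul map_mxM mulmxA.
  rewrite (_ : v *m (span h j ^t*)%sesqui = 0) ?mul0mx//.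
  apply/matrixP => p q; rewrite ord1 [RHS]mxE.
  have qj : val q \in iota 0 j by rewrite mem_iota/= add0n.
  have /matrixP/(_ 0 0) := vo (h q) (map_f h qj); rewrite mxE [RHS]mxE => hq.
  by rewrite mxE -[RHS]hq; apply: eq_bigr => l _; rewrite !mxE.
have -> : t *m g - c *: t = (v *m g - c *: v) + ((t - v) *m g - c *: (t - v)).
  rewrite mulmxBl scalerBr; move: (t *m g) (v *m g) (c *: t) (c *: v) => a b x y.
  by apply/matrixP => p q; rewrite !mxE; ring.
apply: le_trans (tailD_le _ _ _) _.
have h1 : nrm2 ((t - v) *m g - c *: (t - v)) <= 4 * eps ^+ 2.
  apply: le_trans (tailD_le _ _ _) _.
  rewrite tailN tailZ c1 mul1r.
  by have := nrm2U (t - v) g; rewrite /nrm2 in tv2 * => ->; lra.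
by rewrite /nrm2 in vg h1 *; lra.
Qed.

Lemma measure_finite_cover d (T : measurableType d)
    (mu : {measure set T -> \bar R}) (I : finType) (A : set T) (B : I -> set T)
    (b : R) : measurable A -> (forall i, measurable (B i)) ->
  A `<=` \bigcup_i B i -> (forall i, (mu (B i) <= b%:E)%E) ->
  (mu A <= (#|I|%:R * b)%:E)%E.
Proof.
move=> mA mB AB hb.
have aux (s : seq I) A' : measurable A' -> A' `<=` \bigcup_(i in [set` s]) B i ->
    (mu A' <= ((size s)%:R * b)%:E)%E.
  elim: s A' => [|i s ih] A' mA' A'B.
    by rewrite mul0r (_ : A' = set0) ?measure0//; rewrite -subset0 => x /A'B[].
  have A'E : A' = (A' `&` B i) `|` (A' `\` B i) by rewrite setUIDK.
  have mI : measurable (A' `&` B i) by exact: measurableI.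
  have mD : measurable (A' `\` B i) by exact: measurableD.
  rewrite A'E; apply: (le_trans (measureU2 mu mI mD)).
  rewrite /= -addn1 addnC natrD mulrDl mul1r EFinD; apply: leeD.
    apply: le_trans (hb i); apply: le_measure; rewrite ?inE//.
  apply: ih => //.
  move=> x [/A'B[j /=]]; rewrite inE => /orP[/eqP ->//|js xj] _.
  by exists j.
rewrite cardE; apply: aux => // x /AB[i _ xi]; exists i => //=.
by rewrite mem_enum.
Qed.

End frames.

(** * The union bound *)

Section union_bound.
Context {R : realType} {n r : nat}.
Local Notation C := R[i].
Local Notation V := 'rV[C]_n.
Local Notation U := (unitary R n).
Local Notation Gam := (r.-tuple U).

(** The union is over all [k]-tuples of net points whose gaps are at least
    [4^-1]: by [exists_almost_eigenframe] one of them is mapped close to its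
    span. *)
Lemma nonspread_bound (x0 : 'I_r * bool) (w : word r) (k D q : nat) (eps : R)
    (nu : probability Gam R) (A : set Gam) :
  reduced w -> (0 < size w)%N -> (0 < k)%N -> (k * (size w).+1 <= n)%N ->
  (0 < D <= n)%N -> (n + k <= n./2.+1 + D)%N ->
  0 < eps -> eps <= 2^-1 -> (0 < q)%N -> eps^-1 <= q%:R ->
  haar_on setT nu -> measurable A ->
  A `<=` [set g | ~ spread 2^-1 eps (wprod w g)] ->
  (nu A <= (((8 * q) ^ (2 * D * k))%:R * (2 ^+ (n * (k * size w)) *
    (80 * eps ^+ 2) ^+ ((n - k * (size w).+1) * k)))%:E)%E.
Proof.
case: D => // D rw l0 k0 kn /andP[_ Dn] nkD e0 e1 q0 eq hnu mA AS.
have [s [ss net]] := sphere_net Dn q0 e0 eq.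
set l := size w in l0 kn *; pose e2 : R := 10 * eps ^+ 2.
have e20 : 0 < e2 by rewrite mulr_gt0// exprn_gt0.
pose I : finType := {ffun 'I_k -> 'I_(size s)}.
pose fr (f : I) (j : nat) : V :=
  if insub j is Some i then nth 0 s (f i) else 0.
pose good (f : I) := forall j, (j < k)%N -> 4^-1 <= gap (fr f) j.
pose B (f : I) : set Gam := [set g | good f /\ ends k l (fr f) e2 w g].
pose b : R := 2 ^+ (n * (k * l)) * (80 * eps ^+ 2) ^+ ((n - k * l.+1) * k).
have b0 : 0 <= b by rewrite mulr_ge0 ?exprn_ge0// mulr_ge0// exprn_ge0// ltW.
have Bgood f : good f -> B f = ends k l (fr f) e2 w.
  by move=> gf; apply/seteqP; split=> [g []|g ?].
have Bbad f : ~ good f -> B f = set0.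
  by move=> gf; rewrite -subset0 => g [].
have mB f : measurable (B f).
  have [gf|gf] := pselect (good f); last by rewrite Bbad.
  by rewrite Bgood//; exact: measurable_ends.
have nuB f : (nu (B f) <= b%:E)%E.
  have [gf|gf] := pselect (good f); last first.
    by rewrite Bbad// measure0 lee_fin.
  rewrite Bgood//.
  apply: le_trans (ends_bound x0 (fr f) k0 l0 e20 kn (erefl _) rw hnu) _.
  rewrite lee_fin /b -mulrA -exprM ler_pM2l ?exprn_gt0//.
  have psig (j : 'I_k) : psi (n := n) k l e2 (gap (fr f) j) <= 4 ^+ (n - k * l.+1).
    apply: le_trans (psi_le _ _ e20 _ (gf j (ltn_ord j))) _ => //.
    rewrite /psi -/l lerXn2r ?nnegrE ?invr_ge0 ?addr_ge0 ?(ltW e20)//.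
    by rewrite -[leRHS]invrK lef_pV2 ?posrE ?addr_gt0// lerDl ltW.
  have gap0 (j : 'I_k) : 0 <= gap (fr f) j by exact: dist2_ge0.
  rewrite (_ : 80 * eps ^+ 2 = (2 * e2) * 4); last by rewrite /e2; ring.
  rewrite [leRHS]exprMn ler_wpM2l ?exprn_ge0 ?mulr_ge0 ?(ltW e20) ?(ltW e0)//.
  rewrite exprM -[X in _ ^+ X](card_ord k) -prodr_const.
  by apply: ler_prod => j _; rewrite psig psi_ge0.
have AB : A `<=` \bigcup_f B f.
  move=> g /AS/= /(nonspreadP e0)[c [P [sp [J [c1 gE nJ hJ]]]]].
  have nkJ : (n + k <= #|J| + D.+1)%N.
    apply: leq_trans nkD _; rewrite leq_add2r.
    by move: nJ; move: #|J| => m; lia.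
  have [h hP] := exists_almost_eigenframe e0 e1 c1 gE hJ Dn nkJ net.
  have ix (j : 'I_k) : (index (h j) s < size s)%N.
    by rewrite index_mem; have [] := hP j (ltn_ord j).
  pose f : I := [ffun j => Ordinal (ix j)].
  have fh j : (j < k)%N -> fr f j = h j.
    move=> jk; rewrite /fr insubT ffunE /= nth_index//.
    by have [] := hP j jk.
  have gapE j : (j < k)%N -> gap (fr f) j = gap h j.
    move=> jk; apply: eq_gap => u uj; apply: fh; exact: leq_ltn_trans jk.
  exists f => //; split=> [j jk|j jk].
    by rewrite gapE//; have [] := hP j jk.
  have [_ _ hd] := hP j jk.
  have jm : ((k * l + j) %% k = j)%N by rewrite mulnC modnMDl modn_small.
  have jd : ((k * l + j) %/ k = l)%N.
    by rewrite mulnC divnMDl// divn_small// addn0.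
  by rewrite /traj jm jd take_size (fh j jk) (eq_span fh).
apply: le_trans (measure_finite_cover mA mB AB nuB) _.
rewrite lee_fin ler_wpM2r//.
by rewrite ler_nat card_ffun !card_ord expnM leq_exp2r.
Qed.

End union_bound.

(** * Measurability of the set of matrices that are not spread *)

Section polar.
Context {R : realType}.

Definition eix (t : R) : R[i] := (cos t +i* sin t)%C.

Lemma polar (z : R[i]) : sqn z = 1 ->
  exists p : R, 0 <= p <= 1 /\ z = eix (2 * pi * p).
Proof.
case: z => x y; rewrite /sqn/= => xy1.
have x1 : -1 <= x <= 1.
  by have y2 := sqr_ge0 y; apply/andP; split; nra.
have [/andP[a0 api] ca] := acos_def x1.
have pi0 : 0 < pi :> R := pi_gt0 R.
have sa := sin_acos x1.
have y2 : 1 - x ^+ 2 = y ^+ 2 by lra.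
rewrite y2 sqrtr_sqr in sa.
pose u := acos x / (2 * pi).
have tp0 : 0 < 2 * pi :> R by rewrite mulr_gt0.
have u0 : 0 <= u by apply: divr_ge0 => //; exact: ltW.
have u1 : u <= 2^-1 by rewrite ler_pdivrMr//; lra.
have uE : 2 * pi * u = acos x by rewrite mulrC divfK ?gt_eqF.
have [y0|y0] := leP 0 y.
  exists u; split; first by lra.
  by rewrite uE /eix ca sa ger0_norm.
exists (1 - u); split; first by lra.
rewrite mulrBr mulr1 uE /eix mulr_natl cosB sinB cos2pi sin2pi ca sa ltr0_norm//.
by rewrite !mul0r !mul1r addr0 sub0r opprK.
Qed.

Lemma eixD s t : eix (s + t) = eix s * eix t.
Proof. by rewrite /eix cosD sinD; simpc; rewrite [sin s * _ + _]addrC. Qed.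

Lemma sqn_eix t : sqn (eix t) = 1.
Proof. by rewrite /sqn/= cos2Dsin2. Qed.

End polar.

Section complex_continuity.
Context {R : realType} {T : topologicalType}.
Implicit Types f g : T -> R[i].

Definition ccont f :=
  continuous (fun t => Re (f t)) /\ continuous (fun t => Im (f t)).

Lemma ccont_cst z : ccont (fun=> z).
Proof. by split; exact: cst_continuous. Qed.

Lemma ccontB f g : ccont f -> ccont g -> ccont (fun t => f t - g t).
Proof.
move=> [f1 f2] [g1 g2]; split=> t.
- rewrite (_ : (fun _ => _) = (fun t => Re (f t)) \- (fun t => Re (g t))).
    by apply: continuousB; [exact: f1|exact: g1].
  by apply/funext => u /=; case: (f u) => ? ?; case: (g u).
- rewrite (_ : (fun _ => _) = (fun t => Im (f t)) \- (fun t => Im (g t))).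
    by apply: continuousB; [exact: f2|exact: g2].
  by apply/funext => u /=; case: (f u) => ? ?; case: (g u).
Qed.

Lemma ccontM f g : ccont f -> ccont g -> ccont (fun t => f t * g t).
Proof.
move=> [f1 f2] [g1 g2]; split=> t.
- rewrite (_ : (fun _ => _) = ((fun t => Re (f t)) \* (fun t => Re (g t))) \-
    ((fun t => Im (f t)) \* (fun t => Im (g t)))).
    by apply: continuousB; apply: continuousM; [exact: f1|exact: g1|exact: f2|exact: g2].
  by apply/funext => u /=; case: (f u) => ? ?; case: (g u).
- rewrite (_ : (fun _ => _) = ((fun t => Re (f t)) \* (fun t => Im (g t))) \+
    ((fun t => Im (f t)) \* (fun t => Re (g t)))).
    by apply: continuousD; apply: continuousM; [exact: f1|exact: g2|exact: f2|exact: g1].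
  by apply/funext => u /=; case: (f u) => ? ?; case: (g u).
Qed.

Lemma ccont_prod (I : Type) (s : seq I) (F : I -> T -> R[i]) :
  (forall i, ccont (F i)) -> ccont (fun t => \prod_(i <- s) F i t).
Proof.
move=> cF; elim: s => [|i s ih].
  by under eq_fun do rewrite big_nil; exact: ccont_cst.
by under eq_fun do rewrite big_cons; exact: ccontM.
Qed.

Lemma ccont_eix (h : T -> R) : continuous h -> ccont (fun t => eix (h t)).
Proof.
move=> ch; split=> t /=.
- by apply: (@continuous_comp _ _ _ h cos); [exact: ch|exact: continuous_cos].
- by apply: (@continuous_comp _ _ _ h sin); [exact: ch|exact: continuous_sin].
Qed.

Lemma continuous_sqn f : ccont f -> continuous (fun t => sqn (f t)).
Proof.
move=> [f1 f2] t.
rewrite (_ : (fun _ => _) = ((fun t => Re (f t)) \* (fun t => Re (f t))) \+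
    ((fun t => Im (f t)) \* (fun t => Im (f t)))).
  by apply: continuousD; apply: continuousM; [exact: f1|exact: f1|exact: f2|exact: f2].
by apply/funext.
Qed.

Lemma continuous_sumr (I : Type) (s : seq I) (F : I -> T -> R) :
  (forall i, continuous (F i)) -> continuous (fun t => \sum_(i <- s) F i t).
Proof.
move=> cF; elim: s => [|i s ih] t.
  by under eq_fun do rewrite big_nil; exact: cst_continuous.
under eq_fun do rewrite big_cons.
by apply: continuousD; [exact: cF|exact: ih].
Qed.

End complex_continuity.

Section determinant.
Context {R : realType} d (T : measurableType d) {n : nat}.

Lemma cmeas_prod (I : Type) (s : seq I) (F : I -> T -> R[i]) :
  (forall i, cmeas (F i)) -> cmeas (fun t => \prod_(i <- s) F i t).
Proof.
move=> mF; elim: s => [|i s ih].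
  by under eq_fun do rewrite big_nil; exact: cmeas_cst.
by under eq_fun do rewrite big_cons; exact: cmeasM.
Qed.

Lemma cmeas_det (F : T -> 'M[R[i]]_n) : mxmeas F -> cmeas (fun t => \det (F t)).
Proof.
move=> mF; apply: cmeas_sum => s; apply: cmeasM; first exact: cmeas_cst.
by apply: cmeas_prod => i; exact: mF.
Qed.

End determinant.

Lemma horner_char_poly (F : comNzRingType) n (A : 'M[F]_n) x :
  (char_poly A).[x] = \det (x%:M - A).
Proof.
rewrite -[LHS]/(horner_eval x _) -det_map_mx; congr (\det _).
apply/matrixP => i j; rewrite !mxE /= /horner_eval.
by rewrite hornerD hornerN hornerC hornerMn hornerX.
Qed.

Section nonspread_measurable.
Context {R : realType} {n : nat}.
Local Notation C := R[i].
Local Notation V := 'rV[C]_n.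
Local Notation U := (unitary R n).
Variable eps : R.
Hypotheses (n1 : (1 < n)%N) (e0 : 0 < eps).

Lemma sqn_eigenvalue (g : U) z : z \in eigenvalues (umx g) -> sqn z = 1.
Proof.
move=> zg; have : root (char_poly (umx g)) z.
  by rewrite char_poly_eigenvalues root_prod_XsubC.
rewrite -eigenvalue_root_char => /eigenvalueP[v vg v0].
have := nrm2U v g; rewrite vg /nrm2 tailZ => h.
by apply: (@mulIf _ (nrm2 v)); [rewrite nrm2_eq0|rewrite mul1r].
Qed.

(** A point [p] of the cube encodes a point [2 pi p_0] of the circle and [n]
    angles, a majority of which lie in the arc of length [2 eps] starting
    there. *)
Definition angle (p : 'rV[R]_n.+1) (j : 'I_n) : R :=
  if (j < n./2.+1)%N then 2 * pi * p 0 0 + 2 * eps * p 0 (lift ord0 j)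
  else 2 * pi * p 0 (lift ord0 j).

Definition defect (g : U) (p : 'rV[R]_n.+1) : R :=
  \sum_(k < n.+1) sqn ((char_poly (umx g)).[k%:R] -
    \prod_(j < n) (k%:R - eix (angle p j))).

Lemma defect_ge0 g p : 0 <= defect g p.
Proof. by apply: sumr_ge0 => k _; exact: sqn_ge0. Qed.

(** Two monic polynomials of degree [n] agree if they do at [n + 1] points. *)
Lemma defect_eq0 g p : defect g p = 0 <->
  char_poly (umx g) = \prod_(j < n) ('X - (eix (angle p j))%:P).
Proof.
set q := \prod_(j < n) _.
have qE (k : C) : q.[k] = \prod_(j < n) (k - eix (angle p j)).
  by rewrite horner_prod; apply: eq_bigr => j _; rewrite hornerXsubC.
split=> [/eqP|h]; last first.
  by rewrite /defect big1// => k _; rewrite h qE subrr sqn0.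
rewrite psumr_eq0; last by move=> k _; exact: sqn_ge0.
move=> /allP h; apply/eqP; rewrite -subr_eq0; apply/eqP.
pose rs := [seq k%:R : C | k <- iota 0 n.+1].
apply: (@roots_geq_poly_eq0 _ _ rs).
- apply/allP => _ /mapP[k kn ->]; rewrite mem_iota/= add0n in kn.
  have := h (Ordinal kn) (mem_index_enum _); rewrite /= sqn_eq0 subr_eq0 => /eqP e.
  by rewrite rootE hornerD hornerN qE -e subrr.
- by rewrite map_inj_uniq ?iota_uniq// => i j /eqP; rewrite eqr_nat => /eqP.
- rewrite size_map size_iota; apply: leq_trans (size_polyD _ _) _.
  have -> : q = \prod_(j <- enum 'I_n) ('X - (eix (angle p j))%:P).
    by rewrite big_enum.
  by rewrite size_polyN size_char_poly size_prod_XsubC size_enum_ord maxnn.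
Qed.

Definition cube : set 'rV[R]_n.+1 := [set p | forall i, 0 <= p 0 i <= 1].

(** The eigenvalues are listed so that those of the arc come first; for the
    converse, the list of roots of a polynomial is determined up to order. *)
Lemma nonspread_defect g :
  ~ spread 2^-1 eps g <-> exists2 p, cube p & defect g p = 0.
Proof.
split=> [/existsNP[a /negP]|[p cp /defect_eq0 pE]]; last first.
  apply/existsNP; exists (2 * pi * p 0 0); apply/negP; rewrite -ltNge.
  have /seq.permP pe : perm_eq (eigenvalues (umx g))
      [seq eix (angle p j) | j <- enum 'I_n].
    by apply: prod_XsubC_eq; rewrite -char_poly_eigenvalues pE big_map big_enum.
  rewrite ltr_pdivrMl// -natrM ltr_nat pe count_map.
  apply: (@leq_trans (2 * n./2.+1)); first by lia.
  rewrite leq_mul2l/= -[X in (X <= _)%N](card_ord n./2.+1) -sum1_card.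
  have mn : (n./2.+1 <= n)%N by lia.
  rewrite -sum1_count big_enum_cond/=.
  apply: (@leq_trans (\sum_(j < n | (j < n./2.+1)%N) 1)).
    by rewrite (big_ord_narrow mn).
  rewrite [leqRHS]big_mkcond [leqLHS]big_mkcond/=; apply: leq_sum => j _.
  case: ifP => // jm; rewrite mem_set//; exists (angle p j) => //=.
  rewrite /angle jm in_itv/= lerDl lerD2l.
  have /andP[p0 p1] := cp (lift ord0 j).
  have e2 : 0 < 2 * eps by rewrite mulr_gt0.
  by rewrite (mulr_ge0 (ltW e2) p0)/= ler_piMr// ltW.
rewrite -ltNge ltr_pdivrMl// -natrM ltr_nat.
set ar := fun z => z \in Defs.arc a (2 * eps) => na.
set ev := eigenvalues (umx g) in na.
pose l := [seq z <- ev | ar z] ++ [seq z <- ev | predC ar z].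
have lev : perm_eq l ev by apply/permPl; exact: perm_filterC.
have sl : size l = n.
  have := size_char_poly (umx g).
  by rewrite (perm_size lev) char_poly_eigenvalues size_prod_XsubC => -[].
have [p0 [p01 p0E]] := polar (sqn_eix a).
have sP (j : 'I_n) : exists s : R, 0 <= s <= 1 /\ nth 0 l j =
    eix (if (j < n./2.+1)%N then 2 * pi * p0 + 2 * eps * s else 2 * pi * s).
  have [jm|jm] := ltnP j n./2.+1; last first.
    apply: polar; apply: (@sqn_eigenvalue g); rewrite -(perm_mem lev).
    by rewrite mem_nth// sl.
  have js : (j < size [seq z <- ev | ar z])%N.
    have half c : (n < 2 * c -> n./2.+1 <= c)%N by clear; lia.
    by rewrite size_filter; apply: leq_trans jm _; exact: half.
  have : nth 0 l j \in [seq z <- ev | ar z].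
    by rewrite nth_cat js mem_nth.
  rewrite mem_filter => /andP[/set_mem[t /=]].
  rewrite in_itv/= => /andP[t1 t2] <- _.
  have e2 : 0 < 2 * eps by rewrite mulr_gt0.
  exists ((t - a) / (2 * eps)); split.
    rewrite divr_ge0 ?subr_ge0 ?(ltW e2)//= ler_pdivrMr// mul1r; lra.
  by rewrite [2 * eps * _]mulrC divfK ?gt_eqF// eixD -p0E -eixD subrKC.
have [s s01] := choice sP.
pose p : 'rV[R]_n.+1 := \row_i oapp s p0 (unlift ord0 i).
have pS j : p 0 (lift ord0 j) = s j by rewrite mxE liftK.
have pO : p 0 0 = p0 by rewrite mxE unlift_none.
exists p.
  move=> i; rewrite mxE; case: unliftP => [j _|_] //=.
  by have [] := s01 j.
apply/defect_eq0; rewrite char_poly_eigenvalues -/ev -(perm_big _ lev)/=.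
rewrite (big_nth 0) sl big_mkord; apply: eq_bigr => j _.
by rewrite /angle pS pO; have [_ ->] := s01 j.
Qed.

Lemma continuous_defect g : continuous (defect g).
Proof.
apply: continuous_sumr => k.
apply: continuous_sqn; apply: ccontB; first exact: ccont_cst.
apply: ccont_prod => j; apply: ccontB; first exact: ccont_cst.
apply: ccont_eix => p; rewrite /angle.
have cm (b : R) i : {for p, continuous (fun p : 'rV[R]_n.+1 => b * p 0 i)}.
  by apply: continuousM; [exact: cst_continuous|exact: coord_continuous].
case: (_ < _)%N; last exact: cm.
exact: (continuousD (cm _ _) (cm _ _)).
Qed.

Lemma measurable_defect p : measurable_fun setT (fun g : U => defect g p).
Proof.
apply: measurable_sum => k; apply: measurable_sqn; apply: cmeasD; last exact: cmeas_cst.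
under eq_fun do rewrite horner_char_poly.
apply: cmeas_det; apply: mxmeasD; first exact: mxmeas_cst.
by apply: mxmeasN; apply/measurable_unitaryP; exact: measurable_id.
Qed.

Definition grid (N : nat) (f : {ffun 'I_n.+1 -> 'I_N.+1}) : 'rV[R]_n.+1 :=
  \row_i ((f i)%:R / N%:R).

(** By compactness of the cube the defect attains its infimum there, and by
    continuity the infimum is approached at rational points. *)
Lemma measurable_nonspread : measurable [set g : U | ~ spread 2^-1 eps g].
Proof.
rewrite (_ : [set g | _] = \bigcap_(j : nat) \bigcup_(N : nat)
    \bigcup_(f in [set: {ffun 'I_n.+1 -> 'I_N.+2}])
      [set g | defect g (@grid N.+1 f) < j.+1%:R^-1]).
  apply: bigcapT_measurable => j; apply: bigcupT_measurable => N.
  apply: fin_bigcup_measurable => // f _.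
  rewrite (_ : [set g | _] =
      setT `&` (defect ^~ (grid f)) @^-1` `]-oo, j.+1%:R^-1[%classic).
    exact: measurable_defect.
  by rewrite setTI; apply/seteqP; split=> g /=; rewrite in_itv.
apply/seteqP; split=> g /=.
  move=> /nonspread_defect[p cp p0] j _.
  have /(@cvgrPdist_lt _ R^o)/(_ j.+1%:R^-1) := @continuous_defect g p.
  rewrite invr_gt0 ltr0n => /(_ isT)/nbhs_ballP[e /= e1 pe].
  pose N := Num.trunc e^-1.
  have N0 : 0 < N.+1%:R :> R by rewrite ltr0n.
  have Ne : N.+1%:R^-1 < e by rewrite invf_plt ?posrE// truncnS_gt.
  pose c i := Num.trunc (p 0 i * N.+1%:R).
  have cP i : (c i)%:R <= p 0 i * N.+1%:R < (c i).+1%:R.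
    by apply: truncn_itv; have /andP[pi0 _] := cp i; rewrite mulr_ge0.
  have cN i : (c i < N.+2)%N.
    rewrite ltnS -(ler_nat R); have /andP[ci _] := cP i; apply: le_trans ci _.
    by have /andP[_ pi1] := cp i; rewrite ler_piMl// ltW.
  exists N => //; exists [ffun i => Ordinal (cN i)] => //=.
  rewrite -[X in X < _]ger0_norm ?defect_ge0// -normrN -[- _]add0r -p0.
  apply: pe; split=> // q i; rewrite ord1 !mxE ffunE/= /ball/=.
  have /andP[c1 c2] := cP i; apply: le_lt_trans Ne.
  rewrite -(ler_pM2r N0) mulVf ?gt_eqF//.
  rewrite -[X in _ * X](gtr0_norm N0) -normrM mulrBl divfK ?gt_eqF//.
  by rewrite ger0_norm ?subr_ge0// lerBlDr addrC natr1 ltW.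
move=> gh; apply/nonspread_defect.
have cc : compact cube.
  rewrite (_ : cube = [set v | forall i, `[0, 1]%classic (v ord0 i)]).
    by apply: (@rV_compact R _ (fun=> `[0, 1]%classic)) => i; exact: segment_compact.
  by apply/seteqP; split=> p /= pc i; have := pc i; rewrite in_itv.
have cube0 : cube !=set0 by exists 0 => i; rewrite mxE lexx ler01.
have [p /set_mem cp pmin] := EVT_min_rV cube0 cc
  (continuous_subspaceT (@continuous_defect g)).
exists p => //; apply/eqP; rewrite eq_le defect_ge0 andbT leNgt.
apply/negP => d0.
have [N _ [f _ fd]] := gh (Num.trunc (defect g p)^-1) I.
have cf : grid f \in cube.
  apply/mem_set => i; rewrite mxE divr_ge0//= ler_pdivrMr ?ltr0n// mul1r ler_nat.
  by rewrite -ltnS.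
have := le_lt_trans (pmin _ cf) fd; apply/negP; rewrite -leNgt.
by rewrite invf_ple ?posrE// ltW// truncnS_gt.
Qed.

End nonspread_measurable.

(** * Choice of the parameters and conclusion *)

Section parameters.

(** With [L = l + 1] and [y = 4 L k], so that [y <= n < 2 y], the quadratic
    estimate is [(n - y) * (3 y - n) >= 0] up to lower order terms. *)
Lemma parametersP (n l : nat) : (0 < l)%N -> (8 * l < n)%N -> (16 < n)%N ->
  let k := (n %/ (4 * l.+1))%N in
  let D := (n - n./2.+1 + k)%N in
  let s := (n - k * l.+1)%N in
  [/\ (0 < k)%N, (k * l.+1 <= n)%N, (0 < D <= n)%N,
      (n + k <= n./2.+1 + D)%N & (D <= s)%N] /\
  ((n ^ 2 <= 16 * l.+1 * (2 * (s - D) * k))%N /\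
   (4 * (2 * D * k) + n * (k * l) + 7 * (s * k) < 3 * n ^ 2)%N).
Proof.
move=> l0 n8 n16 k D s.
have kn : (k * (4 * l.+1) <= n)%N by exact: leq_trunc_div.
have nk : (n < k.+1 * (4 * l.+1))%N by exact: ltn_ceil.
have k0 : (0 < k)%N by rewrite divn_gt0// /k; lia.
clearbody k.
have k8 : (8 * k <= n)%N by nia.
have D2 : (2 * D <= n - 1 + 2 * k)%N by rewrite /D; lia.
have D0 : (0 < D <= n)%N by rewrite /D; lia.
have nkD : (n + k <= n./2.+1 + D)%N by rewrite /D; lia.
clearbody D.
have kl : (4 * (k * l.+1) <= n)%N by nia.
have sE : (s + k * l.+1 = n)%N by rewrite /s; lia.
clearbody s.
have Ds : (D <= s)%N by lia.
split; first by split=> //; lia.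
split.
  pose y := (4 * l.+1 * k)%N.
  have sD : (n + 1 <= 2 * (s - D) + 2 * k + 2 * (k * l.+1))%N by lia.
  apply: (@leq_trans (16 * l.+1 * k * (n + 1 - 2 * k - 2 * (k * l.+1)))).
    have [d dE] : exists d, n = (y + d)%N by exists (n - y)%N; rewrite /y; lia.
    have yl : (4 * l.+1 <= y)%N by rewrite leq_pmulr.
    have ny : (n < y + 4 * l.+1)%N by rewrite /y; lia.
    have dy : (d <= y)%N by lia.
    have ky : (8 * k <= y)%N by rewrite /y; nia.
    have zy : (y + 4 * d <= 4 * (n + 1 - 2 * k - 2 * (k * l.+1)))%N.
      have yE : y = (4 * (k * l.+1))%N by rewrite /y; lia.
      by clearbody y; move: yE ky dE kl; move: (k * l.+1)%N => z; clear; lia.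
    have -> : (16 * l.+1 * k = 4 * y)%N by rewrite /y; lia.
    rewrite -mulnA mulnCA; apply: leq_trans (leq_mul (leqnn y) zy).
    rewrite dE; clear -dy; nia.
  have -> : (16 * l.+1 * (2 * (s - D) * k) = 16 * l.+1 * k * (2 * (s - D)))%N.
    by lia.
  by rewrite leq_mul2l; apply/orP; right; lia.
have h1 : (2 * D * k <= (n + 2 * k) * k)%N by rewrite leq_mul2r; lia.
have h2 : (4 * (n * (k * l)) <= n * n)%N by nia.
have h3 : (s * k <= n * k)%N by rewrite leq_mul2r; lia.
have h4 : (8 * (n * k) <= n * n)%N by rewrite mulnCA leq_mul2l k8 orbT.
have h5 : (8 * (k * k) <= n * k)%N by nia.
have h6 : (0 < n * n)%N by rewrite muln_gt0; lia.
by rewrite -mulnn; nia.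
Qed.

End parameters.

Section final_estimate.
Context {R : realType}.

(** The exponent of [eps] is less than [n ^ 2], so that the power of [2] wins
    for [eps >= 2^-1]. *)
Lemma trivial_bound (n L : nat) (eps : R) : (0 < n)%N -> (0 < L)%N ->
  2^-1 <= eps ->
  1 < 2 ^+ (3 * n ^ 2) * eps `^ (n%:R ^+ 2 / (16 * L%:R)).
Proof.
move=> n0 L0 e1.
have nR : 0 < n%:R :> R by rewrite ltr0n.
have LR : 1 <= L%:R :> R by rewrite ler1n.
set x := n%:R ^+ 2 / _.
have x0 : 0 <= x by rewrite divr_ge0 ?sqr_ge0// mulr_ge0// (le_trans _ LR).
have xn : x <= (n ^ 2)%:R.
  by rewrite natrX /x ler_piMr ?sqr_ge0// invf_le1; lra.
have e2 : 2^-1 ^+ (n ^ 2) <= eps `^ x.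
  apply: le_trans (_ : 2^-1 `^ x <= _); last by rewrite ge0_ler_powR// nnegrE; lra.
  by rewrite -powR_mulrn//; apply: ger_powR => //; lra.
apply: lt_le_trans (_ : 2 ^+ (3 * n ^ 2) * 2^-1 ^+ (n ^ 2) <= _); last first.
  by rewrite ler_pM2l// exprn_gt0.
rewrite exprM -exprMn expr_gt1 ?expn_gt0 ?n0//; rewrite !exprS expr0; lra.
Qed.

(** The net has at most [(16 / eps) ^ (2 D)] points, and [80 <= 2 ^ 7]. *)
Lemma parameters_bound (n l q k D s E : nat) (eps : R) :
  0 < eps -> eps <= 2^-1 -> q%:R <= 2 / eps -> (D <= s)%N ->
  (4 * (2 * D * k) + n * (k * l) + 7 * (s * k) < E)%N ->
  ((8 * q) ^ (2 * D * k))%:R * (2 ^+ (n * (k * l)) *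
    (80 * eps ^+ 2) ^+ (s * k)) < 2 ^+ E * eps ^+ (2 * (s - D) * k).
Proof.
move=> e0 e1 qe Ds hE; have en := lt0r_neq0 e0.
have h1 : ((8 * q) ^ (2 * D * k))%:R <=
    2 ^+ (4 * (2 * D * k)) * (eps ^+ (2 * D * k))^-1 :> R.
  rewrite natrX [2 ^+ (4 * _)]exprM -exprVn -exprMn lerXn2r ?nnegrE ?mulr_ge0 ?invr_ge0 ?(ltW e0)//.
  by rewrite natrM; lra.
have h2 : (80 * eps ^+ 2) ^+ (s * k) <= 2 ^+ (7 * (s * k)) * eps ^+ (2 * s * k).
  rewrite -mulnA [2 ^+ _]exprM [eps ^+ (2 * _)]exprM -exprMn lerXn2r ?nnegrE ?mulr_ge0 ?exprn_ge0 ?(ltW e0)//.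
  by rewrite ler_wpM2r ?exprn_ge0 ?(ltW e0)//; rewrite -natrX ler_nat.
apply: le_lt_trans (_ : 2 ^+ (4 * (2 * D * k)) * (eps ^+ (2 * D * k))^-1 *
   (2 ^+ (n * (k * l)) * (2 ^+ (7 * (s * k)) * eps ^+ (2 * s * k))) < _).
  apply: ler_pM => //; first by rewrite mulr_ge0 ?exprn_ge0 ?mulr_ge0 ?exprn_ge0 ?(ltW e0).
  by rewrite ler_pM2l// exprn_gt0.
have -> : (2 * s * k = 2 * D * k + 2 * (s - D) * k)%N by nia.
rewrite [eps ^+ (_ + _)]exprD.
have collect a b c (x y : R) : y != 0 ->
    2 ^+ a / y * (2 ^+ b * (2 ^+ c * (y * x))) = 2 ^+ (a + b + c) * x.
  by move=> y0; rewrite !exprD; field.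
rewrite collect ?expf_neq0//.
by rewrite ltr_pM2r ?exprn_gt0// ltr_eXn2l// ltr1n.
Qed.

End final_estimate.

Theorem theorem1p6 (R : realType) (r n : nat) (w : word r) (eps : R)
    (d : measure_display) (Omega : measurableType d) (P : probability Omega R)
    (G : 'I_r -> {mfun Omega >-> unitary R n}) :
  (1 <= r)%N ->
  reduced w -> w <> [::] ->
  0 < eps ->
  (maxn (8 * size w) 16 < n)%N ->
  mutually_independent P G ->
  (forall i, is_haar (distribution P (G i))) ->
  (P [set o | ~ spread 2^-1 eps (word_map w (fun i => G i o))] <
   (2 ^+ (3 * n ^ 2) *
    eps `^ (n%:R ^+ 2 / (16 * ((size w)%:R + 1))))%:E)%E.
Proof.
move=> _ rw w0 e0; rewrite gtn_max => /andP[n8 n16] indep haar.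
have l0 : (0 < size w)%N by rewrite lt0n size_eq0; exact/eqP.
have n1 : (1 < n)%N by exact: ltn_trans n16.
have x0 : 'I_r * bool by case: (w) w0 => // x.
pose A : set (r.-tuple (unitary R n)) :=
  [set g | ~ spread 2^-1 eps (wprod w g)].
have mA : measurable A.
  exact: (measurable_preim (measurable_wprod w) (measurable_nonspread n1 e0)).
have wE o : word_map w (fun i => G i o) = wprod w (jointf G o).
  by apply: eq_bigr => x _; rewrite /act tnth_mktuple.
under eq_fun do rewrite wE.
have jE (B : set (r.-tuple (unitary R n))) :
  joint_law P G B = P (jointf G @^-1` B) by [].
have AS : A `<=` [set g | ~ spread 2^-1 eps (wprod w g)] by [].
rewrite -/(jointf G @^-1` A) -jE; clearbody A.
rewrite natr1.
have [e1|e1] := leP 2^-1 eps.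
  apply: le_lt_trans (probability_le1 _ mA) _.
  by rewrite lte_fin trivial_bound// ltnW.
have [[k0 kn D0 nkD Ds] [hE h2]] := parametersP l0 n8 n16.
set k := (n %/ _)%N in k0 kn D0 nkD Ds hE h2.
set D := (n - _ + k)%N in D0 nkD Ds hE h2.
pose q := (Num.trunc eps^-1).+1.
have eV : 1 <= eps^-1 by rewrite invf_ge1//; lra.
have qe : eps^-1 <= q%:R by rewrite ltW// truncnS_gt.
have qe2 : q%:R <= 2 / eps.
  have : (Num.trunc eps^-1)%:R <= eps^-1 by rewrite truncn_le// invr_ge0 ltW.
  by rewrite /q -natr1; lra.
apply: le_lt_trans (nonspread_bound x0 rw l0 k0 kn D0 nkD e0 (ltW e1) _ qe
  (joint_law_haar indep haar) mA AS) _ => //.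
rewrite lte_fin.
apply: lt_le_trans (parameters_bound e0 (ltW e1) qe2 Ds h2) _.
rewrite ler_pM2l ?exprn_gt0// -powR_mulrn ?(ltW e0)//.
apply: ger_powR; first by rewrite e0/=; lra.
rewrite ler_pdivrMr ?mulr_gt0 ?ltr0n// -natrX -!natrM ler_nat.
by rewrite mulnC.
Qed.
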